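(* Let $J\subset I_0$, let $\epsilon:W_J\to\{\pm1\}$ be a multiplicative character, let $\lambda\in L$ and $f\in A'_J$. Then $$f(Y)F^{(\epsilon)}_{J,\lambda}=f(-r_{k'}(\lambda))\,F^{(\epsilon)}_{J,\lambda},$$ i.e. the commutative algebra $A_J'(Y)$ of difference-reflection operators acts diagonally on the $F^{(\epsilon)}_{J,\lambda}$.
   Context: **Duality data.** $V$ is a finite-dimensional real Euclidean space with inner product $\langle\cdot,\cdot\rangle$; $\alpha^\vee=2\alpha/\langle\alpha,\alpha\rangle$ for $0\ne\alpha\in V$. Affine functions on $V$ are written $v+rc$ ($v\in V$, $r\in\mathbb R$), meaning $x\mapsto\langle v,x\rangle+r$; the gradient is $v$. For $a=v+rc$ with $v\neq0$ put $a^\vee=2a/\langle v,v\rangle$ and $s_a(x)=x-a(x)v^\vee$. Affine isometries act on affine functions by $(wf)(x)=f(w^{-1}x)$. For a reduced root system $R$: $S(R)=\{\alpha+rc:\alpha\in R,r\in\mathbb Z\}$, $S(R)^\vee=\{a^\vee:a\in S(R)\}$, $P(R)=\{\lambda\in\mathrm{span}_{\mathbb R}R:\langle\lambda,\alpha^\vee\rangle\in\mathbb Z\ \forall\alpha\in R\}$. A set of duality data $(S,S',R,R',L,L')$ in $V$ (with $R$ spanning $V$) is an orthogonal direct sum (unions of root systems, sums of lattices) of irreducible ones, each of one of the forms, $R$ irreducible and reduced: (i) $S=S(R)$, $S'=S(R^\vee)$, $R'=R^\vee$, $L=P(R)$, $L'=P(R^\vee)$; (ii) $S=S'=S(R)^\vee$,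 $R'=R$, $L=L'=P(R^\vee)$; (iii) $R=\{\pm2\varepsilon_i,\ \pm\varepsilon_i\pm\varepsilon_j\ (i<j)\}$ of type $C_n$, $n\ge1$, $\varepsilon_1,\dots,\varepsilon_n$ orthonormal, $S=S'=S(R)\cup S(R)^\vee$, $R'=R$, $L=L'=\mathbb ZR^\vee$. Fix positive roots $R^+$ with simple roots $\alpha_i$ ($i\in I_0$); $W_0$ is the Weyl group with simple reflections $s_i$ and length $\ell$. Put $a_i=\alpha_i$ in components (i), $a_i=\alpha_i^\vee$ in components (ii),(iii) ($i\in I_0$). Each component with highest root $\varphi$ contributes one further simple affine root $a_i$, $i\in I\setminus I_0$: $-\varphi+c$ in case (i), $(-\varphi+c)^\vee$ in cases (ii),(iii). $S^+$ is the set of $a\in S$ positive on the alcove where all $a_i>0$ ($i\in I$), $S^-=-S^+$. $W=W_0\ltimes t(L')$ with $t(\lambda')$ translation by $\lambda'$; $\ell(w)=\#\{a\in S^+:a/2\notin S,\ wa\in S^-\}$ for $w\in W$; $\Omega=\{w\in W:\ell(w)=0\}$; $s_i=s_{a_i}$ ($i\in I$). **Labels and coefficients.** $k:S\to\mathbb R$ is constant on $W$-orbits; $k(2a):=0$ if $2a\notin S$. The dual labelling $k':S'\to\mathbb R$ is, componentwise: (i) $k'(\alpha^\vee+rc)=k(\alpha)$; (ii) $k'=k$; (iii) with $k_j$ the value of $k$ on $O_j$, where $O_1=\{\pm\varepsilon_i+rc\}$, $O_2=2O_1$, $O_3=\{\pm\varepsilon_i+(r+\tfrac12)c\}$, $O_4=2O_3$,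 $O_5=\{\pm\varepsilon_i\pm\varepsilon_j+rc\}$ ($r\in\mathbb Z$): $k_5'=k_5$, $k_1'=\frac12(k_1+k_2+k_3+k_4)$, $k_2'=\frac12(k_1+k_2-k_3-k_4)$, $k_3'=\frac12(k_1-k_2+k_3-k_4)$, $k_4'=\frac12(k_1-k_2-k_3+k_4)$. $K\supset\mathbb Q$ is a field with a homomorphism $q:\mathbb R\to K^\times$ such that $q(x)$ is transcendental over $\mathbb Q$ for $x\ne0$. $A=K[L]$, $A'=K[L']$ are group algebras with basis $e(\cdot)$; $e(\mu+rc):=q(r)e(\mu)$. Put $\tau_a=q\bigl(\frac{k(a)+k(2a)}2\bigr)$, $\tilde\tau_a=q\bigl(\frac{k(a)-k(2a)}2\bigr)$, $\tau_i=\tau_{a_i}$, $\mathbf b_a=\dfrac{\tau_a-\tau_a^{-1}+(\tilde\tau_a-\tilde\tau_a^{-1})e(a)}{1-e(2a)}$. **Operators on $A$.** $T_if=\tau_is_if+\mathbf b_{a_i}(f-s_if)$ ($i\in I$), $T(u)f=uf$ ($u\in\Omega$); $T(w)=T(u)T_{i_1}\cdots T_{i_p}$ for $w=us_{i_1}\cdots s_{i_p}$, $u\in\Omega$, $p=\ell(w)$. $Y^{\lambda'}=T(t(\lambda'))$ for dominant $\lambda'\in L'$, extended to a group homomorphism on $L'$; $f(Y)=\sum f_{\lambda'}Y^{\lambda'}$ for $f=\sum f_{\lambda'}e(\lambda')\in A'$. **Order and spectrum.** For $\lambda\in L$, $\lambda_\pm$ is the dominant/antidominant element of $W_0\lambda$;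 $\bar v(\lambda)$ is the shortest $w\in W_0$ with $w\lambda_+=\lambda$; $v(\lambda)$ the shortest $w\in W_0$ with $w\lambda=\lambda_-$. $\lambda\le\mu$ iff either $\mu_+-\lambda_+$ is a nonzero $\mathbb N_0$-combination of $(R'^\vee)^+$, or $\lambda_+=\mu_+$ and $\bar v(\lambda)\le\bar v(\mu)$ in Bruhat order. $\rho_{k'}=\frac12\sum_{\alpha\in R^+}k'(\alpha^\vee)\alpha$, $r_{k'}(\lambda)=v(\lambda)^{-1}(\lambda_--\rho_{k'})$. For $f\in A'$, $x\in V$: $f(x)=\sum f_{\lambda'}q(\langle\lambda',x\rangle)$. **Non-symmetric Macdonald polynomials.** $(E_\lambda)_{\lambda\in L}\subset A$ is the unique family with $E_\lambda\in e(\lambda)+\sum_{\mu<\lambda}Ke(\mu)$ and $f(Y)E_\lambda=f(-r_{k'}(\lambda))E_\lambda$ for $f\in A'$. Standing assumption: $k$ is such that the $r_{k'}(\lambda)$, $\lambda\in L$, are pairwise distinct (e.g. $k'>0$). **The polynomials $F$.** $W_J=\langle s_j:j\in J\rangle$ with longest element $w_J$; $A'_J=(A')^{W_J}$, $A'_J(Y)=\{f(Y):f\in A'_J\}$. $\tau_j^{(\epsilon)}=\tau_j$ if $\epsilon(s_j)=1$, $-\tau_j^{-1}$ if $\epsilon(s_j)=-1$; $\tau^{(\epsilon)}_w$ is the product over a reduced expression of $w\in W_J$. $U_J^{(\epsilon)}=(\tau^{(\epsilon)}_{w_J})^{-1}\sum_{w\in W_J}\tau_w^{(\epsilon)}T(w)$,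 $F^{(\epsilon)}_{J,\lambda}=U_J^{(\epsilon)}E_\lambda$ (the intermediate Macdonald polynomials are nonzero scalar multiples of these). *)

(* Defs.v *)
From HB Require Import structures.
From mathcomp Require Import all_boot all_order all_algebra.
From mathcomp Require Import finmap monalg.
From mathcomp Require Import boolp classical_sets functions cardinality fsbigop.
From mathcomp Require Import reals.

Set Implicit Arguments.
Unset Strict Implicit.
Unset Printing Implicit Defensive.

Import Order.TTheory GRing.Theory Num.Theory.
Local Open Scope classical_set_scope.
Local Open Scope ring_scope.

Section Euclidean.
Context {R : realType} {V : vectType R} (ip : {dot V for idfun}).

Definition coroot (v : V) : V := (2 / ip v v) *: v.

(* The pair (v, r) stands for the affine function v + rc : x |-> <v, x> + r. *)
Definition aff : Type := (V * R)%type.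

Definition aeval (a : aff) (x : V) : R := ip a.1 x + a.2.
Definition ascale (t : R) (a : aff) : aff := (t *: a.1, t * a.2).
Definition acoroot (a : aff) : aff := ascale (2 / ip a.1 a.1) a.
Definition srefl (a : aff) (x : V) : V := x - aeval a x *: coroot a.1.
Definition refl (v : V) : V -> V := srefl (v, 0).
Definition translation (t x : V) : V := t + x.

(* (wa)(x) = a(w^-1 x) for an affine isometry w, in terms of the linear part
   x |-> w x - w 0 of w; see aeval_aact. *)
Definition aact (w : V -> V) (a : aff) : aff :=
  (w a.1 - w 0, a.2 - ip (w a.1 - w 0) (w 0)).

Lemma aeval_aact (w : V -> V) (a : aff) (x : V) :
    (forall y z, ip (w y - w 0) (w z - w 0) = ip y z) ->
  aeval (aact w a) (w x) = aeval a x.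
Proof.
move=> iso_w; rewrite /aeval /= -[RHS](congr1 (+%R^~ a.2) (iso_w a.1 x)).
by rewrite [ip _ (w x - _)]linearBr /= addrA addrAC.
Qed.

(* Finite linear combinations of elements of B with coefficients in C. *)
Definition comb (C : {pred R}) (B : set V) (x : V) : Prop :=
  exists2 s : seq (R * V),
    (forall p, p \in s -> p.1 \in C /\ B p.2) & x = \sum_(p <- s) p.1 *: p.2.

Definition root_system (P : set V) : Prop :=
  [/\ finite_set P, ~ P 0,
      (forall a b, P a -> P b -> P (refl a b)) &
      (forall a b, P a -> P b -> ip b (coroot a) \is a Num.int)].

Definition reduced (P : set V) : Prop :=
  forall (a : V) (t : R), P a -> P (t *: a) -> t = 1 \/ t = -1.

Definition irreducible (P : set V) : Prop :=
  P !=set0 /\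
  forall A B : set V, P = A `|` B ->
    (forall a b, A a -> B b -> ip a b = 0) -> A = set0 \/ B = set0.

Definition dual (P : set V) : set V := coroot @` P.
Definition S_of (P : set V) : set aff :=
  [set a | P a.1 /\ a.2 \is a Num.int].
Definition dualS (A : set aff) : set aff := acoroot @` A.
Definition weights (P : set V) : set V :=
  [set x | comb predT P x /\ forall a, P a -> ip x (coroot a) \is a Num.int].

Definition Cn_short n (eps : 'I_n -> V) : set V :=
  [set x | exists (i j : 'I_n) (b c : bool),
     (i < j)%N /\ x = (-1) ^+ b *: eps i + (-1) ^+ c *: eps j].
Definition Cn_roots n (eps : 'I_n -> V) : set V :=
  [set x | exists i (b : bool), x = (-1) ^+ b *: (2 *: eps i)]
  `|` Cn_short eps.

Definition O1 n (eps : 'I_n -> V) : set aff :=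
  [set a | exists i (b : bool),
     a.1 = (-1) ^+ b *: eps i /\ a.2 \is a Num.int].
Definition O2 n (eps : 'I_n -> V) : set aff := ascale 2 @` O1 eps.
Definition O3 n (eps : 'I_n -> V) : set aff :=
  [set a | exists i (b : bool),
     a.1 = (-1) ^+ b *: eps i /\ a.2 - 2^-1 \is a Num.int].
Definition O4 n (eps : 'I_n -> V) : set aff := ascale 2 @` O3 eps.
Definition O5 n (eps : 'I_n -> V) : set aff := S_of (Cn_short eps).

(* An irreducible set of duality data of the form (i) or (ii) is determined by
   the root system R, one of the form (iii) by the orthonormal vectors. *)
Inductive shape : Type :=
| CaseI of set V
| CaseII of set V
| CaseIII n of 'I_n -> V.

Definition shape_R (c : shape) : set V :=
  match c with CaseI P | CaseII P => P | CaseIII _ eps => Cn_roots eps end.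
Definition shape_R' (c : shape) : set V :=
  match c with
  | CaseI P => dual P | CaseII P => P | CaseIII _ eps => Cn_roots eps
  end.
Definition shape_S (c : shape) : set aff :=
  match c with
  | CaseI P => S_of P
  | CaseII P => dualS (S_of P)
  | CaseIII _ eps => S_of (Cn_roots eps) `|` dualS (S_of (Cn_roots eps))
  end.
Definition shape_S' (c : shape) : set aff :=
  match c with
  | CaseI P => S_of (dual P)
  | CaseII P => dualS (S_of P)
  | CaseIII _ eps => S_of (Cn_roots eps) `|` dualS (S_of (Cn_roots eps))
  end.
Definition shape_L (c : shape) : set V :=
  match c with
  | CaseI P => weights P
  | CaseII P => weights (dual P)
  | CaseIII _ eps => comb Num.int (dual (Cn_roots eps))
  end.
Definition shape_L' (c : shape) : set V :=
  match c with
  | CaseI P => weights (dual P)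
  | CaseII P => weights (dual P)
  | CaseIII _ eps => comb Num.int (dual (Cn_roots eps))
  end.

Definition wf_shape (c : shape) : Prop :=
  match c with
  | CaseI P | CaseII P => [/\ root_system P, reduced P & irreducible P]
  | CaseIII n eps => (0 < n)%N /\ forall i j, ip (eps i) (eps j) = (i == j)%:R
  end.

(* An irreducible component with its simple roots and its highest root. *)
Record component : Type := Component {
  shp : shape;
  rk : nat;
  simple : 'I_rk -> V;
  top : V }.

Definition cpos (c : component) : set V :=
  [set a | shape_R (shp c) a /\ comb Num.nat (range (@simple c)) a].

Definition wf_component (c : component) : Prop :=
  [/\ wf_shape (shp c),
      [/\ forall i, shape_R (shp c) (@simple c i),
          free (codom (@simple c)) &
          forall a, shape_R (shp c) a ->
            comb Num.nat (range (@simple c)) a \/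
            comb Num.nat (range (@simple c)) (- a)] &
      shape_R (shp c) (top c) /\
      forall a, shape_R (shp c) a ->
        comb Num.nat (range (@simple c)) (top c - a)].

Section DualityData.
Context {m : nat} (D : 'I_m -> component).

Definition Rall : set V := [set a | exists j, shape_R (shp (D j)) a].
Definition Sall : set aff := [set a | exists j, shape_S (shp (D j)) a].
Definition Lall : set V :=
  [set x | exists2 y : 'I_m -> V,
     (forall j, shape_L (shp (D j)) (y j)) & x = \sum_j y j].
Definition L'all : set V :=
  [set x | exists2 y : 'I_m -> V,
     (forall j, shape_L' (shp (D j)) (y j)) & x = \sum_j y j].

Definition duality_data : Prop :=
  [/\ forall j, wf_component (D j),
      forall i j, i != j -> forall a b,
        shape_R (shp (D i)) a -> shape_R (shp (D j)) b -> ip a b = 0 &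
      forall x, comb predT Rall x].

Definition Rpos : set V := [set a | exists j, cpos (D j) a].

(* (R'^vee)^+ : the elements of R'^vee that are positive multiples of
   elements of R^+ (R'^vee is R or R^vee, componentwise). *)
Definition R'dual_pos : set V :=
  [set b | exists j, dual (shape_R' (shp (D j))) b /\
                     exists2 t : R, 0 < t & cpos (D j) (t *: b)].

Definition I0 : finType := {j : 'I_m & 'I_(rk (D j))}.
Definition Iaff : Type := (I0 + 'I_m)%type.

Definition normalize (c : shape) (a : aff) : aff :=
  if c is CaseI _ then a else acoroot a.

Definition asimple (i : Iaff) : aff :=
  match i with
  | inl i0 => normalize (shp (D (tag i0))) (simple (tagged i0), 0)
  | inr j => normalize (shp (D j)) (- top (D j), 1)
  end.

Definition s_ (i : Iaff) : V -> V := srefl (asimple i).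

Definition alcove : set V := [set x | forall i, 0 < aeval (asimple i) x].
Definition Spos : set aff :=
  [set a | Sall a /\ forall x, alcove x -> 0 < aeval a x].
Definition Sneg : set aff := [set a | Spos (ascale (-1) a)].

(* Groups of isometries are represented as sets of maps V -> V. *)
Definition W0 : set (V -> V) :=
  [set w | exists2 s : seq V, (forall a, a \in s -> Rall a) &
           w = foldr (fun a u => refl a \o u) id s].
Definition Waff : set (V -> V) :=
  [set w | exists u t, [/\ W0 u, L'all t & w = translation t \o u]].

Definition len (w : V -> V) : nat :=
  #|` fset_set [set a | [/\ Spos a, ~ Sall (ascale 2^-1 a) & Sneg (aact w a)]]|.

Definition Omega : set (V -> V) := [set w | Waff w /\ len w = 0%N].

Definition prod_s (s : seq Iaff) : V -> V :=
  foldr (fun i u => s_ i \o u) id s.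

Definition dominant (x : V) : Prop := forall a, Rpos a -> 0 <= ip x a.
Definition antidominant (x : V) : Prop := forall a, Rpos a -> ip x a <= 0.

Definition dom_part (x : V) : V :=
  xget 0 [set y | (exists2 w, W0 w & w x = y) /\ dominant y].
Definition antidom_part (x : V) : V :=
  xget 0 [set y | (exists2 w, W0 w & w x = y) /\ antidominant y].

Definition shortest (A : set (V -> V)) : V -> V :=
  xget (@id V) [set w | A w /\ forall u, A u -> (len w <= len u)%N].
Definition longest (A : set (V -> V)) : V -> V :=
  xget (@id V) [set w | A w /\ forall u, A u -> (len u <= len w)%N].

Definition vbar (x : V) : V -> V :=
  shortest [set w | W0 w /\ w (dom_part x) = x].
Definition vmin (x : V) : V -> V :=
  shortest [set w | W0 w /\ w x = antidom_part x].

Inductive bruhat (u : V -> V) : (V -> V) -> Prop :=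
| bruhat_refl : bruhat u u
| bruhat_step w a : bruhat u w -> Rall a -> (len w < len (refl a \o w))%N ->
    bruhat u (refl a \o w).

Definition leL (x y : V) : Prop :=
  (dom_part y - dom_part x != 0 /\
   comb Num.nat R'dual_pos (dom_part y - dom_part x))
  \/ (dom_part x = dom_part y /\ bruhat (vbar x) (vbar y)).
Definition ltL (x y : V) : Prop := leL x y /\ x <> y.

Definition labelling (k : aff -> R) : Prop :=
  forall w a, Waff w -> Sall a -> k (aact w a) = k a.

Definition dual_labelling (k k' : aff -> R) : Prop :=
  forall j, match shp (D j) with
  | CaseI P => forall a r, P a -> r \is a Num.int -> k' (coroot a, r) = k (a, 0)
  | CaseII P => forall a, shape_S' (CaseII P) a -> k' a = k a
  | CaseIII n eps => forall k1 k2 k3 k4 k5 : R,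
      (forall a, O1 eps a -> k a = k1) ->
      (forall a, O2 eps a -> k a = k2) ->
      (forall a, O3 eps a -> k a = k3) ->
      (forall a, O4 eps a -> k a = k4) ->
      (forall a, O5 eps a -> k a = k5) ->
      [/\ forall a, O1 eps a -> k' a = (k1 + k2 + k3 + k4) / 2,
          forall a, O2 eps a -> k' a = (k1 + k2 - k3 - k4) / 2,
          forall a, O3 eps a -> k' a = (k1 - k2 + k3 - k4) / 2,
          forall a, O4 eps a -> k' a = (k1 - k2 - k3 + k4) / 2 &
          forall a, O5 eps a -> k' a = k5]
  end.

Definition rho (k' : aff -> R) : V :=
  2^-1 *: \sum_(a \in Rpos) (k' (coroot a, 0) *: a).

(* v(x)^-1 (x_- - rho_{k'}) *)
Definition r_ (k' : aff -> R) (x : V) : V :=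
  xget 0 [set y | vmin x y = antidom_part x - rho k'].

Section Operators.
Context {K : fieldType} (q : R -> K) (k : aff -> R).

(* K[L] and K[L'] are the elements of the group algebra K[V] supported in L
   and in L'. Operators on K[L] are functions on K[V] of which only the
   restriction to K[L] matters. *)
Definition KV : Type := {malg K[V]}.

Definition supported (M : set V) (f : KV) : Prop :=
  forall x, x \in msupp f -> M x.

Definition e_ (a : aff) : KV := << q a.2 *g a.1 >>.

Definition gmul (f g : KV) : KV :=
  \sum_(x <- msupp f) \sum_(y <- msupp g) << f@_x * g@_y *g (x + y) >>.

Definition gact (w : V -> V) (f : KV) : KV :=
  \sum_(x <- msupp f) f@_x *: e_ (aact w (x, 0)).

Definition k2 (a : aff) : R :=
  if `[< Sall (ascale 2 a) >] then k (ascale 2 a) else 0.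
Definition tau (a : aff) : K := q ((k a + k2 a) / 2).
Definition ttau (a : aff) : K := q ((k a - k2 a) / 2).

(* Ti i f is the element tau_i s_i f + b_{a_i} (f - s_i f) of K[L]; since K[V]
   is a domain, it is determined by the identity obtained by clearing the
   denominator 1 - e(2 a_i) of b_{a_i}. *)
Definition is_Ti (Ti : Iaff -> KV -> KV) : Prop :=
  forall i f, supported Lall f ->
    let a := asimple i in
    supported Lall (Ti i f) /\
    gmul (e_ (0, 0) - e_ (ascale 2 a)) (Ti i f - tau a *: gact (s_ i) f) =
    gmul ((tau a - (tau a)^-1) *: e_ (0, 0)
          + (ttau a - (ttau a)^-1) *: e_ a)
         (f - gact (s_ i) f).

(* The next predicates each pin down an object on K[L], uniquely: T(w) from the
   T_i, the Y^t from T, and the polynomials E_l from the Y^t. *)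
Definition is_T (Ti : Iaff -> KV -> KV) (T : (V -> V) -> KV -> KV) : Prop :=
  forall u s f, Omega u -> len (u \o prod_s s) = size s -> supported Lall f ->
    T (u \o prod_s s) f = gact u (foldr Ti f s).

Definition is_Y (T : (V -> V) -> KV -> KV) (Y : V -> KV -> KV) : Prop :=
  [/\ forall t f, L'all t -> dominant t -> supported Lall f ->
        Y t f = T (translation t) f,
      forall t f, L'all t -> supported Lall f -> supported Lall (Y t f),
      forall f, supported Lall f -> Y 0 f = f &
      forall t u f, L'all t -> L'all u -> supported Lall f ->
        Y (t + u) f = Y t (Y u f)].

Definition polyY (Y : V -> KV -> KV) (f g : KV) : KV :=
  \sum_(t <- msupp f) f@_t *: Y t g.

Definition evalq (f : KV) (x : V) : K :=
  \sum_(t <- msupp f) f@_t * q (ip t x).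

Definition is_E (k' : aff -> R) (Y : V -> KV -> KV) (E : V -> KV) : Prop :=
  forall l, Lall l ->
    [/\ (E l)@_l = 1,
        forall x, x \in msupp (E l) -> x <> l -> Lall x /\ ltL x l &
        forall f, supported L'all f ->
          polyY Y f (E l) = evalq f (- r_ k' l) *: E l].

Section Parabolic.
Variable J : {set I0}.

Definition is_wordJ (s : seq I0) (w : V -> V) : Prop :=
  {subset s <= J} /\ w = prod_s (map inl s).

Definition WJ : set (V -> V) := [set w | exists s, is_wordJ s w].

Definition A'J (f : KV) : Prop :=
  supported L'all f /\ forall w, WJ w -> gact w f = f.

Definition mult_character (eps : (V -> V) -> int) : Prop :=
  (forall w, WJ w -> eps w = 1 \/ eps w = -1) /\
  (forall u w, WJ u -> WJ w -> eps (u \o w) = eps u * eps w).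

Definition tau_eps (eps : (V -> V) -> int) (i : I0) : K :=
  if eps (s_ (inl i)) == 1 then tau (asimple (inl i))
  else - (tau (asimple (inl i)))^-1.

Definition reduced_word (w : V -> V) : seq I0 :=
  xget [::] [set s | is_wordJ s w /\ size s = len w].

Definition tauw (eps : (V -> V) -> int) (w : V -> V) : K :=
  \prod_(i <- reduced_word w) tau_eps eps i.

Definition UJ (eps : (V -> V) -> int) (T : (V -> V) -> KV -> KV) (f : KV) : KV :=
  (tauw eps (longest WJ))^-1 *: \sum_(w \in WJ) (tauw eps w *: T w f).

End Parabolic.
End Operators.
End DualityData.
End Euclidean.

Arguments aff {R} V.
Arguments component {R} V.
Arguments KV {R} V K.

(* Main.v *)
(* If f is invariant under W_J, then f(Y) commutes with T_j for j in J, hence with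
   T(w) for w in W_J and with U_J; as f(Y) acts on E_l by the scalar f(-r_{k'}(l)), so
   it does on U_J E_l.

   Since f(Y) is a combination of the Y^t + Y^(s_j t), it suffices that T_j commutes
   with these; they are all polynomials in Y^l + Y^(s_j l), for one l whose pairing with
   alpha_j is minimal, with coefficients Y^n, s_j n = n.  If that pairing is 0 or 1, this
   follows from T_j Y^t = Y^t T_j, resp. T_j Y^(s_j l) T_j = Y^l, which come down to the
   additivity of lengths in s_j t(t) = t(t) s_j and t(l) s_j t(l) = s_j t(l + s_j l).
   The pairing is 2 only for the long simple root of a component (iii); then
   Y^(alpha_j^vee) = X T_j, where X is conjugate to T_0 and so satisfies a quadratic
   relation, which makes X T_j + (X T_j)^-1 commute with T_j.

   The braid relations are built into the hypothesis on T, but the existence of reduced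
   decompositions, the length formulas and the quadratic relations are not.  Lengths are
   counted on the affine roots alpha + rc with alpha in R and r an integer, which
   are, up to positive factors, the indivisible elements of S in all three cases. *)
From HB Require Import structures.
Require Import Defs.
From mathcomp Require Import all_boot all_order all_algebra.
From mathcomp Require Import finmap monalg.
From mathcomp Require Import boolp classical_sets functions cardinality fsbigop.
From mathcomp Require Import reals.
From mathcomp Require Import ring lra zify.

Set Implicit Arguments.
Unset Strict Implicit.
Unset Printing Implicit Defensive.

Import Order.TTheory GRing.Theory Num.Theory.
Local Open Scope classical_set_scope.
Local Open Scope ring_scope.

(** * The group algebra *)

(** Stating the relation for the symmetric sums Y^t + Y^(s_j t), and not for a single Y^t, avoids
    the quotient in the usual Bernstein formula: what has to be shown is plain commutation, which is
    inherited by sums and products. Only for dominant t is Y^t tied to T(t(t)). Other t are reached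
    by multiplying by an invertible Y^b with b dominant; choosing b orthogonal to alpha_j makes Y^b
    commute with T_j, so that relations for t + b descend to t. The obstacle is that L' need not
    contain the fundamental coweights. In a component (iii) it is spanned by the eps_i, so a long
    simple root 2 eps_i pairs with it in even integers, and no t is available for the relation T_j
    Y^(s_j t) T_j = Y^t. This is where T_0 has to enter, with a parameter independent of that of
    T_j. *)

Section LinearExtension.
Context {T : choiceType} {K : nzRingType} {M : lmodType K}.
Implicit Types (phi : T -> M) (f g : {malg K[T]}).

(** The linear map that takes prescribed values on the basis e(x); [gmul] and [gact] are both of
    this form. *)
Definition mextend phi f : M := \sum_(x <- msupp f) f@_x *: phi x.

Lemma mextendEw phi f (d : {fset T}) : (msupp f `<=` d)%fset ->
  mextend phi f = \sum_(x <- d) f@_x *: phi x.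
Proof.
move=> fd; rewrite /mextend (big_fset_incl _ fd) // => x _ xf.
by rewrite mcoeff_outdom ?scale0r.
Qed.

Lemma mextend_is_linear phi : linear (mextend phi).
Proof.
move=> c f g; pose d := (msupp f `|` msupp g)%fset.
have sub: (msupp (c *: f + g) `<=` d)%fset.
  apply: fsubset_trans (msuppD_le _ _) _; apply: fsetSU.
  exact: msuppZ_le.
rewrite (mextendEw _ sub) (@mextendEw _ f d) ?fsubsetUl//.
rewrite (@mextendEw _ g d) ?fsubsetUr// scaler_sumr -big_split /=.
by apply: eq_bigr => x _; rewrite mcoeffD mcoeffZ scalerDl scalerA.
Qed.

HB.instance Definition _ phi :=
  GRing.isLinear.Build K {malg K[T]} M _ (mextend phi) (mextend_is_linear phi).

Lemma mextendU phi c x : mextend phi << c *g x >> = c *: phi x.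
Proof.
rewrite (@mextendEw _ _ [fset x]%fset) ?msuppU_le //.
by rewrite big_seq_fset1 mcoeffUU.
Qed.

Lemma eq_mextend phi phi' : phi =1 phi' -> mextend phi =1 mextend phi'.
Proof. by move=> e f; apply: eq_bigr => x _; rewrite e. Qed.

Lemma malgUZ c (x : T) : << c *g x >> = c *: << 1 *g x >> :> {malg K[T]}.
Proof.
by apply/malgP => y; rewrite mcoeffZ !mcoeffU; case: eqP; rewrite ?mulr1 ?mulr0.
Qed.

Lemma linear_mextend (h : {linear {malg K[T]} -> M}) f :
  h f = mextend (fun x => h << 1 *g x >>) f.
Proof.
rewrite [in LHS](monalgE f) linear_sum; apply: eq_bigr => x _.
by rewrite malgUZ linearZ.
Qed.

(** Linearity is a premise and not a bundled structure, so that both sides of an algebra identity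
    can be viewed as functions of any one factor. *)
Lemma eq_linear_malg (h h' : {malg K[T]} -> M) : linear h -> linear h' ->
  (forall x, h << 1 *g x >> = h' << 1 *g x >>) -> h =1 h'.
Proof.
move=> lh lh' e f.
pose L : {linear {malg K[T]} -> M} := HB.pack h
  (GRing.isLinear.Build K {malg K[T]} M _ h lh).
pose L' : {linear {malg K[T]} -> M} := HB.pack h'
  (GRing.isLinear.Build K {malg K[T]} M _ h' lh').
rewrite -[h f]/(L f) -[h' f]/(L' f) (linear_mextend L) (linear_mextend L').
exact: eq_mextend.
Qed.

End LinearExtension.

Section GroupAlgebra.
Context {R : realType} {V : vectType R} {K : fieldType}.
Implicit Types f g h : KV V K.

Lemma gmulE f g :
  gmul f g = mextend (fun x => mextend (fun y => << 1 *g x + y >>) g) f.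
Proof.
apply: eq_bigr => x _; rewrite scaler_sumr; apply: eq_bigr => y _.
by rewrite [LHS]malgUZ scalerA.
Qed.

Lemma gmulUU x y :
  gmul << 1 *g x >> << 1 *g y >> = << 1 *g x + y >> :> KV V K.
Proof. by rewrite gmulE !mextendU !scale1r. Qed.

Lemma gmul_linearl g : linear (@gmul R V K ^~ g).
Proof. by move=> c f h /=; rewrite !gmulE linearP. Qed.

Lemma gmul_linearr f : linear (@gmul R V K f).
Proof.
move=> c g h /=; rewrite !gmulE /mextend scaler_sumr -big_split /=.
apply: eq_bigr => x _; rewrite -!/(mextend _ _) linearP scalerDr !scalerA.
by rewrite mulrC.
Qed.

HB.instance Definition _ f :=
  GRing.isLinear.Build K (KV V K) (KV V K) _ (gmul f) (gmul_linearr f).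

Lemma gmulC f g : gmul f g = gmul g f.
Proof.
move: f; apply: eq_linear_malg => [||x]; first exact: gmul_linearl.
  exact: gmul_linearr.
move: g; apply: eq_linear_malg => [||y]; first exact: gmul_linearr.
  exact: gmul_linearl.
by rewrite !gmulUU addrC.
Qed.

Lemma gmulA : associative (@gmul R V K).
Proof.
move=> f g h; move: f; apply: eq_linear_malg => [||x].
- exact: gmul_linearl.
- by move=> c u v; rewrite !gmul_linearl.
move: g; apply: eq_linear_malg => [||y].
- by move=> c u v; rewrite gmul_linearl gmul_linearr.
- by move=> c u v; rewrite gmul_linearr gmul_linearl.
move: h; apply: eq_linear_malg => [||z].
- by move=> c u v; rewrite !gmul_linearr.
- by move=> c u v; rewrite gmul_linearr.
by rewrite !gmulUU addrA.
Qed.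

(** An alias to which the ring structure with product [gmul] is attached; identities in K[V] then
    become instances of identities in a commutative ring. *)
Definition galg : Type := KV V K.
HB.instance Definition _ := GRing.Lmodule.on galg.

Lemma gmul1 : left_id (<< 1 *g 0 >> : KV V K) (@gmul R V K).
Proof.
move=> f; move: f; apply: eq_linear_malg => [||x]; first exact: gmul_linearr.
  by [].
by rewrite gmulUU add0r.
Qed.

Lemma gmulDl : left_distributive (@gmul R V K) +%R.
Proof. by move=> f g h; have := gmul_linearl h 1 f g; rewrite !scale1r. Qed.

Lemma gone_neq0 : (<< 1 *g 0 >> : galg) != 0.
Proof. by rewrite monalgU_eq0 oner_eq0. Qed.

HB.instance Definition _ := GRing.Zmodule_isComNzRing.Build galg
  gmulA gmulC gmul1 gmulDl gone_neq0.

Lemma gmulM f g : gmul f g = (f : galg) * (g : galg).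
Proof. by []. Qed.

Lemma gmulZl c f g : c *: gmul f g = gmul (c *: f) g.
Proof. by rewrite gmulC [RHS]gmulC linearZ. Qed.

(** Turns scaling into multiplication inside the ring. *)
Definition gconst (c : K) : galg := << c *g 0 >>.

Lemma gconstZ c (f : galg) : c *: f = gconst c * f.
Proof. by rewrite /gconst malgUZ -gmulM -gmulZl gmul1. Qed.

Lemma gconstD c d : gconst (c + d) = gconst c + gconst d.
Proof. exact: monalgUD. Qed.
Lemma gconstN c : gconst (- c) = - gconst c.
Proof. exact: monalgUN. Qed.
Lemma gconstM c d : gconst (c * d) = gconst c * gconst d.
Proof. by rewrite -gconstZ /gconst [in RHS]malgUZ scalerA -malgUZ. Qed.
Lemma gconst1 : gconst 1 = 1.
Proof. by []. Qed.

End GroupAlgebra.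

(** * Euclidean geometry and affine isometries *)

Section Euclid.
Context {R : realType} {V : vectType R} (ip : {dot V for idfun}).
Implicit Types (u v x y s t : V) (a b : aff V) (c : R) (g h w : V -> V).

Lemma ipC x y : ip x y = ip y x.
Proof. by rewrite hermC expr0 mul1r. Qed.
Lemma ipDr x y z : ip x (y + z) = ip x y + ip x z.
Proof. exact: linearDr. Qed.
Lemma ipDl x y z : ip (x + y) z = ip x z + ip y z.
Proof. exact: linearDl. Qed.
Lemma ipNr x y : ip x (- y) = - ip x y.
Proof. exact: linearNr. Qed.
Lemma ipNl x y : ip (- x) y = - ip x y.
Proof. exact: linearNl. Qed.
Lemma ipBr x y z : ip x (y - z) = ip x y - ip x z.
Proof. exact: linearBr. Qed.
Lemma ipBl x y z : ip (x - y) z = ip x z - ip y z.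
Proof. exact: linearBl. Qed.
Lemma ipZr c x y : ip x (c *: y) = c * ip x y.
Proof. exact: linearZr_LR. Qed.
Lemma ipZl c x y : ip (c *: x) y = c * ip x y.
Proof. exact: linearZl_LR. Qed.
Lemma ip0l x : ip 0 x = 0.
Proof. exact: linear0l. Qed.
Lemma ip0r x : ip x 0 = 0.
Proof. exact: linear0r. Qed.
Lemma ip_sumr I (s : seq I) (P : pred I) (F : I -> V) x :
  ip x (\sum_(i <- s | P i) F i) = \sum_(i <- s | P i) ip x (F i).
Proof. exact: linear_sumr. Qed.
Lemma ip_suml I (s : seq I) (P : pred I) (F : I -> V) x :
  ip (\sum_(i <- s | P i) F i) x = \sum_(i <- s | P i) ip (F i) x.
Proof. by rewrite ipC ip_sumr; apply: eq_bigr => i _; rewrite ipC. Qed.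

Definition ipE := (ipDr, ipDl, ipNr, ipNl, ipZr, ipZl, ip0l, ip0r).

Lemma ip_gt0 x : (0 < ip x x) = (x != 0).
Proof.
have [->|x0] := eqVneq x 0; first by rewrite ip0l ltxx.
exact: neq0_dnorm_gt0.
Qed.

Lemma ip_ge0 x : 0 <= ip x x.
Proof.
have [->|x0] := eqVneq x 0; first by rewrite ip0l.
by rewrite ltW ?ip_gt0.
Qed.

Lemma ip_eq0 x : (ip x x == 0) = (x == 0).
Proof.
have [->|x0] := eqVneq x 0; first by rewrite ip0l eqxx.
by rewrite gt_eqF ?ip_gt0.
Qed.

Lemma coroot0 : coroot ip 0 = 0.
Proof. by rewrite /coroot scaler0. Qed.

Lemma corootZ c v : c != 0 -> coroot ip (c *: v) = c^-1 *: coroot ip v.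
Proof.
move=> c0; have [->|v0] := eqVneq v 0; first by rewrite scaler0 coroot0 scaler0.
rewrite /coroot !ipE !scalerA; congr (_ *: _).
have := ip_eq0 v; rewrite (negPf v0) => /negbT vv; field.
by rewrite c0 vv.
Qed.

Lemma corootN v : coroot ip (- v) = - coroot ip v.
Proof. by rewrite /coroot !ipE opprK scalerN. Qed.

Lemma ip_coroot v : v != 0 -> ip v (coroot ip v) = 2.
Proof. by move=> v0; rewrite ipZr mulfVK ?ip_eq0. Qed.

Lemma coroot_ip v : v != 0 -> ip (coroot ip v) (coroot ip v) = 4 / ip v v.
Proof.
move=> v0; have := ip_eq0 v; rewrite (negPf v0) => /negbT vv.
by rewrite !ipE; field.
Qed.

Lemma corootK v : coroot ip (coroot ip v) = v.
Proof.
have [->|v0] := eqVneq v 0; first by rewrite !coroot0.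
rewrite {1}/coroot coroot_ip // /coroot scalerA -[RHS]scale1r; congr (_ *: _).
by field; rewrite ip_eq0.
Qed.

Lemma reflE v x : refl ip v x = x - ip v x *: coroot ip v.
Proof. by rewrite /refl /srefl /aeval addr0. Qed.

Lemma reflE' v x : refl ip v x = x - ip x (coroot ip v) *: v.
Proof.
by rewrite reflE /coroot ipZr scalerA (ipC x) (mulrC (ip v x)).
Qed.

Lemma reflN v : refl ip (- v) = refl ip v.
Proof.
by apply/funext => x; rewrite !reflE corootN ipNl scalerN scaleNr opprK.
Qed.

Lemma reflZ c v : c != 0 -> refl ip (c *: v) = refl ip v.
Proof.
move=> c0; apply/funext => x; rewrite !reflE corootZ // ipZl scalerA.
by rewrite mulrAC divff // mul1r.
Qed.

Lemma refl_self v : refl ip v v = - v.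
Proof.
have [->|v0] := eqVneq v 0.
  by rewrite reflE ip0l scale0r subr0 oppr0.
by rewrite reflE' ip_coroot // scaler_nat mulr2n opprD addrA subrr add0r.
Qed.

Lemma refl_orth v x : ip v x = 0 -> refl ip v x = x.
Proof. by rewrite reflE => ->; rewrite scale0r subr0. Qed.

Lemma refl_is_linear v : linear (refl ip v).
Proof.
move=> c x y; rewrite !reflE !ipE scalerBr scalerDl opprD -scalerA.
by rewrite !addrA; congr (_ - _); rewrite addrAC.
Qed.

Lemma refl_isometric v x y : ip (refl ip v x) (refl ip v y) = ip x y.
Proof.
have [->|v0] := eqVneq v 0.
  by rewrite !reflE !ip0l !scale0r !subr0.
have vv : ip v v != 0 by rewrite ip_eq0.
rewrite !reflE /coroot !ipE (ipC x v).
by field.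
Qed.

Lemma reflK v : involutive (refl ip v).
Proof.
move=> x; rewrite {1}reflE' (reflE' v x) ipBl ipZl.
have [->|v0] := eqVneq v 0; first by rewrite !scaler0 !subr0.
set p := ip x _; rewrite ip_coroot // -addrA -opprD -scalerDl.
by rewrite (_ : p + (p - p * 2) = 0) ?scale0r ?subr0 //; ring.
Qed.

Definition isometry (g : V -> V) : Prop :=
  linear g /\ forall x y, ip (g x) (g y) = ip x y.

Definition affine_isometry (w : V -> V) : Prop :=
  exists g t, isometry g /\ w = translation t \o g.

Lemma isometry0 g : isometry g -> g 0 = 0.
Proof. by case=> l _; have := l (-1) 0 0; rewrite scaler0 addr0 scaleN1r addNr. Qed.

Lemma isometryD g x y : isometry g -> g (x + y) = g x + g y.
Proof. by case=> l _; have := l 1 x y; rewrite !scale1r. Qed.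

Lemma isometryZ g c x : isometry g -> g (c *: x) = c *: g x.
Proof. by move=> ig; have := ig.1 c x 0; rewrite (isometry0 ig) !addr0. Qed.

Lemma isometryN g x : isometry g -> g (- x) = - g x.
Proof. by move=> ig; rewrite -scaleN1r (isometryZ _ _  ig) scaleN1r. Qed.

Lemma isometryB g x y : isometry g -> g (x - y) = g x - g y.
Proof. by move=> ig; rewrite (isometryD _ _  ig) isometryN. Qed.

Lemma isometry_sum I (s : seq I) (P : pred I) (F : I -> V) g : isometry g ->
  g (\sum_(i <- s | P i) F i) = \sum_(i <- s | P i) g (F i).
Proof.
move=> ig; apply: (big_morph g) => [x y|]; first exact: isometryD.
exact: isometry0.
Qed.

Lemma isometry_comp g h : isometry g -> isometry h -> isometry (g \o h).
Proof.
move=> ig ih; split=> [c x y|x y] /=; first by rewrite ih.1 ig.1.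
by rewrite ig.2 ih.2.
Qed.

Lemma isometry_id : isometry id.
Proof. by []. Qed.

Lemma isometry_refl v : isometry (refl ip v).
Proof. by split; [exact: refl_is_linear | exact: refl_isometric]. Qed.

Lemma isometry_coroot g v : isometry g -> g (coroot ip v) = coroot ip (g v).
Proof. by move=> ig; rewrite /coroot (isometryZ _ _  ig) ig.2. Qed.

Lemma isometry_reflJ g v : isometry g -> g \o refl ip v = refl ip (g v) \o g.
Proof.
move=> ig; apply/funext => x /=.
by rewrite !reflE (isometryB _ _  ig) (isometryZ _ _  ig) isometry_coroot // ig.2.
Qed.

Lemma aactE g t a : isometry g ->
  aact ip (translation t \o g) a = (g a.1, a.2 - ip (g a.1) t).
Proof.
move=> ig; rewrite /aact /translation /= (isometry0 ig) addr0.
by rewrite [t + _]addrC addrK.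
Qed.

Lemma aact_linear g a : isometry g -> aact ip g a = (g a.1, a.2).
Proof. by move=> ig; rewrite /aact (isometry0 ig) ip0r !subr0. Qed.

Lemma translation_comp (g h : V -> V) (t s : V) : isometry g ->
  (translation t \o g) \o (translation s \o h) =
  translation (t + g s) \o (g \o h).
Proof.
by move=> ig; apply/funext => x; rewrite /translation /= (isometryD _ _  ig) addrA.
Qed.

Lemma aact_comp w w' a : affine_isometry w -> affine_isometry w' ->
  aact ip (w \o w') a = aact ip w (aact ip w' a).
Proof.
move=> [g [t [ig ->]]] [h [s [ih ->]]]; rewrite translation_comp //.
rewrite !aactE //=; last exact: isometry_comp.
by rewrite ipDr ig.2 opprD addrA addrAC.
Qed.

Lemma aact_id a : aact ip id a = a.
Proof. by rewrite aact_linear ?isometry_id //; case: a. Qed.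

Lemma aact_scale w c a : affine_isometry w ->
  aact ip w (ascale c a) = ascale c (aact ip w a).
Proof.
move=> [g [t [ig ->]]]; rewrite !aactE //= /ascale /= (isometryZ _ _  ig).
by rewrite ipZl mulrBr.
Qed.

Lemma ascaleA c (t : R) a : ascale c (ascale t a) = ascale (c * t) a.
Proof. by rewrite /ascale /= scalerA mulrA. Qed.

Lemma ascale1 a : ascale 1 a = a.
Proof. by case: a => x r; rewrite /ascale /= scale1r mul1r. Qed.

Lemma aeval_scale c a x : aeval ip (ascale c a) x = c * aeval ip a x.
Proof. by rewrite /aeval /ascale /= ipZl mulrDr. Qed.

Lemma aevalE w a x : affine_isometry w -> aeval ip (aact ip w a) (w x) = aeval ip a x.
Proof.
move=> [g [t [ig ->]]]; apply: aeval_aact => y z.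
by rewrite /translation /= (isometry0 ig) addr0 ![t + _]addrC !addrK ig.2.
Qed.

Lemma srefl_translation a :
  srefl ip a = translation (- a.2 *: coroot ip a.1) \o refl ip a.1.
Proof.
apply/funext => x; rewrite /srefl /translation /aeval /= reflE.
by rewrite scalerDl opprD scaleNr addrA [RHS]addrC.
Qed.

Lemma aact_srefl a b : aact ip (srefl ip a) b =
  (b.1 - ip b.1 (coroot ip a.1) *: a.1, b.2 - ip b.1 (coroot ip a.1) * a.2).
Proof.
rewrite srefl_translation aactE; last exact: isometry_refl.
rewrite reflE' ipBl !(ipZr (- a.2)) ipZl; congr pair.
have [->|v0] := eqVneq a.1 0; first by rewrite coroot0 !ip0r /=; ring.
by rewrite ip_coroot //; ring.
Qed.

Lemma sreflZ c a : c != 0 -> srefl ip (ascale c a) = srefl ip a.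
Proof.
move=> c0; rewrite !srefl_translation /= reflZ // corootZ //; congr (translation _ \o _).
by rewrite scalerA; congr (_ *: _); rewrite mulNr mulrAC mulfV ?mul1r.
Qed.

Lemma sreflK a : srefl ip a \o srefl ip a = id.
Proof.
apply/funext => x; rewrite /= {1}/srefl.
have [v0|v0] := eqVneq a.1 0; first by rewrite /srefl v0 coroot0 !scaler0 !subr0.
rewrite {2}/srefl -addrA -opprD -scalerDl.
rewrite [aeval ip a (srefl ip a x)](_ : _ = - aeval ip a x) ?subrr ?scale0r ?subr0 //.
by rewrite {1}/aeval /srefl ipBr ipZr ip_coroot // /aeval; ring.
Qed.

Lemma srefl_aactJ w a : affine_isometry w ->
  w \o srefl ip a = srefl ip (aact ip w a) \o w.
Proof.
move=> aw; apply/funext => x /=; rewrite {2}/srefl aevalE //.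
case: aw => g [t [ig ->]]; rewrite /srefl /translation aactE //=.
by rewrite (isometryB _ _  ig) (isometryZ _ _  ig) isometry_coroot // addrA.
Qed.

End Euclid.

(** * Exponentials of affine functions and the action of affine isometries on K[V] *)

Section Exponentials.
Context {R : realType} {V : vectType R} (ip : {dot V for idfun}).
Context {K : fieldType} (q : R -> K).
Hypothesis q_neq0 : forall x, q x != 0.
Hypothesis qD : forall x y, q (x + y) = q x * q y.
Implicit Types (a b : aff V) (w : V -> V).

Lemma q0 : q 0 = 1.
Proof. by apply: (mulfI (q_neq0 0)); rewrite -qD addr0 mulr1. Qed.

Lemma e_0 : e_ q (0, 0) = 1 :> galg (V := V) (K := K).
Proof. by rewrite /e_ /= q0. Qed.

Lemma e_M a b : gmul (e_ q a) (e_ q b) = e_ q (a.1 + b.1, a.2 + b.2) :> KV V K.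
Proof. by rewrite gmulE /e_ !mextendU qD scalerA -malgUZ. Qed.

Lemma gactE w f : gact ip q w f = mextend (fun x => e_ q (aact ip w (x, 0))) f.
Proof. by []. Qed.

Lemma gact_is_linear w : linear (gact ip q w).
Proof. by move=> c f g; rewrite !gactE linearP. Qed.

HB.instance Definition _ w :=
  GRing.isLinear.Build K (KV V K) (KV V K) _ (gact ip q w) (gact_is_linear w).

Lemma gactU w c x : gact ip q w << c *g x >> = c *: e_ q (aact ip w (x, 0)).
Proof. by rewrite gactE mextendU. Qed.

Lemma gact_e w a : affine_isometry ip w -> gact ip q w (e_ q a) = e_ q (aact ip w a).
Proof.
move=> [g [t [ig ->]]]; rewrite /e_ gactU !aactE // /e_ /= sub0r.
by rewrite [in LHS]malgUZ scalerA -qD -malgUZ.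
Qed.

Lemma gactM w f g : affine_isometry ip w ->
  gact ip q w (gmul f g) = gmul (gact ip q w f) (gact ip q w g).
Proof.
move=> [h [t [ih ->]]]; move: f; apply: eq_linear_malg => [||x].
- by move=> c u v; rewrite gmul_linearl linearP.
- by move=> c u v; rewrite linearP gmul_linearl.
move: g; apply: eq_linear_malg => [||y].
- by move=> c u v; rewrite gmul_linearr linearP.
- by move=> c u v; rewrite linearP gmul_linearr.
rewrite gmulUU !gactU !scale1r e_M !aactE //= !sub0r (isometryD _ _  ih).
by rewrite ipDl opprD.
Qed.

Lemma gact_comp w w' f : affine_isometry ip w -> affine_isometry ip w' ->
  gact ip q (w \o w') f = gact ip q w (gact ip q w' f).
Proof.
move=> aw aw'; move: f; apply: eq_linear_malg => [||x].
- exact: gact_is_linear.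
- by move=> c u v; rewrite !linearP.
by rewrite !gactU !scale1r gact_e // aact_comp.
Qed.

Lemma gact_id f : gact ip q id f = f.
Proof.
move: f; apply: eq_linear_malg => [||x]; first exact: gact_is_linear.
  by [].
by rewrite gactU scale1r aact_id /e_ /= q0.
Qed.

Lemma gact_const w c : affine_isometry ip w ->
  gact ip q w (gconst c) = gconst c :> galg (V := V) (K := K).
Proof.
move=> [g [t [ig ->]]]; rewrite gactU aactE //= (isometry0 ig) ip0l subr0 /e_ /= q0.
by rewrite -malgUZ.
Qed.

(* Comparing the coefficients at the point of the support of f that is extremal
   in the direction of the gradient of a. *)
Lemma gmul_1e_inj a (f : KV V K) : a.1 != 0 ->
  gmul (e_ q (0, 0) - e_ q a) f = 0 -> f = 0.
Proof.
move=> a0 ef; apply/eqP; apply: contraT => f0.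
have {}ef : f = gmul (e_ q a) f.
  have {}ef : (1 - (e_ q a : galg)) * (f : galg) = 0 by rewrite -[RHS]ef -e_0.
  by move/eqP: ef; rewrite mulrBl mul1r subr_eq0 => /eqP.
have coef x : f@_(a.1 + x) = q a.2 * f@_x.
  rewrite {1}ef gmulE /e_ mextendU mcoeffZ /mextend raddf_sum /=; congr (_ * _).
  rewrite [in RHS](monalgE f) raddf_sum /=; apply: eq_bigr => y _.
  rewrite mcoeffZ !mcoeffU (inj_eq (addrI _)).
  by case: eqP => _; rewrite ?mulr1 ?mulr0.
have : (msupp f != fset0)%fset.
  apply: contra_neq f0 => e.
  by rewrite (monalgE f) e big_seq_fset0.
case/fset0Pn => x0 x0f.
have [[x xf] _ /= max] := @arg_maxP _ _ _ [` x0f]%fset xpredT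
  (fun x : msupp f => ip a.1 (fsval x)) isT.
have axf : a.1 + x \in msupp f.
  by rewrite -mcoeff_neq0 coef mulf_neq0 // mcoeff_neq0.
have /= := max [` axf]%fset isT; rewrite ipDr gerDr leNgt ip_gt0.
by rewrite a0.
Qed.

End Exponentials.

(** * Root systems and alcoves *)

Section Combinations.
Context {R : realType} {V : vectType R}.
Implicit Types (C : {pred R}) (B : set V).

Lemma comb_ind C B (P : V -> Prop) : P 0 ->
  (forall c b x, c \in C -> B b -> P x -> P (c *: b + x)) ->
  forall x, comb C B x -> P x.
Proof.
move=> P0 PS x [s]; elim: s x => [|p s IH] x sP -> {x}; first by rewrite big_nil.
rewrite big_cons; have [pC pB] := sP p (mem_head _ _).
by apply: PS => //; apply: IH => // p' p's; apply: sP; rewrite inE p's orbT.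
Qed.

Lemma comb0 C B : comb C B 0.
Proof. by exists [::]; rewrite ?big_nil. Qed.

Lemma combS C B c b x : c \in C -> B b -> comb C B x -> comb C B (c *: b + x).
Proof.
move=> cC Bb [s sP ->]; exists ((c, b) :: s); last by rewrite big_cons.
by move=> p; rewrite inE => /predU1P[->//|]; exact: sP.
Qed.

Lemma combD C B x y : comb C B x -> comb C B y -> comb C B (x + y).
Proof.
move=> hx hy; move: x hx; apply: comb_ind; first by rewrite add0r.
by move=> c b x cC Bb xy; rewrite -addrA; exact: combS.
Qed.

Lemma combZ C B a x : (forall c, c \in C -> a * c \in C) ->
  comb C B x -> comb C B (a *: x).
Proof.
move=> aC; move: x; apply: comb_ind; first by rewrite scaler0; exact: comb0.
by move=> c b x cC Bb xC; rewrite scalerDr scalerA; apply: combS => //; exact: aC.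
Qed.

Lemma comb1 C B b : 1 \in C -> B b -> comb C B b.
Proof.
by move=> C1 Bb; rewrite -[b]addr0 -[b]scale1r; apply: combS => //; exact: comb0.
Qed.

Lemma comb_sum C B I (s : seq I) (F : I -> V) :
  (forall i, comb C B (F i)) -> comb C B (\sum_(i <- s) F i).
Proof.
move=> FC; apply: (big_ind (comb C B)) => //; first exact: comb0.
exact: combD.
Qed.

Lemma comb_rangeP n (s : 'I_n -> V) x : comb Num.nat (range s) x <->
  exists2 c : 'I_n -> R, (forall i, c i \is a Num.nat) & x = \sum_i c i *: s i.
Proof.
split; last first.
  move=> [c cN ->]; apply: comb_sum => i.
  apply: combZ => [a aN|]; first by rewrite rpredM // cN.
  by apply: comb1; [exact: rpred1 | exists i].
move: x; apply: comb_ind.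
  by exists (fun=> 0) => [i|]; [exact: rpred0 | rewrite big1 // => i _; rewrite scale0r].
move=> a _ x aN [j _ <-] [c cN ->].
exists (fun i => a *+ (i == j) + c i).
  by move=> i; rewrite rpredD //; rewrite mulrb; case: eqP => _ //; exact: rpred0.
under [RHS]eq_bigr do rewrite scalerDl.
rewrite big_split /=; congr (_ + _); rewrite (bigD1 j) //= eqxx.
by rewrite big1 ?addr0 // => i /negPf ->; rewrite scale0r.
Qed.

End Combinations.

(** * The root system of type C_n *)

Section TypeC.
Context {R : realType} {V : vectType R} (ip : {dot V for idfun}).
Context {n : nat} (eps : 'I_n -> V).
Hypothesis epsP : forall i j, ip (eps i) (eps j) = (i == j)%:R.

Definition signed_eps : set V := [set v | exists i (b : bool), v = (-1) ^+ b *: eps i].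
Local Notation E := signed_eps.

Lemma signed_epsN u : E u -> E (- u).
Proof.
by move=> [i [b ->]]; exists i, (~~ b); case: b; rewrite ?expr1 ?expr0 ?scaleN1r ?scale1r ?opprK.
Qed.

Lemma signed_eps_ip u : E u -> ip u u = 1.
Proof.
by move=> [i [b ->]]; rewrite !ipE epsP eqxx /=; case: b; rewrite ?expr1 ?expr0; ring.
Qed.

Lemma signed_eps_cases u v : E u -> E v -> [\/ u = v, u = - v | ip u v = 0].
Proof.
move=> [i [b ->]] [j [c ->]]; have [<-|ij] := eqVneq i j.
  by case: b c => [] []; rewrite ?expr1 ?expr0 ?scaleN1r ?scale1r ?opprK;
     [apply: Or31|apply: Or32|apply: Or32|apply: Or31].
by apply: Or33; rewrite !ipE epsP (negPf ij) !mulr0.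
Qed.

(** A uniform description of long roots (u = v) and short roots, which reduces closure under
    reflections and integrality to the signed basis vectors. *)
Lemma Cn_rootsP x : Cn_roots eps x <->
  exists u v, [/\ E u, E v, u + v != 0 & x = u + v].
Proof.
have eps0 i : eps i != 0 by rewrite -(ip_eq0 ip) epsP eqxx oner_eq0.
split.
  case=> [[i [b ->]]|[i [j [b [c [ij ->]]]]]].
    exists ((-1) ^+ b *: eps i), ((-1) ^+ b *: eps i); split=> //; try by exists i, b.
      by rewrite -scalerDl scaler_eq0 negb_or eps0 andbT; case: b; rewrite ?expr1 ?expr0;
         apply/eqP; lra.
    by rewrite scalerA mulrC -scalerA scaler_nat mulr2n.
  exists ((-1) ^+ b *: eps i), ((-1) ^+ c *: eps j); split=> //; try by [exists i, b|exists j, c].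
  apply/eqP => /(congr1 (ip (eps i))); rewrite !ipE !epsP eqxx -(inj_eq val_inj) (ltn_eqF ij) /=.
  by case: b; rewrite ?expr1 ?expr0; lra.
move=> [_ [_ [[i [b ->]] [j [c ->]] s0 ->]]].
have [ij|ji|ij] := ltngtP i j.
- by right; exists i, j, b, c.
- by right; exists j, i, c, b; rewrite addrC.
move/val_inj: ij s0 => -> {i}.
case: b c => [] []; rewrite ?expr1 ?expr0 ?scaleN1r ?scale1r ?subrr ?addNr ?eqxx //.
- by move=> _; left; exists j, true; rewrite scaleN1r scaler_nat mulr2n opprD.
- by move=> _; left; exists j, false; rewrite scale1r scaler_nat mulr2n.
Qed.

Lemma Cn_cases a : Cn_roots eps a ->
  (exists2 u, E u & a = 2 *: u) \/
  (exists u v, [/\ E u, E v, ip u v = 0 & a = u + v]).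
Proof.
move/Cn_rootsP => [u [v [Eu Ev s0 ->]]].
case: (signed_eps_cases Eu Ev) => [e|e|uv]; first by left; exists v => //; rewrite e scaler_nat.
  by rewrite e addNr eqxx in s0.
by right; exists u, v.
Qed.

Lemma Cn_long u : E u -> Cn_roots eps (2 *: u).
Proof.
move=> Eu; apply/Cn_rootsP; exists u, u; rewrite scaler_nat; split=> //.
have : 2 *: u != 0 by rewrite scaler_eq0 pnatr_eq0 /= -(ip_eq0 ip) signed_eps_ip // oner_eq0.
by rewrite scaler_nat.
Qed.

Lemma Cn_ip a : Cn_roots eps a -> ip a a = 4 \/ ip a a = 2.
Proof.
case/Cn_cases => [[u Eu ->]|[u [v [Eu Ev uv ->]]]]; [left|right].
  by rewrite !ipE signed_eps_ip //; lra.
by rewrite !ipE (ipC _ v) uv !signed_eps_ip //; lra.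
Qed.

Lemma Cn_coroot_long a : ip a a = 4 -> coroot ip a = 2^-1 *: a.
Proof. by rewrite /coroot => ->; congr (_ *: _); lra. Qed.

Lemma Cn_coroot_short a : ip a a = 2 -> coroot ip a = a.
Proof. by rewrite /coroot => ->; rewrite divff ?scale1r // pnatr_eq0. Qed.

(** The reflection in 2u negates u and fixes the signed basis vectors orthogonal to u; the one in u
    + v, with u and v orthogonal, exchanges u with -v and v with -u. *)
Lemma signed_eps_refl a w : Cn_roots eps a -> E w -> E (refl ip a w).
Proof.
have self u : E u -> refl ip u u = - u by move=> _; exact: refl_self.
case/Cn_cases => [[u Eu ->] Ew|[u [v [Eu Ev uv ->]]] Ew].
  rewrite reflZ ?pnatr_eq0 //; case: (signed_eps_cases Ew Eu) => [->|->|wu].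
  - by rewrite self //; exact: signed_epsN.
  - by rewrite (isometryN _ (isometry_refl ip u)) self // opprK.
  - by rewrite refl_orth // ipC.
have uu := signed_eps_ip Eu; have vv := signed_eps_ip Ev; have vu := uv; rewrite ipC in vu.
have cr : coroot ip (u + v) = u + v.
  by apply: Cn_coroot_short; rewrite !ipE uu vv vu uv; lra.
have ru : refl ip (u + v) u = - v.
  by rewrite reflE cr ipDl uu vu addr0 scale1r opprD addrA subrr add0r.
have rv : refl ip (u + v) v = - u.
  by rewrite reflE cr ipDl uv vv add0r scale1r opprD addrC addrNK.
have rN x := isometryN x (isometry_refl ip (u + v)).
case: (signed_eps_cases Ew Eu) => [->|->|wu]; first by rewrite ru; exact: signed_epsN.
  by rewrite rN ru opprK.
case: (signed_eps_cases Ew Ev) => [->|->|wv]; first by rewrite rv; exact: signed_epsN.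
  by rewrite rN rv opprK.
by rewrite refl_orth // ipDl ipC wu ipC wv addr0.
Qed.

Lemma signed_eps_int u v : E u -> E v -> ip u v \is a Num.int.
Proof.
move=> Eu Ev; case: (signed_eps_cases Eu Ev) => [->|->|->]; last exact: rpred0.
  by rewrite signed_eps_ip // rpred1.
by rewrite ipNl signed_eps_ip // rpredN rpred1.
Qed.

Lemma signed_eps_Cn_int a w : Cn_roots eps a -> E w -> ip w a \is a Num.int.
Proof.
move/Cn_rootsP => [u [v [Eu Ev _ ->]]] Ew.
by rewrite ipDr rpredD // signed_eps_int.
Qed.

Lemma signed_eps_coroot_int a w : Cn_roots eps a -> E w ->
  ip w (coroot ip a) \is a Num.int.
Proof.
move=> Ra Ew; case/Cn_cases: (Ra) => [[u Eu aE]|[u [v [Eu Ev uv aE]]]].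
  rewrite Cn_coroot_long; last by rewrite aE !ipE signed_eps_ip //; lra.
  by rewrite aE scalerA mulVf ?pnatr_eq0 // scale1r signed_eps_int.
rewrite Cn_coroot_short; first exact: signed_eps_Cn_int.
by rewrite aE !ipE (ipC _ v) uv !signed_eps_ip //; lra.
Qed.

Lemma Cn_root_system : root_system ip (Cn_roots eps).
Proof.
split.
- pose f (p : 'I_n * bool * ('I_n * bool)) : V :=
    (-1) ^+ p.1.2 *: eps p.1.1 + (-1) ^+ p.2.2 *: eps p.2.1.
  apply: (@sub_finite_set _ _ (range f)); last exact: finite_image.
  move=> x /Cn_rootsP[_ [_ [[i [b ->]] [j [c ->]] _ ->]]].
  by exists (i, b, (j, c)).
- by move=> /Cn_ip; rewrite ip0l; lra.
- move=> a b Ra /Cn_rootsP[u [v [Eu Ev s0 ->]]]; apply/Cn_rootsP.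
  exists (refl ip a u), (refl ip a v); split; try exact: signed_eps_refl.
    rewrite -(isometryD _ _ (isometry_refl ip a)).
    apply: contra_neq s0 => s0; rewrite -[_ + _](reflK ip a) s0.
    exact/isometry0/isometry_refl.
  exact/isometryD/isometry_refl.
- move=> a b Ra /Cn_rootsP[u [v [Eu Ev s0 ->]]].
  by rewrite ipDl rpredD // signed_eps_coroot_int.
Qed.

(** The integer z = <ta, a^vee> equals 2t. Squared lengths of roots are 2 or 4, so t^2 is 1, 2 or
    1/2 and z^2 is 4, 8 or 2, of which only 4 is a square. *)
Lemma Cn_reduced : reduced (Cn_roots eps).
Proof.
move=> a t Ra Rta; have [_ _ _ int] := Cn_root_system.
have a0 : a != 0 by rewrite -(ip_eq0 ip); case: (Cn_ip Ra) => ->; rewrite pnatr_eq0.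
have := int _ _ Ra Rta; rewrite ipZl ip_coroot // => /intrP[z tz].
have : ip (t *: a) (t *: a) = t * t * ip a a by rewrite ipZl ipZr mulrA.
have zz : t * t = (z * z)%:~R / 4 by rewrite intrM -tz; field.
have zP : z * z = 4 \/ z * z = 8 \/ z * z = 2 -> z = 2 \/ z = -2 by case: z {tz zz} => [[|[|[|[|n']]]]|[|[|[|n']]]]; lia.
move=> tt.
have : z = 2 \/ z = -2.
  apply: zP; move: tt; rewrite zz.
  case: (Cn_ip Ra) => ->; case: (Cn_ip Rta) => -> e.
  - by left; apply: (@intr_inj R); lra.
  - by right; right; apply: (@intr_inj R); lra.
  - by right; left; apply: (@intr_inj R); lra.
  - by left; apply: (@intr_inj R); lra.
by case=> zE; rewrite zE in tz; [left|right]; lra.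
Qed.

End TypeC.

Section FreeFamilies.
Context {R : realType} {V : vectType R} (ip : {dot V for idfun}).
Context {n : nat} (s : 'I_n -> V).

Lemma free_codom_inj (c : 'I_n -> R) : free (codom s) ->
  \sum_i c i *: s i = 0 -> forall i, c i = 0.
Proof.
move=> fs; have : free [tuple of map s (ord_tuple n)].
  by move: fs; rewrite codomE.
move/freeP => fr sum0; apply: fr.
by under eq_bigr do rewrite -tnth_nth tnth_map tnth_ord_tuple.
Qed.

(* Invertibility of the Gram matrix. *)
Lemma free_dual_point (c : 'I_n -> R) : free (codom s) ->
  exists2 x, (forall i, ip (s i) x = c i) &
    forall y, (forall i, ip y (s i) = 0) -> ip y x = 0.
Proof.
move=> fs; pose G := \matrix_(i, k) ip (s i) (s k) : 'M[R]_n.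
have Gu : G \in unitmx.
  rewrite -row_free_unit; apply/row_freeP/row_freeP.
  rewrite -kermx_eq0; apply/eqP/row_matrixP => j; rewrite row0.
  have /sub_kermxP := row_sub j (kermx G); set u := row j _ => uG.
  (* A vector in the kernel of the Gram matrix yields a combination of the [s i] of norm 0. *)
  have u0 : \sum_i u 0 i *: s i = 0.
    apply/eqP; rewrite -(ip_eq0 ip) ip_suml big1 // => i _; rewrite ipZl ip_sumr.
    have : (u *m G) 0 i = 0 by rewrite uG mxE.
    rewrite mxE => e; apply/eqP; rewrite mulf_eq0; apply/orP; right; apply/eqP.
    rewrite -[RHS]e; apply: eq_bigr => k _.
    by rewrite ipZr [G k i]mxE (ipC ip (s i)).
  by apply/rowP => i; rewrite (free_codom_inj fs u0) mxE.
(* The point is taken in the span of [s]; this gives the second claim, by which orthogonal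
   components do not interfere. *)
pose v := \row_i c i *m invmx G.
exists (\sum_k v 0 k *: s k) => [i|y ys]; last first.
  by rewrite ip_sumr big1 // => k _; rewrite ipZr ys mulr0.
rewrite ip_sumr; have : (v *m G) 0 i = c i by rewrite mulmxKV // mxE.
by rewrite mxE => <-; apply: eq_bigr => k _; rewrite ipZr [G _ _]mxE ipC.
Qed.

End FreeFamilies.

(** * Positive roots, affine roots and points of the fundamental alcove *)

Section Roots.
Context {R : realType} {V : vectType R} (ip : {dot V for idfun}).
Context {m : nat} (D : 'I_m -> component V) (hD : duality_data ip D).
Local Notation Rc j := (shape_R (shp (D j))).
Implicit Types (a b x y : V) (j : 'I_m).

Lemma comp_wf j : wf_component ip (D j).
Proof. by have [h _ _] := hD. Qed.

Lemma comp_root_system j : root_system ip (Rc j).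
Proof.
have [wf _ _] := comp_wf j; case: (shp (D j)) wf => [P [] //|P [] //|n eps [_ h]].
exact: Cn_root_system.
Qed.

Lemma comp_reduced j : reduced (Rc j).
Proof.
have [wf _ _] := comp_wf j; case: (shp (D j)) wf => [P [] //|P [] //|n eps [_ h]].
exact: (Cn_reduced (ip := ip)).
Qed.

Lemma Rall_comp j a : Rc j a -> Rall D a.
Proof. by exists j. Qed.

Lemma comp_neq0 j a : Rc j a -> a != 0.
Proof. by move=> ja; apply/eqP => a0; have [_ + _ _] := comp_root_system j; rewrite -a0. Qed.

Lemma Rall_neq0 a : Rall D a -> a != 0.
Proof. by case=> j /comp_neq0. Qed.

Lemma comp_orth i j a b : i != j -> Rc i a -> Rc j b -> ip a b = 0.
Proof. by have [_ h _] := hD; move=> ij; exact: h. Qed.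

Lemma comp_uniq i j a c : Rc i a -> c != 0 -> Rc j (c *: a) -> i = j.
Proof.
move=> ia c0 ja; apply/eqP; apply: contraT => ij.
have := comp_orth ij ia ja; rewrite ipZr => /eqP.
by rewrite mulf_eq0 (negPf c0) /= ip_eq0 (negPf (comp_neq0 ia)).
Qed.

Lemma finite_Rall : finite_set (Rall D).
Proof.
rewrite (_ : Rall D = \bigcup_(j in [set: 'I_m]) Rc j).
  by apply: bigcup_finite => // j _; have [] := comp_root_system j.
by apply/seteqP; split=> [a [j ja]|a [j _ ja]]; exists j.
Qed.

Lemma comp_refl j a b : Rall D a -> Rc j b -> Rc j (refl ip a b).
Proof.
move=> [i ia] jb; have [ij|ij] := eqVneq i j.
  by subst i; have [_ _ h _] := comp_root_system j; exact: h.
by rewrite refl_orth //; exact: comp_orth ia jb.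
Qed.

Lemma compN j a : Rc j a -> Rc j (- a).
Proof. by move=> ja; rewrite -(refl_self ip); apply: comp_refl => //; exists j. Qed.

Lemma Rall_refl a b : Rall D a -> Rall D b -> Rall D (refl ip a b).
Proof. by move=> ha [j jb]; exists j; exact: comp_refl. Qed.

Lemma RallN a : Rall D a -> Rall D (- a).
Proof. by move=> [j /compN]; exists j. Qed.

Lemma Rall_reduced a c : Rall D a -> Rall D (c *: a) -> c = 1 \/ c = -1.
Proof.
move=> [i ia] ca; have c0 : c != 0.
  by apply: contraTneq (Rall_neq0 ca) => ->; rewrite scale0r eqxx.
case: ca => j ja; have ij := comp_uniq ia c0 ja; subst i.
exact: comp_reduced ia ja.
Qed.

Definition sroot (i : I0 D) : V := simple (tagged i).

Lemma comp_sroot i : Rc (tag i) (sroot i).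
Proof. by have [_ [h _ _] _] := comp_wf (tag i); exact: h. Qed.

Lemma Rall_sroot i : Rall D (sroot i).
Proof. exact: Rall_comp (comp_sroot i). Qed.

(** The coefficients are indexed by all of [I0] and vanish outside component [j], so that every
    component uses sums over the same index type. *)
Definition cone j x : Prop := exists c : I0 D -> R,
  [/\ forall i, c i \is a Num.nat, forall i, tag i != j -> c i = 0
    & x = \sum_i c i *: sroot i].

Lemma coneP j x : comb Num.nat (range (@simple _ _ (D j))) x -> cone j x.
Proof.
case/comb_rangeP => c cN ->.
(* An index whose component is only propositionally equal to [j] has to be transported. *)
pose c' (i : I0 D) : R := if tag i =P j is ReflectT e
  then c (ecast k 'I_(rk (D k)) e (tagged i)) else 0.
exists c'; split.
- by move=> i; rewrite /c'; case: eqP => // _; exact: rpred0.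
- by move=> i; rewrite /c'; case: eqP.
- rewrite -(sig_big_dep (fun=> true) (fun _ _ => true)
    (fun j (i : 'I_(rk (D j))) => c' (Tagged _ i) *: simple i)) /=.
  rewrite (bigD1 j) //= [X in _ = _ + X]big1 ?addr0.
    apply: eq_bigr => i _; congr (_ *: _); rewrite /c' /=.
    by case: eqP => // e; rewrite (eq_axiomK e).
  move=> k kj; rewrite big1 // => i _; rewrite /c' /=.
  by case: eqP => [e|_]; [rewrite e eqxx in kj | rewrite scale0r].
Qed.

Lemma cpos_cone j a : cpos (D j) a -> cone j a.
Proof. by case=> _ /coneP. Qed.

(** The Gram system is solved in each component; a solution lies in the span of its component, hence
    is orthogonal to the others. The points produced include fundamental coweights and a point where
    all simple roots take the value 1. *)
Lemma dual_point (c : I0 D -> R) : exists x, forall i, ip (sroot i) x = c i.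
Proof.
have h j : exists x : V, (forall i : 'I_(rk (D j)), ip (simple i) x = c (Tagged _ i)) /\
    forall y, (forall i : 'I_(rk (D j)), ip y (simple i) = 0) -> ip y x = 0.
  have [_ [_ fr _] _] := comp_wf j.
  by have [x xP xo] := free_dual_point ip (fun i => c (Tagged _ i)) fr; exists x.
have {h} [x xP] := choice h.
exists (\sum_j x j) => -[j i]; rewrite ip_sumr (bigD1 j) //=.
rewrite (xP j).1 big1 ?addr0 // => k kj; apply: (xP k).2 => l.
apply: (comp_orth _ (comp_sroot (existT _ j i : I0 D))
  (comp_sroot (existT _ k l : I0 D))).
by rewrite eq_sym.
Qed.

Lemma Rall_pos a : Rall D a -> Rpos D a \/ Rpos D (- a).
Proof.
move=> [j ja]; have [_ [_ _ h] _] := comp_wf j.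
by case: (h _ ja) => ?; [left|right]; exists j; split=> //; exact: compN.
Qed.

Lemma Rpos_Rall a : Rpos D a -> Rall D a.
Proof. by move=> [j [ja _]]; exists j. Qed.

Lemma Rpos_ge0 a x : (forall i, 0 <= ip (sroot i) x) -> Rpos D a -> 0 <= ip a x.
Proof.
move=> x0 [j /cpos_cone[c [cN _ ->]]]; rewrite ip_suml sumr_ge0 // => i _.
by rewrite ipZl mulr_ge0 // natr_ge0.
Qed.

Lemma Rpos_gt0 a x : (forall i, 0 < ip (sroot i) x) -> Rpos D a -> 0 < ip a x.
Proof.
move=> x0 Ra; rewrite lt_neqAle (Rpos_ge0 (fun i => ltW (x0 i)) Ra) andbT.
have := Rall_neq0 (Rpos_Rall Ra); move: Ra => [j /cpos_cone[c [cN _ ->]]].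
have cx i : 0 <= c i * ip (sroot i) x by rewrite mulr_ge0 ?(natr_ge0 (cN i)) ?(ltW (x0 i)).
apply: contra_neq => /esym; rewrite ip_suml.
under eq_bigr do rewrite ipZl.
move=> /psumr_eq0P h; apply: big1 => i _; have := h (fun i _ => cx i) i isT.
move/eqP; rewrite mulf_eq0 => /orP[/eqP->|]; first by rewrite scale0r.
by rewrite gt_eqF.
Qed.

Lemma Rpos_asym a : Rpos D a -> ~ Rpos D (- a).
Proof.
have [x xP] := dual_point (fun=> 1); have x0 i : 0 < ip (sroot i) x by rewrite xP.
move=> /(Rpos_gt0 x0) + /(Rpos_gt0 x0); rewrite ipNl; lra.
Qed.

Lemma Rpos_sroot i : Rpos D (sroot i).
Proof.
exists (tag i); split; first exact: comp_sroot.
by apply: comb1; [exact: rpred1 | exists (tagged i)].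
Qed.

Lemma comp_top j : Rc j (top (D j)).
Proof. by have [_ _ []] := comp_wf j. Qed.

Lemma top_cone j a : Rc j a -> cone j (top (D j) - a).
Proof. by have [_ _ [_ h]] := comp_wf j => /h /coneP. Qed.

(** Maximality applied to [- top] puts twice [top] in the cone of simple roots. *)
Lemma Rpos_top j : Rpos D (top (D j)).
Proof.
case: (Rall_pos (Rall_comp (comp_top j))) => // neg.
have [x xP] := dual_point (fun=> 1); have x0 i : 0 < ip (sroot i) x by rewrite xP.
have := Rpos_gt0 x0 neg; have [c [cN _ e]] := top_cone (compN (comp_top j)).
have : 0 <= ip (top (D j) - - top (D j)) x.
  rewrite e ip_suml sumr_ge0 // => i _.
  by rewrite ipZl mulr_ge0 ?(natr_ge0 (cN i)) ?(ltW (x0 i)).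
by rewrite opprK ipDl ipNl; lra.
Qed.

Lemma top_pos_cone j : cone j (top (D j)).
Proof.
have [i [ji /coneP ci]] := Rpos_top j.
rewrite [j in cone j _](_ : j = i) //; apply: (@comp_uniq j i (top (D j)) 1).
- exact: comp_top.
- exact: oner_neq0.
- by rewrite scale1r.
Qed.

(* Up to a positive factor, the elements of S are the elements of H. *)
Local Notation H := (S_of (Rall D)).

(** Positivity on the alcove in combinatorial form: roots take values strictly between -1 and 1
    there, so an integral constant term decides the sign unless it is 0. See [apos_alcove_gt0]. *)
Definition apos (h : aff V) : Prop := 0 < h.2 \/ (h.2 = 0 /\ Rpos D h.1).

Definition hsimple (i : Iaff D) : aff V :=
  match i with inl i => (sroot i, 0) | inr j => (- top (D j), 1) end.

Lemma H_simple i : H (hsimple i).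
Proof.
case: i => [i|j]; split=> /=; [exact: Rall_sroot | exact: rpred0 | | exact: rpred1].
exact/RallN/Rall_comp/comp_top.
Qed.

Lemma HN h : H h -> H (ascale (-1) h).
Proof. by move=> [h1 h2]; split; rewrite /= ?scaleN1r ?mulN1r ?rpredN //; exact: RallN. Qed.

Lemma H_neq0 h : H h -> h.1 != 0.
Proof. by move=> [/Rall_neq0]. Qed.

Lemma apos_simple i : apos (hsimple i).
Proof. by case: i => [i|j]; [right; split=> //; exact: Rpos_sroot | left; rewrite ltr01]. Qed.

Lemma apos_total h : H h -> apos h \/ apos (ascale (-1) h).
Proof.
move=> [h1 h2]; have [h0|h0|h0] := ltgtP h.2 0.
- by right; left; rewrite /= mulN1r oppr_gt0.
- by left; left.
- by case: (Rall_pos h1); [left|right]; right; rewrite /= ?h0 ?mulr0 ?scaleN1r.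
Qed.

Lemma apos_asym h : apos h -> ~ apos (ascale (-1) h).
Proof.
case=> [h0|[h0 h1]]; case=> /=; rewrite mulN1r ?scaleN1r ?h0; try lra.
by case=> _; exact: Rpos_asym.
Qed.

(** For an integer r >= 1 and the highest root phi of the component of b, b + rc = r(-phi + c) + (r
    - 1)phi + (phi + b), where phi and phi + b are nonnegative combinations of simple roots. *)
Lemma apos_comb h : H h -> apos h -> exists2 c : Iaff D -> R,
  (forall i, 0 <= c i) &
  h.1 = \sum_i c i *: (hsimple i).1 /\ h.2 = \sum_i c i * (hsimple i).2.
Proof.
case: h => b r [/= [j jb] rZ] [/= r0|/= [r0 [k /cpos_cone[c [cN _ bE]]]]]; last first.
  exists (fun i => if i is inl i then c i else 0) => [[i|//]|]; first exact: natr_ge0.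
  rewrite !big_sumType /=; split.
    by rewrite [X in _ + X]big1 ?addr0 // => i _; rewrite scale0r.
  by rewrite r0 !big1 ?addr0 // => i _; rewrite ?mul0r ?mulr0.
have r1 : 1 <= r by case/intrP: rZ r0 => z ->; rewrite ltr0z ler1z; lia.
have [c [cN _ cE]] := top_cone (compN jb); have [d [dN _ dE]] := top_pos_cone j.
exists (fun i => match i with inl i => (r - 1) * d i + c i
                            | inr k => r *+ (k == j) end).
  move=> [i|k]; last by rewrite mulrn_wge0 // ltW.
  by rewrite addr_ge0 ?mulr_ge0 ?(natr_ge0 (dN i)) ?(natr_ge0 (cN i)) ?subr_ge0.
rewrite !big_sumType /=; split; last first.
  rewrite [X in X + _]big1 ?add0r => [|i _]; last by rewrite mulr0.
  rewrite (bigD1 j) //= eqxx mulr1 big1 ?addr0 ?mulr1n // => k /negPf ->.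
  by rewrite mul0r.
rewrite [X in _ + X](bigD1 j) //= eqxx [X in _ + (_ + X)]big1; last first.
  by move=> k /negPf ->; rewrite scale0r.
under eq_bigr do rewrite scalerDl -scalerA.
rewrite big_split /= -scaler_sumr -dE -cE mulr1n addr0 opprK scalerBl scale1r scalerN.
by rewrite addrA subrK addrAC subrr add0r.
Qed.

Lemma aeval_comb h (c : Iaff D -> R) x :
  h.1 = \sum_i c i *: (hsimple i).1 -> h.2 = \sum_i c i * (hsimple i).2 ->
  aeval ip h x = \sum_i c i * aeval ip (hsimple i) x.
Proof.
move=> h1 h2; rewrite /aeval h1 h2 ip_suml -big_split /=; apply: eq_bigr => i _.
by rewrite ipZl mulrDr.
Qed.

(** Components are rescaled independently, which brings the value of each highest root to a chosen
    level. *)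
Lemma scaled_point (d : I0 D -> R) (c : 'I_m -> R) x : (forall i, ip (sroot i) x = d i) ->
  exists2 y, (forall i, ip (sroot i) y = c (tag i) * d i) &
    forall j, ip (top (D j)) y = c j * ip (top (D j)) x.
Proof.
move=> xP; have [y yP] := dual_point (fun i => c (tag i) * d i); exists y => // j.
have [e [_ e0 ->]] := top_pos_cone j.
rewrite !ip_suml mulr_sumr; apply: eq_bigr => i _; rewrite !ipZl yP xP.
have [->|/e0 ->] := eqVneq (tag i) j; first by ring.
by rewrite !mul0r mulr0.
Qed.

Lemma top_point_ge0 j x : (forall i, 0 <= ip (sroot i) x) -> 0 <= ip (top (D j)) x.
Proof. by move=> /Rpos_ge0; apply; exact: Rpos_top. Qed.

Lemma alcove_point : exists x, forall i, 0 < aeval ip (hsimple i) x.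
Proof.
have [x xP] := dual_point (fun=> 1).
have t0 j : 0 <= ip (top (D j)) x by apply: top_point_ge0 => i; rewrite xP.
(* With this divisor every highest root takes a value below 1. *)
have [y yP yt] := scaled_point (fun j => (ip (top (D j)) x + 1)^-1) xP.
exists y => -[i|j]; rewrite /aeval /=.
  by rewrite yP mulr1 addr0 invr_gt0 ltr_wpDl.
rewrite ipNl yt addrC subr_gt0 mulrC ltr_pdivrMr ?mul1r ?ltrDl //.
by rewrite ltr_wpDl.
Qed.

(** A point inside the wall of a_i. For a finite simple root, start from the point with coordinate 0
    at i and 1 elsewhere and shrink; for an affine one, rescale until the highest root of its
    component equals 1. *)
Lemma face_point i : exists2 x, aeval ip (hsimple i) x = 0 &
  forall l, l != i -> 0 < aeval ip (hsimple l) x.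
Proof.
case: i => [i|j].
  have [x xP] := dual_point (fun l => (l != i)%:R).
  have t0 j : 0 <= ip (top (D j)) x by apply: top_point_ge0 => l; rewrite xP ler0n.
  have [y yP yt] := scaled_point (fun j => (ip (top (D j)) x + 1)^-1) xP.
  exists y; first by rewrite /aeval /= yP eqxx mulr0 addr0.
  move=> [l|j] li; rewrite /aeval /=.
    rewrite yP (_ : l != i) ?mulr1 ?addr0 ?invr_gt0 ?ltr_wpDl //.
  rewrite ipNl yt addrC subr_gt0 mulrC ltr_pdivrMr ?mul1r ?ltrDl //.
  by rewrite ltr_wpDl.
have [x xP] := dual_point (fun=> 1).
have t0 k : 0 < ip (top (D k)) x by apply: Rpos_gt0 (Rpos_top k) => i; rewrite xP.
(* Without the summand 1 in component [j], the highest root takes the value 1 exactly there; in the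
   other components it stays below 1. *)
have [y yP yt] := scaled_point (fun k => (ip (top (D k)) x + (k != j)%:R)^-1) xP.
have tk k : 0 < ip (top (D k)) x + (k != j)%:R by rewrite ltr_pwDl // ler0n.
exists y; first by rewrite /aeval /= ipNl yt eqxx addr0 mulVf ?addNr ?gt_eqF.
move=> [i|k] li; rewrite /aeval /=; first by rewrite yP mulr1 addr0 invr_gt0.
rewrite ipNl yt addrC subr_gt0 mulrC ltr_pdivrMr // mul1r.
by rewrite (_ : k != j) // ltrDl.
Qed.

Lemma apos_face_ge0 h x : H h -> apos h -> (forall i, 0 <= aeval ip (hsimple i) x) ->
  0 <= aeval ip h x.
Proof.
move=> Hh ph x0; have [c c0 [h1 h2]] := apos_comb Hh ph.
by rewrite (aeval_comb _ h1 h2) sumr_ge0 // => i _; rewrite mulr_ge0.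
Qed.

(** In a nonnegative combination of simple affine roots that vanishes at x, only a_i can have a
    nonzero coefficient; reducedness makes that coefficient 1. *)
Lemma apos_face_eq0 h i x : H h -> apos h -> aeval ip (hsimple i) x = 0 ->
  (forall l, l != i -> 0 < aeval ip (hsimple l) x) ->
  aeval ip h x = 0 -> h = hsimple i.
Proof.
move=> Hh ph xi xl; have [c c0 [h1 h2]] := apos_comb Hh ph.
rewrite (aeval_comb _ h1 h2) => /psumr_eq0P e0.
have x0 l : 0 <= c l * aeval ip (hsimple l) x.
  by rewrite mulr_ge0 //; have [->|/xl/ltW//] := eqVneq l i; rewrite xi.
have {}e0 l : l != i -> c l = 0.
  move=> li; have /eqP := e0 (fun l _ => x0 l) l isT.
  by rewrite mulf_eq0 (gt_eqF (xl l li)) orbF => /eqP.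
have {h1} h1 : h.1 = c i *: (hsimple i).1.
  by rewrite h1 (bigD1 i) //= big1 ?addr0 // => l /e0 ->; rewrite scale0r.
have {h2} h2 : h.2 = c i * (hsimple i).2.
  by rewrite h2 (bigD1 i) //= big1 ?addr0 // => l /e0 ->; rewrite mul0r.
have [_ /Rall_reduced r] : Rall D (hsimple i).1 /\ Rall D (hsimple i).1.
  by have [] := H_simple i.
have ci : c i = 1.
  have [Hh1 _] := Hh; rewrite h1 in Hh1; case: (r _ Hh1) => // ci.
  by have := c0 i; rewrite ci; lra.
by move: h1 h2; rewrite ci scale1r mul1r; case: (h) (hsimple i) => [? ?] [? ?] /= -> ->.
Qed.

Lemma apos_alcove_gt0 h x : H h -> apos h -> (forall i, 0 < aeval ip (hsimple i) x) ->
  0 < aeval ip h x.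
Proof.
move=> Hh ph x0; rewrite lt_neqAle apos_face_ge0 ?andbT //; last by move=> i; exact: ltW.
have [c c0 [h1 h2]] := apos_comb Hh ph.
have := H_neq0 Hh; rewrite (aeval_comb _ h1 h2) => /eqP hn.
apply/eqP => /esym /psumr_eq0P e0; apply: hn.
rewrite h1 big1 // => i _.
have /eqP := e0 (fun l _ => mulr_ge0 (c0 l) (ltW (x0 l))) i isT.
by rewrite mulf_eq0 (gt_eqF (x0 i)) orbF => /eqP ->; rewrite scale0r.
Qed.

End Roots.

(** * Lattices and the Weyl group *)

Section Lattices.
Context {R : realType} {V : vectType R} (ip : {dot V for idfun}).
Context {m : nat} (D : 'I_m -> component V) (hD : duality_data ip D).
Local Notation Rc j := (shape_R (shp (D j))).
Local Notation Lc j := (shape_L ip (shp (D j))).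
Local Notation L'c j := (shape_L' ip (shp (D j))).
Implicit Types (a b x y : V) (j : 'I_m).

Lemma weights0 (P : set V) : weights ip P 0.
Proof. by split; [exact: comb0 | move=> a _; rewrite ip0l rpred0]. Qed.

Lemma weightsD (P : set V) x y : weights ip P x -> weights ip P y -> weights ip P (x + y).
Proof.
move=> [x1 x2] [y1 y2]; split; first exact: combD.
by move=> a Pa; rewrite ipDl rpredD ?x2 ?y2.
Qed.

Lemma weightsN (P : set V) x : weights ip P x -> weights ip P (- x).
Proof.
move=> [x1 x2]; split; first by rewrite -scaleN1r; apply: combZ.
by move=> a Pa; rewrite ipNl rpredN x2.
Qed.

Lemma combN_int (B : set V) x : comb Num.int B x -> comb Num.int B (- x).
Proof. by move=> Bx; rewrite -scaleN1r; apply: combZ Bx => c ci; rewrite mulN1r rpredN. Qed.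

Lemma weights_refl (P : set V) b x :
  (forall c d, P c -> P d -> ip c (coroot ip d) \is a Num.int) ->
  P b -> weights ip P x -> weights ip P (refl ip b x).
Proof.
move=> int Pb [x1 x2]; rewrite reflE'; split.
  by rewrite addrC -scaleNr; apply: combS.
by move=> a Pa; rewrite ipBl ipZl rpredB ?rpredM ?x2 ?int.
Qed.

Lemma comb_span (C : {pred R}) (A B : set V) x :
  (forall a, A a -> comb predT B a) -> comb C A x -> comb predT B x.
Proof.
move=> AB; move: x; apply: comb_ind; first exact: comb0.
by move=> c b x _ Ab xB; apply: combD => //; apply: combZ => //; exact: AB.
Qed.

Lemma dual_span (P : set V) a : dual ip P a -> comb predT P a.
Proof. by case=> b Pb <-; apply: combZ => //; exact: comb1. Qed.

Lemma span_dual (P : set V) a : P a -> comb predT (dual ip P) a.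
Proof.
by move=> Pa; rewrite -(corootK ip a); apply: combZ => //; apply: comb1 => //; exists a.
Qed.

Lemma dual_int (P : set V) : root_system ip P -> forall c d, dual ip P c -> dual ip P d ->
  ip c (coroot ip d) \is a Num.int.
Proof.
by move=> [_ _ _ h] _ _ [c Pc <-] [d Pd <-]; rewrite corootK ipC; exact: h.
Qed.

Lemma Lc_span j x : Lc j x -> comb predT (Rc j) x.
Proof.
by case: (shp (D j)) => [P [] //|P [] + _|n eps] /=; apply: comb_span => a; exact: dual_span.
Qed.

Lemma L'c_span j x : L'c j x -> comb predT (Rc j) x.
Proof.
by case: (shp (D j)) => [P [] + _|P [] + _|n eps] /=; apply: comb_span => a; exact: dual_span.
Qed.

Lemma span_orth i j a x : i != j -> Rc i a -> comb predT (Rc j) x -> ip a x = 0.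
Proof.
move=> ij ia; move: x; apply: comb_ind; first by rewrite ip0r.
by move=> c b x _ jb ax; rewrite ipDr ipZr ax (comp_orth hD ij ia jb) mulr0 addr0.
Qed.

Lemma L'c0 j : L'c j 0.
Proof. by case: (shp (D j)) => [P|P|n eps] /=; try exact: weights0; exact: comb0. Qed.

Lemma L'cD j x y : L'c j x -> L'c j y -> L'c j (x + y).
Proof. by case: (shp (D j)) => [P|P|n eps] /=; try exact: weightsD; exact: combD. Qed.

Lemma L'cN j x : L'c j x -> L'c j (- x).
Proof. by case: (shp (D j)) => [P|P|n eps] /=; try exact: weightsN; exact: combN_int. Qed.

Lemma L'c_int j x a : L'c j x -> Rc j a -> ip x a \is a Num.int.
Proof.
have := comp_root_system hD j; case: (shp (D j)) => [P|P|n eps] /= rs.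
- by move=> [_ h] Pa; rewrite -(corootK ip a); apply: h; exists a.
- by move=> [_ h] Pa; rewrite -(corootK ip a); apply: h; exists a.
move=> + ja; move: x; apply: comb_ind; first by rewrite ip0l rpred0.
move=> c _ x cZ [b jb <-] xZ; rewrite ipDl ipZl rpredD ?rpredM // ipC.
by have [_ _ _] := rs; exact.
Qed.

Lemma L'c_coroot j a : Rc j a -> L'c j (coroot ip a).
Proof.
have := comp_root_system hD j; case: (shp (D j)) => [P|P|n eps] /= rs ja.
- by split=> [|b Pb]; [apply: comb1 => //; exists a | apply: dual_int rs _ _ _ Pb; exists a].
- by split=> [|b Pb]; [apply: comb1 => //; exists a | apply: dual_int rs _ _ _ Pb; exists a].
by apply: comb1; [exact: rpred1 | exists a].
Qed.

Lemma Lc_refl j a x : Rc j a -> Lc j x -> Lc j (refl ip a x).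
Proof.
move=> ja; have a0 := comp_neq0 hD ja.
have ra : refl ip (coroot ip a) = refl ip a.
  by rewrite /coroot reflZ // mulf_neq0 ?invr_eq0 ?ip_eq0 // pnatr_eq0.
have := comp_root_system hD j; move: ja.
case E: (shp (D j)) => [P|P|n eps] /= ja rs.
- by apply: weights_refl => //; have [_ _ _ h] := rs; move=> c d Pc Pd; exact: h.
- by rewrite -ra; apply: weights_refl; [exact: dual_int | exists a].
move=> xL; rewrite reflE addrC -scaleNr; apply: combS => //; last by exists a.
rewrite rpredN ipC; apply: (@L'c_int j); first by rewrite E.
by rewrite E.
Qed.

Lemma sum_single j y : \sum_i (if i == j then y else 0) = y :> V.
Proof. by rewrite -big_mkcond big_pred1_eq. Qed.

Lemma L'all_comp j y : L'c j y -> L'all ip D y.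
Proof.
move=> jy; exists (fun i => if i == j then y else 0); last by rewrite sum_single.
by move=> i; case: eqP => [->//|_]; exact: L'c0.
Qed.

Lemma L'all0 : L'all ip D 0.
Proof. by exists (fun=> 0); [move=> j; exact: L'c0 | rewrite big1]. Qed.

Lemma L'allD x y : L'all ip D x -> L'all ip D y -> L'all ip D (x + y).
Proof.
move=> [f fL ->] [g gL ->]; exists (fun j => f j + g j); last by rewrite big_split.
by move=> j; exact: L'cD.
Qed.

Lemma L'allN x : L'all ip D x -> L'all ip D (- x).
Proof.
move=> [f fL ->]; exists (fun j => - f j); last by rewrite sumrN.
by move=> j; exact: L'cN.
Qed.

Lemma L'all_nat n x : L'all ip D x -> L'all ip D (n%:R *: x).
Proof.
move=> xL; elim: n => [|n IH]; first by rewrite scale0r; exact: L'all0.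
by rewrite -addn1 natrD scalerDl scale1r; exact: L'allD.
Qed.

Lemma L'all_int c x : c \is a Num.int -> L'all ip D x -> L'all ip D (c *: x).
Proof.
case/intrP => -[] n -> xL; first exact: L'all_nat.
by rewrite NegzE mulrNz scaleNr; apply: L'allN; exact: L'all_nat.
Qed.

Lemma L'all_ip_int x a : L'all ip D x -> Rall D a -> ip x a \is a Num.int.
Proof.
move=> [f fL ->] [j ja]; rewrite ip_suml (bigD1 j) //= big1 ?addr0.
  by apply: L'c_int (fL j) ja.
by move=> i ij; rewrite ipC; apply: (span_orth _ ja (L'c_span (fL i))); rewrite eq_sym.
Qed.

Lemma L'all_coroot a : Rall D a -> L'all ip D (coroot ip a).
Proof. by move=> [j ja]; apply: (@L'all_comp j); exact: L'c_coroot. Qed.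

Lemma L'all_refl a x : Rall D a -> L'all ip D x -> L'all ip D (refl ip a x).
Proof.
move=> ha xL; rewrite reflE; apply: L'allD => //; apply: L'allN; apply: L'all_int.
  by rewrite ipC; exact: L'all_ip_int.
exact: L'all_coroot.
Qed.

Lemma Lall_refl a x : Rall D a -> Lall ip D x -> Lall ip D (refl ip a x).
Proof.
move=> [j ja] [f fL ->]; exists (fun i => refl ip a (f i)); last first.
  exact/isometry_sum/isometry_refl.
move=> i; have [ij|ij] := eqVneq j i; first by subst i; exact: Lc_refl.
by rewrite refl_orth //; exact: span_orth ij ja (Lc_span (fL i)).
Qed.

(* P(R^vee) is contained in L', or in half of it in the components (iii). *)
Lemma coweight_decomposition x : (forall a, Rall D a -> ip x a \is a Num.int) ->
  exists f : 'I_m -> V, [/\ x = \sum_j f j,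
    forall j a, Rc j a -> ip (f j) a = ip x a,
    forall j, L'c j (2 *: f j) &
    forall j, (if shp (D j) is CaseIII _ _ then False else True) -> L'c j (f j)].
Proof.
move=> xZ; have [_ _ /(_ x) span] := hD.
have [f fs xE] : exists2 f : 'I_m -> V, (forall j, comb predT (Rc j) (f j)) & x = \sum_j f j.
  move: x {xZ} span; apply: comb_ind.
    by exists (fun=> 0); [move=> j; exact: comb0 | rewrite big1].
  move=> c b _ _ [j jb] [f fs ->]; exists (fun i => (if i == j then c *: b else 0) + f i).
    move=> i; apply: combD => //; case: eqP => [->|_]; last exact: comb0.
    by apply: combZ => //; exact: comb1.
  by rewrite big_split /= sum_single.
have fx j a : Rc j a -> ip (f j) a = ip x a.
  move=> ja; rewrite xE ip_suml (bigD1 j) //= big1 ?addr0 // => i ij.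
  by rewrite ipC; apply: (span_orth _ ja (fs i)); rewrite eq_sym.
have fZ j a : Rc j a -> ip (f j) a \is a Num.int.
  by move=> ja; rewrite fx //; apply: xZ; exists j.
have f1 j : (if shp (D j) is CaseIII _ _ then False else True) -> L'c j (f j).
  move: (fs j) (fZ j); case: (shp (D j)) => [P|P|n eps] //= fsj fZj _.
  - split; first by apply: comb_span fsj => a; exact: span_dual.
    by move=> _ [a Pa <-]; rewrite corootK; exact: fZj.
  - split; first by apply: comb_span fsj => a; exact: span_dual.
    by move=> _ [a Pa <-]; rewrite corootK; exact: fZj.
exists f; split=> // j.
have [wf _ _] := comp_wf hD j; move: (fs j) (fZ j) (f1 j) wf.
case E: (shp (D j)) => [P|P|n eps] /= fsj fZj f1j wf.
- by rewrite scaler_nat mulr2n; apply: weightsD; exact: f1j.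
- by rewrite scaler_nat mulr2n; apply: weightsD; exact: f1j.
(* In a component (iii) the vector is expanded in the orthonormal [eps i]. Twice a coefficient is
   the pairing with the root [2 *: eps i], hence an integer, and [eps i] is the coroot of that
   root. *)
have epsP := wf.2; pose ex (y : V) := y = \sum_i ip y (eps i) *: eps i.
have exD y z : ex y -> ex z -> ex (y + z).
  rewrite /ex => {1}-> {1}->; rewrite -big_split /=; apply: eq_bigr => i _.
  by rewrite ipDl scalerDl.
have exZ c y : ex y -> ex (c *: y).
  rewrite /ex => {1}->; rewrite scaler_sumr; apply: eq_bigr => i _.
  by rewrite ipZl scalerA.
have exE u : signed_eps eps u -> ex u.
  move=> [i [b ->]]; apply: exZ; rewrite /ex (bigD1 i) //= epsP eqxx scale1r.
  by rewrite big1 ?addr0 // => k ki; rewrite epsP eq_sym (negPf ki) scale0r.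
have -> : f j = \sum_i ip (f j) (eps i) *: eps i.
  rewrite -/(ex (f j)); move: (f j) fsj; apply: comb_ind.
    by rewrite /ex big1 // => i _; rewrite ip0l scale0r.
  move=> c b y _ /(Cn_rootsP epsP) [u [v [Eu Ev _ ->]]] ey.
  exact: exD _ _ (exZ _ _ (exD _ _ (exE _ Eu) (exE _ Ev))) ey.
rewrite scaler_sumr; apply: comb_sum => i.
have Ei : signed_eps eps (eps i) by exists i, false; rewrite scale1r.
have R2 := Cn_long epsP Ei.
rewrite scalerA; apply: combZ => [c cZ|].
  by rewrite rpredM // -ipZr; exact: fZj.
apply: comb1; first exact: rpred1.
exists (2 *: eps i) => //; rewrite corootZ ?pnatr_eq0 // /coroot epsP eqxx divr1.
by rewrite scalerA mulVf ?scale1r // pnatr_eq0.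
Qed.

Lemma L'all_double x : (forall a, Rall D a -> ip x a \is a Num.int) -> L'all ip D (2 *: x).
Proof.
move=> /coweight_decomposition[f [-> _ f2 _]]; exists (fun j => 2 *: f j) => //.
by rewrite scaler_sumr.
Qed.

Lemma Rall_ip_int x : (forall i : I0 D, ip (sroot i) x \is a Num.int) ->
  forall a, Rall D a -> ip x a \is a Num.int.
Proof.
move=> xZ; have pos a : Rpos D a -> ip x a \is a Num.int.
  move=> [j /(cpos_cone)[c [cN _ ->]]]; rewrite ip_sumr rpred_sum // => i _.
  by rewrite ipZr rpredM //; [exact: (intr_nat (cN i)) | rewrite ipC; exact: xZ].
by move=> a /(Rall_pos hD)[/pos//|/pos]; rewrite ipNr rpredN.
Qed.

End Lattices.

(** * The finite Weyl group, the group W and its simple reflections *)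

Section WeylGroup.
Context {R : realType} {V : vectType R} (ip : {dot V for idfun}).
Context {m : nat} (D : 'I_m -> component V) (hD : duality_data ip D).
Local Notation Rc j := (shape_R (shp (D j))).
Local Notation H := (S_of (Rall D)).
Implicit Types (a b x y t : V) (j : 'I_m) (u w : V -> V) (h : aff V) (i : Iaff D).

Lemma W0_ind (P : (V -> V) -> Prop) : P id ->
  (forall a u, Rall D a -> W0 ip D u -> P u -> P (refl ip a \o u)) ->
  forall u, W0 ip D u -> P u.
Proof.
move=> P1 PS _ [s + ->]; elim: s => [|a s IH] //= sR.
apply: PS; [exact/sR/mem_head | exists s => // |]; last apply: IH.
all: by move=> b bs; apply: sR; rewrite inE bs orbT.
Qed.

Lemma W0_id : W0 ip D id.
Proof. by exists [::]. Qed.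

Lemma W0_cons a u : Rall D a -> W0 ip D u -> W0 ip D (refl ip a \o u).
Proof.
move=> ha [s sR ->]; exists (a :: s) => // b.
by rewrite inE => /predU1P[->//|]; exact: sR.
Qed.

Lemma W0_refl a : Rall D a -> W0 ip D (refl ip a).
Proof. by move=> ha; exact: (W0_cons ha W0_id). Qed.

Lemma W0_comp u u' : W0 ip D u -> W0 ip D u' -> W0 ip D (u \o u').
Proof. by move=> + hu'; move: u; apply: W0_ind => // a u ha _; exact: W0_cons. Qed.

Lemma W0_inv u : W0 ip D u -> exists2 u', W0 ip D u' & u \o u' = id /\ u' \o u = id.
Proof.
move: u; apply: W0_ind; first by exists id => //; exact: W0_id.
move=> a u ha hu [u' hu' [uu' u'u]]; exists (u' \o refl ip a).
  by apply: W0_comp => //; exact: W0_refl.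
split; apply/funext => x /=.
  by rewrite -[u (u' _)]/((u \o u') _) uu' /= reflK.
by rewrite reflK -[u' (u x)]/((u' \o u) x) u'u.
Qed.

Lemma W0_isometry u : W0 ip D u -> isometry ip u.
Proof.
move: u; apply: W0_ind => [|a u _ _ hu]; first exact: isometry_id.
by apply: isometry_comp => //; exact: isometry_refl.
Qed.

Lemma W0_stable (P : set V) : (forall a x, Rall D a -> P x -> P (refl ip a x)) ->
  forall u x, W0 ip D u -> P x -> P (u x).
Proof.
move=> Pr u x hu; move: u hu x; apply: W0_ind => // a u ha _ IH x Px /=.
by apply: Pr => //; exact: IH.
Qed.

Lemma W0_Rc j u a : W0 ip D u -> Rc j a -> Rc j (u a).
Proof. by apply: W0_stable => b x; exact: comp_refl. Qed.

Lemma W0_Rall u a : W0 ip D u -> Rall D a -> Rall D (u a).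
Proof. by apply: W0_stable => b x; exact: Rall_refl. Qed.

Lemma W0_L' u x : W0 ip D u -> L'all ip D x -> L'all ip D (u x).
Proof. by apply: W0_stable => b y; exact: L'all_refl. Qed.

Lemma W0_L u x : W0 ip D u -> Lall ip D x -> Lall ip D (u x).
Proof. by apply: W0_stable => b y; exact: Lall_refl. Qed.

Lemma Waff_W0 u : W0 ip D u -> Waff ip D u.
Proof.
move=> hu; exists u, 0; split=> //; first exact: L'all0.
by apply/funext => x; rewrite /translation /= add0r.
Qed.

Lemma Waff_translation t : L'all ip D t -> Waff ip D (translation t).
Proof. by move=> ht; exists id, t; split=> //; exact: W0_id. Qed.

Lemma Waff_id : Waff ip D id.
Proof. exact/Waff_W0/W0_id. Qed.

Lemma Waff_isometry w : Waff ip D w -> affine_isometry ip w.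
Proof. by move=> [u [t [/W0_isometry ? _ ->]]]; exists u, t. Qed.

Lemma Waff_comp w w' : Waff ip D w -> Waff ip D w' -> Waff ip D (w \o w').
Proof.
move=> [u [t [hu ht ->]]] [u' [t' [hu' ht' ->]]].
rewrite (translation_comp _ _ _ (W0_isometry hu)).
exists (u \o u'), (t + u t'); split=> //; first exact: W0_comp.
by apply: L'allD => //; exact: W0_L'.
Qed.

Lemma Waff_inv w : Waff ip D w -> exists2 w', Waff ip D w' & w \o w' = id /\ w' \o w = id.
Proof.
move=> [u [t [hu ht ->]]]; have [u' hu' [uu' u'u]] := W0_inv hu.
have iu := W0_isometry hu; have iu' := W0_isometry hu'.
exists (translation (- u' t) \o u').
  by exists u', (- u' t); split=> //; apply: L'allN => //; exact: W0_L'.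
rewrite !(translation_comp _ _ _ iu, translation_comp _ _ _ iu') uu' u'u.
rewrite (isometryN _ iu) -[u (u' t)]/((u \o u') t) uu' /= subrr addNr.
by split; apply/funext => x; rewrite /translation /= add0r.
Qed.

Lemma Waff_H w h : Waff ip D w -> H h -> H (aact ip w h).
Proof.
move=> [u [t [hu ht ->]]] [h1 h2]; rewrite (aactE _ _ (W0_isometry hu)).
have uR := W0_Rall hu h1; split=> //=; rewrite rpredB // ipC.
exact: L'all_ip_int hD _ _ ht uR.
Qed.

Lemma Waff_linear_Rc w j h : Waff ip D w -> Rc j h.1 -> Rc j (aact ip w h).1.
Proof.
move=> [u [t [hu ht ->]]] h1; rewrite (aactE _ _ (W0_isometry hu)) /=.
exact: W0_Rc.
Qed.

Lemma Waff_ip w h : Waff ip D w -> ip (aact ip w h).1 (aact ip w h).1 = ip h.1 h.1.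
Proof.
move=> [u [t [hu ht ->]]]; have iu := W0_isometry hu.
by rewrite (aactE _ _ iu) /= iu.2.
Qed.

Lemma Waff_srefl h : H h -> Waff ip D (srefl ip h).
Proof.
move=> [h1 h2]; rewrite srefl_translation; exists (refl ip h.1), (- h.2 *: coroot ip h.1).
split=> //; first exact: W0_refl.
apply: L'all_int => //; [by rewrite rpredN | exact: L'all_coroot].
Qed.

Lemma asimple_scale i : exists2 c, 0 < c & asimple ip i = ascale c (hsimple i).
Proof.
have [c c0 ->] : exists2 c, 0 < c & asimple ip i = ascale c (hsimple i); last by exists c.
have h0 := H_neq0 hD (H_simple hD i).
have cpos : 0 < 2 / ip (hsimple i).1 (hsimple i).1 by rewrite divr_gt0 ?ip_gt0.
case: i h0 cpos => [i|j] /= h0 cpos.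
- case: (shp _) => [P|P|n eps] /=; first by exists 1; rewrite ?ltr01 // ascale1.
  + by exists (2 / ip (sroot i) (sroot i)).
  + by exists (2 / ip (sroot i) (sroot i)).
- case: (shp _) => [P|P|n eps] /=; first by exists 1; rewrite ?ltr01 // ascale1.
  + by exists (2 / ip (- top (D j)) (- top (D j))).
  + by exists (2 / ip (- top (D j)) (- top (D j))).
Qed.

Lemma s_E i : s_ ip i = srefl ip (hsimple i).
Proof.
by rewrite /s_; have [c c0 ->] := asimple_scale i; rewrite sreflZ // gt_eqF.
Qed.

Lemma Waff_s i : Waff ip D (s_ ip i).
Proof. by rewrite s_E; apply: Waff_srefl; exact: H_simple hD i. Qed.

Lemma s_K (i : Iaff D) : s_ ip i \o s_ ip i = id.
Proof. exact: sreflK. Qed.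

Lemma Waff_prod_s (s : seq (Iaff D)) : Waff ip D (prod_s ip s).
Proof.
elim: s => [|i s IH] /=; first exact: Waff_id.
by apply: Waff_comp => //; exact: Waff_s.
Qed.

Lemma aact_s_simple i : aact ip (s_ ip i) (hsimple i) = ascale (-1) (hsimple i).
Proof.
rewrite s_E aact_srefl ip_coroot; last exact: (H_neq0 hD (H_simple hD i)).
by rewrite /ascale; congr pair; [rewrite scaleN1r scaler_nat mulr2n opprD addrA subrr add0r | ring].
Qed.

(* s_i fixes a point of the alcove's closure at which every positive affine root
   other than a_i is positive. *)
Lemma apos_s i h : H h -> apos D h -> h <> hsimple i -> apos D (aact ip (s_ ip i) h).
Proof.
move=> Hh ph hi; have [x xi xl] := face_point hD i.
have x0 (l : Iaff D) : 0 <= aeval ip (hsimple l) x.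
  by have [->|/xl/ltW//] := eqVneq l i; rewrite xi.
have hx : 0 < aeval ip h x.
  rewrite lt_neqAle (apos_face_ge0 hD Hh ph x0) andbT.
  by apply/eqP => /esym e; apply: hi; exact: apos_face_eq0 hD _ _ _ Hh ph xi xl e.
have sx : s_ ip i x = x by rewrite s_E /srefl xi scale0r subr0.
have := aevalE h x (Waff_isometry (Waff_s i)); rewrite sx => e.
have Hs := Waff_H (Waff_s i) Hh.
case: (apos_total hD Hs) => // neg.
have := apos_face_ge0 hD (HN hD Hs) neg x0.
by rewrite aeval_scale e; lra.
Qed.

End WeylGroup.

(** * The length function *)

Section Length.
Context {R : realType} {V : vectType R} (ip : {dot V for idfun}).
Context {m : nat} (D : 'I_m -> component V) (hD : duality_data ip D).
Local Notation Rc j := (shape_R (shp (D j))).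
Local Notation H := (S_of (Rall D)).
Implicit Types (x t : V) (u w : V -> V) (a h : aff V) (i : Iaff D).

Definition is_caseI (c : @Defs.shape R V) : Prop := if c is CaseI _ then True else False.

(* The affine root a of S with a / 2 not in S that is positively proportional
   to h. *)
Definition nrm h : aff V :=
  if `[< exists2 j, Rc j h.1 & is_caseI (shp (D j)) >] then h else acoroot ip h.

Lemma nrm_comp j h : Rc j h.1 -> nrm h = normalize ip (shp (D j)) h.
Proof.
move=> jh; rewrite /nrm; case: asboolP => [[k kh]|nI].
  have <- : j = k by apply: (@comp_uniq _ _ _ _ _ hD j k h.1 1); rewrite ?scale1r ?oner_neq0.
  by case: (shp (D j)).
case E: (shp (D j)) => [P|P|n eps] //=; case: nI; exists j => //.
by rewrite E.
Qed.

Lemma nrm_scale h : H h -> exists2 c, 0 < c & nrm h = ascale c h.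
Proof.
move=> Hh; rewrite /nrm; case: ifP => _; first by exists 1; rewrite ?ltr01 ?ascale1.
by exists (2 / ip h.1 h.1); rewrite ?divr_gt0 ?ip_gt0 ?(H_neq0 hD Hh).
Qed.

Lemma asimpleE i : asimple ip i = nrm (hsimple i).
Proof.
case: i => [i|j]; rewrite /asimple.
  by rewrite (nrm_comp (j := tag i)) //; exact: (comp_sroot hD i).
by rewrite (nrm_comp (j := j)) //; apply: (compN hD); exact: (comp_top hD j).
Qed.

Lemma acorootK h : h.1 != 0 -> acoroot ip (acoroot ip h) = h.
Proof.
move=> h0; have hh : ip h.1 h.1 != 0 by rewrite ip_eq0.
rewrite {1}/acoroot /= !ipE /acoroot ascaleA -[RHS]ascale1; congr ascale.
by field.
Qed.

(** Equal images are proportional, so they come from one component, on which [nrm] is either the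
    identity or the involution [acoroot]. *)
Lemma nrm_inj h h' : H h -> H h' -> nrm h = nrm h' -> h = h'.
Proof.
move=> Hh Hh' e; have [c c0 hc] := nrm_scale Hh; have [c' c0' hc'] := nrm_scale Hh'.
have [[j jh] _] := Hh; have [[k kh'] _] := Hh'.
have e1 : h'.1 = (c'^-1 * c) *: h.1.
  have := congr1 fst e; rewrite hc hc' /= -scalerA => ->.
  by rewrite scalerA mulVf ?scale1r // gt_eqF.
have jk : j = k.
  apply: (comp_uniq hD jh (c := c'^-1 * c)); last by rewrite -e1.
  by rewrite mulf_neq0 ?invr_eq0 // gt_eqF.
subst k; move: e; rewrite !(nrm_comp (j := j)) //.
case: (shp (D j)) => [P|P|n eps] //= e.
- by rewrite -(acorootK (H_neq0 hD Hh)) e acorootK // (H_neq0 hD Hh').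
- by rewrite -(acorootK (H_neq0 hD Hh)) e acorootK // (H_neq0 hD Hh').
Qed.

Lemma nrm_aact w h : Waff ip D w -> H h -> nrm (aact ip w h) = aact ip w (nrm h).
Proof.
move=> hw [[j jh] _]; rewrite (nrm_comp (j := j)); last exact: Waff_linear_Rc hD _ _ _ hw jh.
rewrite (nrm_comp jh); have aw := Waff_isometry hw.
by case: (shp (D j)) => [P|P|n eps] //=; rewrite /acoroot (Waff_ip _ hw) (aact_scale _ _ aw).
Qed.

Lemma Sall_nrm h : H h -> Sall ip D (nrm h).
Proof.
move=> [[j jh] hZ]; exists j; rewrite (nrm_comp jh).
case: (shp (D j)) jh => [P|P|n eps] /= jh; first by [].
  by exists h.
by right; exists h.
Qed.

Lemma Sall_aact w a : Waff ip D w -> Sall ip D a -> Sall ip D (aact ip w a).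
Proof.
move=> hw [j ja]; exists j.
have S1 h : S_of (Rc j) h -> S_of (Rc j) (aact ip w h).
  move=> [h1 h2]; split; first exact: Waff_linear_Rc hD _ _ _ hw h1.
  by have [|_] := Waff_H hD hw (h := h); first by split=> //; exists j.
have S2 h : dualS ip (S_of (Rc j)) h -> dualS ip (S_of (Rc j)) (aact ip w h).
  move=> [h' Sh' <-]; exists (aact ip w h'); first exact: S1.
  by rewrite /acoroot (Waff_ip _ hw) (aact_scale _ _ (Waff_isometry hw)).
case: (shp (D j)) ja S1 S2 => [P|P|n eps] /= ja S1 S2; [exact: S1|exact: S2|].
by case: ja => ?; [left; exact: S1 | right; exact: S2].
Qed.

(** Reducedness excludes a half inside S(R) in case (i) and inside S(R)^vee in the others. In case
    (iii) half a coroot might also be a root, but its squared length is 1/4 or 1/2, while roots have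
    2 or 4. *)
Lemma nrm_half h : H h -> ~ Sall ip D (ascale 2^-1 (nrm h)).
Proof.
move=> Hh [k kh]; have [[j jh] hZ] := Hh.
have h0 := H_neq0 hD Hh; have hh : ip h.1 h.1 != 0 by rewrite ip_eq0.
have c20 : (2^-1 : R) != 0 by rewrite invr_eq0 pnatr_eq0.
have jk : j = k.
  have proj b : shape_S ip (shp (D k)) b -> exists2 d, d != 0 & Rc k (d *: b.1).
    have R1 g : S_of (Rc k) g -> exists2 d, d != 0 & Rc k (d *: g.1).
      by move=> [g1 _]; exists 1; rewrite ?oner_neq0 ?scale1r.
    have R2 g : dualS ip (S_of (Rc k)) g -> exists2 d, d != 0 & Rc k (d *: g.1).
      move=> [g' [g1 _] <-] /=; have g0 := comp_neq0 hD g1.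
      have gg : ip g'.1 g'.1 != 0 by rewrite ip_eq0.
      exists (ip g'.1 g'.1 / 2); first by rewrite mulf_neq0.
      by rewrite scalerA (_ : _ * _ = 1) ?scale1r //; field.
    by case: (shp (D k)) R1 R2 => [P|P|n eps] /= R1 R2; [exact: R1|exact: R2|case=> /[dup]; [move=> /R1|move=> /R2]].
  have [d d0] := proj _ kh; have [d' d0' hd'] := nrm_scale Hh.
  rewrite hd' /= !scalerA => kd; apply: (comp_uniq hD jh _ kd).
  by rewrite !mulf_neq0 // gt_eqF.
subst k; move: kh; rewrite (nrm_comp jh).
have red (t : R) : Rc j (t *: h.1) -> t * t = 1.
  by move=> jt; case: (comp_reduced hD jh jt) => ->; ring.
have R1 : S_of (Rc j) (ascale 2^-1 h) -> False.
  by move=> [/red]; lra.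
have R2 : dualS ip (S_of (Rc j)) (ascale 2^-1 (acoroot ip h)) -> False.
  move=> [g [g1 _] /(congr1 fst)] /= eg.
  have := congr1 (coroot ip) eg; rewrite corootK.
  rewrite scalerA -[2 / _]mulrC in eg *.
  rewrite -[(2^-1 * _) *: _]scalerA corootZ // -/(coroot ip h.1) corootK => gE.
  by move: g1; rewrite gE => /red; rewrite invrK; lra.
have [wf _ _] := comp_wf hD j.
case: (shp (D j)) wf R1 R2 jh => [P|P|n eps] /= wf R1 R2 jh; [exact: R1|exact: R2|].
case=> [[/= + _]|]; last exact: R2.
have epsP := wf.2.
move=> /(Cn_ip epsP); rewrite !ipE.
by case: (Cn_ip epsP jh) => ->; case; lra.
Qed.

(** The point is case (iii) with a in S(R): if the gradient is short, a is its own normal form; if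
    it is long, a / 2 is the normal form of a and lies in S, against the hypothesis. *)
Lemma Sall_nrmP a : Sall ip D a -> ~ Sall ip D (ascale 2^-1 a) -> exists2 h, H h & a = nrm h.
Proof.
move=> [j ja] na.
have S1 : S_of (Rc j) a -> nrm a = a -> exists2 h, H h & a = nrm h.
  by move=> [a1 a2] ea; exists a => //; split=> //; exists j.
have S2 : ~ is_caseI (shp (D j)) -> dualS ip (S_of (Rc j)) a -> exists2 h, H h & a = nrm h.
  move=> nI [h [h1 h2] <-]; exists h; first by split=> //; exists j.
  by rewrite (nrm_comp h1); case: (shp (D j)) nI => //= P /(_ I).
have [wf _ _] := comp_wf hD j; have nc := nrm_comp (j := j) (h := a).
have ns h : S_of (Rc j) h -> shape_S ip (shp (D j)) (nrm h).
  move=> [h1 h2]; rewrite (nrm_comp h1).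
  case: (shp (D j)) h1 => [P|P|n eps] /= h1; first by [].
    by exists h.
  by right; exists h.
case E: (shp (D j)) wf ja S1 S2 nc ns => [P|P|n eps] /= wf ja S1 S2 nc ns.
- by apply: (S1 ja); apply: nc; case: ja.
- by apply: S2.
case: ja => [ja|]; last exact: S2.
have epsP := wf.2; have [a1 a2] := ja.
have nE := nc a1; case: (Cn_ip epsP a1) => aa; last first.
  by apply: (S1 ja); rewrite nE /acoroot aa divff ?ascale1 // pnatr_eq0.
case: na; exists j; rewrite E (_ : ascale _ a = nrm a); first exact: ns.
by rewrite nE /acoroot aa; congr ascale; lra.
Qed.

Lemma alcoveE x : alcove ip D x <-> forall i, 0 < aeval ip (hsimple i) x.
Proof.
by split=> xa i; have := xa i; have [c c0 ->] := asimple_scale hD i;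
   rewrite aeval_scale pmulr_rgt0.
Qed.

(** One point of the alcove suffices to recover the sign, because h or -h is [apos]. *)
Lemma Spos_scale c h : 0 < c -> H h -> Sall ip D (ascale c h) ->
  (Spos ip D (ascale c h) <-> apos D h).
Proof.
move=> c0 Hh Sh; split=> [[_ pos]|ph]; last first.
  split=> // x /alcoveE xa; rewrite aeval_scale mulr_gt0 //.
  exact: apos_alcove_gt0 hD _ _ Hh ph xa.
case: (apos_total hD Hh) => // neg.
have [x xP] := alcove_point hD; have xa : alcove ip D x by apply/alcoveE.
have := pos x xa; have := apos_alcove_gt0 hD (HN hD Hh) neg xP.
by rewrite !aeval_scale mulN1r (pmulr_rgt0 _ c0); lra.
Qed.

Lemma ascaleN c h : ascale (-1) (ascale c h) = ascale c (ascale (-1) h).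
Proof. by rewrite !ascaleA mulrC. Qed.

Definition inversions w : set (aff V) :=
  [set h | [/\ H h, apos D h & apos D (ascale (-1) (aact ip w h))]].

(** An inversion b + rc of t(t) u satisfies 0 <= r <= <u b, t>, and b runs through the finite set of
    roots. *)
Lemma finite_inversions w : Waff ip D w -> finite_set (inversions w).
Proof.
move=> [u [t [hu ht ->]]]; have iu := W0_isometry hu.
pose F (b : V) : set (aff V) :=
  (fun n : nat => (b, n%:R)) @` `I_(Num.bound (ip (u b) t)).+1.
apply: (@sub_finite_set _ _ (\bigcup_(b in Rall D) F b)); last first.
  apply: bigcup_finite; first exact: finite_Rall hD.
  by move=> b _; apply: finite_image; exact: finite_II.
move=> [b r] [[/= Rb rZ] pos]; rewrite (aactE _ _ iu) => neg; exists b => //.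
have r0 : 0 <= r by case: pos => /= [/ltW|[-> _]].
have rt : r <= ip (u b) t by case: neg => /= [|[]]; lra.
have /natrP[n rn] : r \is a Num.nat by rewrite natrEint rZ r0.
exists n; last by rewrite rn.
rewrite /= ltnS -(ler_nat R) -rn ltW //; apply: (le_lt_trans rt).
by apply: archi_boundP; exact: le_trans r0 rt.
Qed.

(** [nrm] is injective and compatible with W and with signs, so it carries [inversions] bijectively
    to the set counted by [len]. *)
Lemma lenE w : Waff ip D w -> len ip D w = #|` fset_set (inversions w)|.
Proof.
move=> hw; rewrite /len.
have -> : [set a | [/\ Spos ip D a, ~ Sall ip D (ascale 2^-1 a) & Sneg ip D (aact ip w a)]]
    = nrm @` inversions w.
  apply/seteqP; split=> [a [pa na nega]|_ [h [Hh ph nh] <-]].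
    have [h Hh aE] := Sall_nrmP pa.1 na; exists h => //; subst a.
    have [c c0 hc] := nrm_scale Hh; have Sc := Sall_nrm Hh.
    have Hwh := Waff_H hD hw Hh; have Hn := HN hD Hwh.
    have SnE b : Sneg ip D b = Spos ip D (ascale (-1) b) by [].
    rewrite hc in Sc; move: pa nega; rewrite SnE hc (aact_scale _ _ (Waff_isometry hw)).
    by rewrite ascaleN => /(Spos_scale c0 Hh Sc) ph /[dup] -[Sn _] /(Spos_scale c0 Hn Sn).
  have [c c0 hc] := nrm_scale Hh; have Sc := Sall_nrm Hh.
  have Hwh := Waff_H hD hw Hh; have Hn := HN hD Hwh.
  have nn g : H g -> nrm (ascale (-1) g) = ascale (-1) (nrm g).
    move=> [[j jg] _]; rewrite (nrm_comp (j := j)) ?(nrm_comp jg) /=; last first.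
      by rewrite scaleN1r; exact: (compN hD).
    case: (shp (D j)) => [P|P|n eps] //=; rewrite /acoroot ascaleN /=.
      by rewrite !ipE !mulN1r opprK.
    by rewrite !ipE !mulN1r opprK.
  split.
  - by rewrite hc; apply/(Spos_scale c0 Hh) => //; rewrite -hc.
  - exact: nrm_half.
  - rewrite /Sneg /= hc (aact_scale _ _ (Waff_isometry hw)) ascaleN.
    apply/(Spos_scale c0 Hn) => //.
    rewrite -ascaleN -(aact_scale _ _ (Waff_isometry hw)) -hc -nrm_aact // -nn //.
    exact: Sall_nrm.
rewrite fset_set_image; last exact: finite_inversions.
rewrite card_in_imfset // => h h'.
rewrite !in_fset_set ?inE; try exact: finite_inversions.
by move=> [Hh _ _] [Hh' _ _]; exact: nrm_inj.
Qed.

End Length.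

(** * Additivity of lengths and reduced decompositions *)

Section Reduced.
Context {R : realType} {V : vectType R} (ip : {dot V for idfun}).
Context {m : nat} (D : 'I_m -> component V) (hD : duality_data ip D).
Local Notation H := (S_of (Rall D)).
Local Notation aneg h := (apos D (ascale (-1) h)).
Implicit Types (x y u w : V -> V) (h : aff V) (i : Iaff D).

Lemma apos_sign h : H h -> ~ apos D h -> aneg h.
Proof. by move=> Hh np; case: (apos_total hD Hh). Qed.

Lemma ascaleNN h : ascale (-1) (ascale (-1) h) = h.
Proof. by rewrite ascaleA mulrNN mulr1 ascale1. Qed.

Lemma aactN w h : Waff ip D w -> aact ip w (ascale (-1) h) = ascale (-1) (aact ip w h).
Proof. by move=> /(Waff_isometry)/aact_scale. Qed.

Lemma aact_Waff_comp w w' h : Waff ip D w -> Waff ip D w' ->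
  aact ip (w \o w') h = aact ip w (aact ip w' h).
Proof. by move=> /(Waff_isometry) ? /(Waff_isometry) ?; exact: aact_comp. Qed.

Lemma aact_inj w h h' : Waff ip D w -> aact ip w h = aact ip w h' -> h = h'.
Proof.
move=> hw; have [w' hw' [_ w'w]] := Waff_inv hD hw.
by move/(congr1 (aact ip w')); rewrite -!aact_Waff_comp // w'w !aact_id.
Qed.

(** If x never turns back to positive what y has made negative, the inversions of xy are those of y
    together with the preimages under y of those of x, and the union is disjoint. *)
Lemma len_comp x y : Waff ip D x -> Waff ip D y ->
  (forall h, H h -> apos D h -> aneg (aact ip y h) -> aneg (aact ip x (aact ip y h))) ->
  len ip D (x \o y) = (len ip D x + len ip D y)%N.
Proof.
move=> hx hy xy; have [y' hy' [yy' y'y]] := Waff_inv hD hy.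
have yy'K h : aact ip y (aact ip y' h) = h by rewrite -aact_Waff_comp // yy' aact_id.
have y'yK h : aact ip y' (aact ip y h) = h by rewrite -aact_Waff_comp // y'y aact_id.
have hxy := Waff_comp hD hx hy; rewrite !lenE //.
have -> : inversions ip D (x \o y) = inversions ip D y `|` aact ip y' @` inversions ip D x.
  apply/seteqP; split=> [h [Hh ph]|h].
    rewrite aact_Waff_comp // => nh; have Hyh := Waff_H hD hy Hh.
    have [pyh|nyh] := apos_total hD Hyh; last by left.
    by right; exists (aact ip y h).
  case=> [[Hh ph nh]|[g [Hg pg ng] <-]].
    by split=> //; rewrite aact_Waff_comp //; exact: xy.
  have Hy'g := Waff_H hD hy' Hg; split=> //; last by rewrite aact_Waff_comp // yy'K.
  (* Were y^-1 g negative, its opposite would be an inversion of y that x maps back to a positive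
     affine root. *)
  case: (apos_total hD Hy'g) => // ny'g; exfalso.
  apply: (apos_asym hD) (ng).
  have := xy _ (HN hD Hy'g) ny'g; rewrite !aactN // yy'K !ascaleNN => /(_ pg).
  exact.
rewrite fset_setU; try exact: finite_inversions; last first.
  exact/finite_image/finite_inversions.
rewrite fset_set_image; last exact: finite_inversions.
rewrite cardfsU (_ : (_ `&` _)%fset = fset0) ?cardfs0 ?subn0; last first.
  apply/fsetP => h; rewrite !inE; apply/negP => /andP[].
  rewrite in_fset_set ?inE; last exact: finite_inversions.
  move=> [Hh ph nh] /imfsetP[/= g]; rewrite in_fset_set ?inE; last exact: finite_inversions.
  by move=> [Hg pg ng] hE; move: nh; rewrite hE yy'K => /(apos_asym hD pg).
rewrite addnC card_in_imfset // => h h' _ _; exact: aact_inj.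
Qed.

Lemma inversions_s i : inversions ip D (s_ ip i) = [set hsimple i].
Proof.
apply/seteqP; split=> [h [Hh ph nh]|_ ->].
  apply: contrapT => hi; apply: (apos_asym hD) (nh).
  exact: apos_s.
split; [exact: H_simple hD i | exact: apos_simple hD i |].
by rewrite aact_s_simple // ascaleNN; exact: apos_simple hD i.
Qed.

Lemma len_s i : len ip D (s_ ip i) = 1%N.
Proof. by rewrite lenE ?inversions_s ?fset_set1 ?cardfs1 //; exact: Waff_s. Qed.

Lemma inversion_simple i h : H h -> apos D h -> aneg (aact ip (s_ ip i) h) -> h = hsimple i.
Proof. by move=> Hh ph nh; have : inversions ip D (s_ ip i) h by []; rewrite inversions_s. Qed.

Lemma len_comp_s w i : Waff ip D w -> apos D (aact ip w (hsimple i)) ->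
  len ip D (w \o s_ ip i) = (len ip D w).+1.
Proof.
move=> hw pw; rewrite len_comp ?len_s ?addn1 //; first exact: Waff_s.
move=> h Hh ph /(inversion_simple Hh ph) ->.
by rewrite aact_s_simple // aactN // ascaleNN.
Qed.

Lemma comp_s_K w i : (w \o s_ ip i) \o s_ ip i = w.
Proof. by rewrite -compA s_K. Qed.

Lemma len_comp_s_neg w i : Waff ip D w -> aneg (aact ip w (hsimple i)) ->
  len ip D w = (len ip D (w \o s_ ip i)).+1.
Proof.
move=> hw nw; rewrite -[in LHS](comp_s_K w i) len_comp_s //.
  by apply: Waff_comp => //; exact: Waff_s.
by rewrite aact_Waff_comp ?aact_s_simple ?aactN //; exact: Waff_s.
Qed.

Lemma len0_apos w h : Waff ip D w -> len ip D w = 0%N -> H h -> apos D h ->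
  apos D (aact ip w h).
Proof.
move=> hw; rewrite lenE // => /cardfs0_eq inv0 Hh ph.
have [//|nh] := apos_total hD (Waff_H hD hw Hh).
have : h \in fset_set (inversions ip D w).
  by rewrite in_fset_set ?inE //; exact: finite_inversions.
by rewrite inv0 inE.
Qed.

Lemma apos_len0 w : Waff ip D w -> (forall h, H h -> apos D h -> apos D (aact ip w h)) ->
  len ip D w = 0%N.
Proof.
move=> hw pos; rewrite lenE // (_ : inversions _ _ _ = set0) ?fset_set0 ?cardfs0 //.
by apply/seteqP; split=> // h [Hh ph nh]; apply: (apos_asym hD) (nh); exact: pos.
Qed.

(** Such a w pulls a point x of the alcove back to a point w^-1 x of the alcove. A positive h is
    positive at w^-1 x, that is, wh is positive at x. *)
Lemma simple_apos_len0 w : Waff ip D w -> (forall i, apos D (aact ip w (hsimple i))) ->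
  len ip D w = 0%N.
Proof.
move=> hw pos; apply: apos_len0 => // h Hh ph; have Hwh := Waff_H hD hw Hh.
have [//|nh] := apos_total hD Hwh.
have [x xP] := alcove_point hD; have [w' hw' [ww' _]] := Waff_inv hD hw.
have aw := Waff_isometry hw.
have wx g : aeval ip (aact ip w g) x = aeval ip g (w' x).
  by rewrite -[in LHS](_ : w (w' x) = x) ?aevalE // -[w _]/((w \o w') x) ww'.
have yP i : 0 < aeval ip (hsimple i) (w' x).
  by rewrite -wx; apply: (apos_alcove_gt0 hD) => //; exact: (Waff_H hD hw (H_simple hD i)).
have := apos_alcove_gt0 hD Hh ph yP; have := apos_alcove_gt0 hD (HN hD Hwh) nh xP.
by rewrite aeval_scale wx; lra.
Qed.

Lemma exists_descent w : Waff ip D w -> (0 < len ip D w)%N ->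
  exists i, aneg (aact ip w (hsimple i)).
Proof.
move=> hw lw; apply: contrapT => nex; move: lw; rewrite simple_apos_len0 // => i.
apply: contrapT => np; apply: nex; exists i; apply: apos_sign => //.
exact: (Waff_H hD hw (H_simple hD i)).
Qed.

Lemma prod_s_cat (s s' : seq (Iaff D)) : prod_s ip (s ++ s') = prod_s ip s \o prod_s ip s'.
Proof. by elim: s => //= i s ->. Qed.

Lemma prod_s1 i : prod_s ip [:: i] = s_ ip i.
Proof. by []. Qed.

(** Descents are split off on the right until a factor of length 0 remains. *)
Lemma reduced_decomposition w : Waff ip D w ->
  exists u (s : seq (Iaff D)), [/\ Omega ip D u, w = u \o prod_s ip s & size s = len ip D w].
Proof.
move: {2}(len ip D w) (erefl (len ip D w)) => n; elim: n w => [|n IH] w lw hw.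
  by exists w, [::]; rewrite lw.
have [|i ni] := exists_descent hw; first by rewrite lw.
have hws : Waff ip D (w \o s_ ip i) by apply: Waff_comp => //; exact: Waff_s.
have lws := len_comp_s_neg hw ni; have lwn : len ip D (w \o s_ ip i) = n.
  by move: lws; rewrite lw => -[].
have [u [s [Ou wE ss]]] := IH _ lwn hws.
exists u, (s ++ [:: i]); split=> //; last by rewrite size_cat addn1 ss lws.
by rewrite prod_s_cat prod_s1 compA -wE comp_s_K.
Qed.

Lemma Omega_Waff u : Omega ip D u -> Waff ip D u.
Proof. by case. Qed.

Lemma Omega_apos u h : Omega ip D u -> H h -> apos D h -> apos D (aact ip u h).
Proof. by move=> [hu lu]; exact: len0_apos. Qed.

Lemma Omega_id : Omega ip D id.
Proof.
have h1 := Waff_id ip D; split=> //; apply: apos_len0 => // h _ ph.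
by rewrite aact_id.
Qed.

Lemma Omega_comp u u' : Omega ip D u -> Omega ip D u' -> Omega ip D (u \o u').
Proof.
move=> Ou Ou'; have [[hu _] [hu' _]] := (Ou, Ou').
have huu := Waff_comp hD hu hu'; split=> //; apply: apos_len0 => // h Hh ph.
rewrite aact_Waff_comp //; apply: Omega_apos => //; first exact: Waff_H.
exact: Omega_apos.
Qed.

Lemma Omega_inv u u' : Omega ip D u -> Waff ip D u' -> u \o u' = id -> Omega ip D u'.
Proof.
move=> Ou hu' uu'; split=> //; apply: apos_len0 => // h Hh ph.
have Hu'h := Waff_H hD hu' Hh; have [//|nh] := apos_total hD Hu'h.
have hu := Omega_Waff Ou; have := Omega_apos Ou (HN hD Hu'h) nh.
by rewrite aactN // -aact_Waff_comp // uu' aact_id => /(apos_asym hD ph).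
Qed.

(* The conjugate of s_i by an element of length 0 is a reflection of length 1. *)
Lemma Omega_simple u i : Omega ip D u -> exists i', aact ip u (hsimple i) = hsimple i'.
Proof.
move=> Ou; have hu := Omega_Waff Ou; have [u' hu' [uu' u'u]] := Waff_inv hD hu.
have Ou' := Omega_inv Ou hu' uu'; have hs := Waff_s hD i.
have hus := Waff_comp hD hu hs.
have Hi := H_simple hD i; have pi := apos_simple hD i.
pose w := (u \o s_ ip i) \o u'; have hw : Waff ip D w by exact: Waff_comp.
have lw : len ip D w = 1%N.
  rewrite /w len_comp // => [|h Hh ph]; last first.
    by move/(apos_asym hD (Omega_apos Ou' Hh ph)).
  by rewrite len_comp_s //; [rewrite Ou.2 Ou'.2 | exact: Omega_apos].
have [|i' ni'] := exists_descent hw; first by rewrite lw.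
exists i'; have Hu := Waff_H hD hu Hi.
have wu : aact ip w (aact ip u (hsimple i)) = ascale (-1) (aact ip u (hsimple i)).
  rewrite -aact_Waff_comp // (_ : w \o u = u \o s_ ip i); last first.
    by rewrite /w -compA u'u.
  rewrite aact_Waff_comp //.
  by rewrite aact_s_simple // aactN.
(* Both u a_i and a_i' are inversions of w, which has only one. *)
have : inversions ip D w (aact ip u (hsimple i)).
  by split=> //; [exact: Omega_apos | rewrite wu ascaleNN; exact: Omega_apos].
have : inversions ip D w (hsimple i').
  by split=> //; [exact: H_simple hD i' | exact: apos_simple hD i'].
have fin := finite_inversions hD hw.
have /eqP/cardfs1P[h0 iw] : #|` fset_set (inversions ip D w)| = 1%N by rewrite -lenE.
have mem h : inversions ip D w h -> h = h0.
  by move=> ih; have : h \in fset_set (inversions ip D w);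
     [rewrite in_fset_set ?inE | rewrite iw inE => /eqP].
by move=> /mem -> /mem ->.
Qed.

End Reduced.

(** * Operators on K[L] *)

Section Supported.
Context {R : realType} {V : vectType R} {K : fieldType} (M : set V).
Implicit Types f g : KV V K.

Lemma supported_mcoeff f : supported M f <-> forall x, f@_x != 0 -> M x.
Proof. by split=> h x; [rewrite mcoeff_neq0 | rewrite -mcoeff_neq0]; exact: h. Qed.

Lemma supported0 : supported M (0 : KV V K).
Proof. by move=> x; rewrite msupp0 inE. Qed.

Lemma supported_linear c f g : supported M f -> supported M g -> supported M (c *: f + g).
Proof.
move=> /supported_mcoeff hf /supported_mcoeff hg; apply/supported_mcoeff => x.
rewrite mcoeffD mcoeffZ; have [f0|f0 _] := eqVneq f@_x 0; last exact: hf.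
by rewrite f0 mulr0 add0r; exact: hg.
Qed.

Lemma supported_sum I (s : seq I) (P : pred I) (F : I -> KV V K) :
  (forall i, P i -> supported M (F i)) -> supported M (\sum_(i <- s | P i) F i).
Proof.
move=> hF; apply: (big_ind (supported M)) => //; first exact: supported0.
by move=> f g hf hg; rewrite -[f]scale1r; exact: supported_linear.
Qed.

End Supported.

(* [s] stands for the simple reflection, [ea] for the exponential of its affine root,
   [T1] and [T2] for T f and T (T f), and [t'], [u'], [ea'] for inverses. *)
Lemma demazure_lusztig_quadratic (A : comNzRingType) (s : A -> A)
    (f T1 T2 X1 X2 t t' u u' ea ea' d n : A) :
    (forall x y, s (x * y) = s x * s y) -> (forall x y, s (x + y) = s x + s y) ->
    (forall x, s (- x) = - s x) -> s (s f) = f ->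
    s t = t -> s t' = t' -> s u = u -> s u' = u' -> s 1 = 1 -> s ea = ea' ->
    t * t' = 1 -> ea * ea' = 1 ->
    d = 1 - ea * ea -> n = (t - t') + (u - u') * ea -> X1 = t * s f -> X2 = t * s T1 ->
    d * (T1 - X1) = n * (f - s f) -> d * (T2 - X2) = n * (T1 - s T1) ->
  d * (d * (T2 - ((t - t') * T1 + f))) = 0.
Proof.
move=> sM sD sN sK st st' su su' s1 se tt ee dE nE -> -> e1 e2.
(* The equation for T1 with [s] applied to it. *)
have e1s : (1 - ea' * ea') * (s T1 - t * f) = ((t - t') + (u - u') * ea') * (s f - f).
  by have := congr1 s e1; rewrite dE nE !(sM, sD, sN) s1 st st' su su' se sK.
(* This is [ea * ea * s n]: the reflected denominator satisfies d = - ea * ea * s d, so [n'] is, up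
   to sign, the reflected numerator over the denominator d. *)
pose n' := n - (t - t') * d.
have {}e1s : d * s T1 = t * d * f + n' * (f - s f).
  have -> : d * s T1 = t * d * f - ea * ea * ((1 - ea' * ea') * (s T1 - t * f)).
    by rewrite dE; ring: ee.
  by rewrite e1s /n' nE dE; ring: ee.
have {}e1 : d * T1 = t * d * s f + n * (f - s f) by rewrite -e1; ring.
have {}e2 : d * T2 = t * d * s T1 + n * (T1 - s T1) by rewrite -e2; ring.
have -> : d * (d * (T2 - ((t - t') * T1 + f))) =
  d * (d * T2) - (t - t') * d * (d * T1) - d * d * f by ring.
have -> : d * (d * T2) = (t * d - n) * (d * s T1) + n * (d * T1) by rewrite e2; ring.
by rewrite e1s e1 /n'; ring: tt.
Qed.

(** * The Demazure-Lusztig operators T_i *)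

Section DemazureLusztig.
Context {R : realType} {V : vectType R} (ip : {dot V for idfun}).
Context {m : nat} (D : 'I_m -> component V) (hD : duality_data ip D).
Context (k : aff V -> R) (hk : labelling ip D k).
Context {K : fieldType} (q : R -> K).
Hypothesis q_neq0 : forall x, q x != 0.
Hypothesis qD : forall x y, q (x + y) = q x * q y.
Context (Ti : Iaff D -> KV V K -> KV V K) (hTi : is_Ti ip q k Ti).
Local Notation supp := (supported (Lall ip D)).
Local Notation H := (S_of (Rall D)).
Local Notation gact := (gact ip q).
Implicit Types (f g : KV V K) (i : Iaff D) (u w : V -> V).

Lemma supported_gact w f : Waff ip D w -> supp f -> supp (gact w f).
Proof.
move=> [u [t [hu ht ->]]] hf; rewrite gactE /mextend big_seq.
apply: supported_sum => x xf y; rewrite (aactE _ _ (W0_isometry hu)) /=.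
move/(fsubsetP (msuppZ_le _ _)); rewrite msuppU.
by case: ifP; rewrite // inE => _ /eqP ->; apply: W0_L => //; exact: hf.
Qed.

Definition dl_den i : galg := e_ q (0, 0) - e_ q (ascale 2 (asimple ip i)).
Definition dl_num i : galg :=
  (tau ip D q k (asimple ip i) - (tau ip D q k (asimple ip i))^-1) *: e_ q (0, 0)
  + (ttau ip D q k (asimple ip i) - (ttau ip D q k (asimple ip i))^-1) *: e_ q (asimple ip i).
Local Notation tau_ i := (tau ip D q k (asimple ip i)).
Local Notation ttau_ i := (ttau ip D q k (asimple ip i)).

Lemma tau_neq0 i : tau_ i != 0.
Proof. exact: q_neq0. Qed.

Lemma asimple_neq0 i : (asimple ip i).1 != 0.
Proof.
have [c c0 ->] := asimple_scale hD i; rewrite /= scaler_eq0 gt_eqF //=.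
exact: (H_neq0 hD (H_simple hD i)).
Qed.

Lemma dl_den_inj i (f : galg) : dl_den i * f = 0 -> f = 0.
Proof.
apply: (gmul_1e_inj ip q_neq0 qD) => /=.
by rewrite scaler_eq0 pnatr_eq0 /= asimple_neq0.
Qed.

Lemma Ti_supported i f : supp f -> supp (Ti i f).
Proof. by move=> /(hTi i)[]. Qed.

Lemma Ti_eq i f : supp f ->
  dl_den i * (Ti i f - tau_ i *: gact (s_ ip i) f : galg) =
  dl_num i * (f - gact (s_ ip i) f : galg).
Proof. by move=> /(hTi i)[]. Qed.

(** As 1 - e(2a_i) is not a zero divisor, a formula for T_i f can be proved by checking the defining
    identity; linearity and equivariance under [Omega] are obtained so. *)
Lemma Ti_uniq i f g : supp f ->
  dl_den i * (g - tau_ i *: gact (s_ ip i) f : galg) =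
  dl_num i * (f - gact (s_ ip i) f : galg) -> g = Ti i f.
Proof.
move=> hf e; apply/eqP; rewrite -subr_eq0; apply/eqP; apply: (@dl_den_inj i).
rewrite (_ : g - _ = (g - tau_ i *: gact (s_ ip i) f) - (Ti i f - tau_ i *: gact (s_ ip i) f)).
  by rewrite (mulrBr (dl_den i)) e Ti_eq // subrr.
by rewrite opprB addrA subrK.
Qed.

Lemma Ti_linear i c f g : supp f -> supp g -> Ti i (c *: f + g) = c *: Ti i f + Ti i g.
Proof.
move=> hf hg; apply/esym/Ti_uniq; first exact: supported_linear.
have ef := Ti_eq i hf; have eg := Ti_eq i hg.
rewrite !(gact_is_linear ip q (s_ ip i)).
set sf := gact _ f in ef *; set sg := gact _ g in eg *; set t := tau_ i in ef eg *.
have -> : c *: Ti i f + Ti i g - t *: (c *: sf + sg) =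
          c *: (Ti i f - t *: sf) + (Ti i g - t *: sg).
  by rewrite scalerDr scalerBr !scalerA (mulrC t) opprD addrACA.
have -> : c *: f + g - (c *: sf + sg) = c *: (f - sf) + (g - sg).
  by rewrite scalerBr opprD addrACA.
rewrite -!gmulM !gmul_linearr.
exact: (congr2 (fun x y => c *: x + y) ef eg).
Qed.

Lemma aact_s_asimple i : aact ip (s_ ip i) (asimple ip i) = ascale (-1) (asimple ip i).
Proof.
have [c c0 ->] := asimple_scale hD i.
rewrite (aact_scale _ _ (Waff_isometry (Waff_s hD i))) aact_s_simple //.
by rewrite !ascaleA mulrC.
Qed.

Lemma Ti_quadratic i f : supp f ->
  Ti i (Ti i f) = (tau_ i - (tau_ i)^-1) *: Ti i f + f.
Proof.
move=> hf; have hTf : supp (Ti i f) by exact: Ti_supported.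
have as_ := Waff_isometry (Waff_s hD i).
have e1 := Ti_eq i hf; have e2 := Ti_eq i hTf.
pose A := @galg R V K; pose s : A -> A := gact (s_ ip i).
pose F : A := f; pose T1 : A := Ti i f; pose T2 : A := Ti i (Ti i f).
pose tc : A := gconst (tau_ i); pose tc' : A := gconst (tau_ i)^-1.
pose uc : A := gconst (ttau_ i); pose uc' : A := gconst (ttau_ i)^-1.
pose ea : A := e_ q (asimple ip i); pose ea' : A := e_ q (ascale (-1) (asimple ip i)).
have tt : tc * tc' = 1 by rewrite -gconstM mulfV ?gconst1 ?tau_neq0.
have eV : ea * ea' = 1.
  rewrite /ea /ea' -gmulM e_M // -(e_0 (V := V) q_neq0 qD) /= scaleN1r mulN1r.
  by rewrite !subrr.
have e2a : e_ q (ascale 2 (asimple ip i)) = ea * ea :> A.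
  rewrite /ea -gmulM e_M //; congr e_.
  by rewrite /ascale scaler_nat mulr2n mulrDl mul1r.
have sM x y : s (x * y) = s x * s y by exact: gactM.
have sN x : s (- x) = - s x by exact: linearN.
have sD x y : s (x + y) = s x + s y by exact: linearD.
have sc c : s (gconst c) = gconst c by exact: gact_const.
have se : s ea = ea' by rewrite /s /ea gact_e // aact_s_asimple.
have sK x : s (s x) = x by rewrite /s -gact_comp // s_K gact_id.
have e01 : e_ q (0, 0) = 1 :> A by exact: e_0.
have DE : dl_den i = 1 - ea * ea by rewrite /dl_den e01 e2a.
have NE : dl_num i = (tc - tc') + (uc - uc') * ea.
  rewrite /dl_num e01 -gconstN -gconstD -[uc']/(gconst _) -gconstN -gconstD -gconstZ.
  by rewrite [gconst _](esym (mulr1 _)) -gconstZ.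
have X1 : tau_ i *: s F = tc * s F by exact: gconstZ.
have X2 : tau_ i *: s T1 = tc * s T1 by exact: gconstZ.
have := demazure_lusztig_quadratic sM sD sN (sK F) (sc _) (sc _) (sc _) (sc _) (sc 1)
  se tt eV DE NE X1 X2 e1 e2.
move=> /dl_den_inj/dl_den_inj/eqP; rewrite subr_eq0 => /eqP T2E.
apply: (etrans T2E); congr (_ + _).
by rewrite -gconstN -gconstD -gconstZ.
Qed.

(** Since [asimple] is the normal form of [hsimple], u maps one [asimple] to another; the labels and
    the condition 2a in S are invariant under W. *)
Lemma tau_Omega u i i' : Omega ip D u -> aact ip u (hsimple i) = hsimple i' ->
  [/\ aact ip u (asimple ip i) = asimple ip i', tau_ i' = tau_ i & ttau_ i' = ttau_ i].
Proof.
move=> Ou ui; have hu := Omega_Waff Ou; have Hi := H_simple hD i.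
have ai : aact ip u (asimple ip i) = asimple ip i'.
  by rewrite !(asimpleE hD) -nrm_aact // ui.
have Sa : Sall ip D (asimple ip i) by rewrite (asimpleE hD); exact: Sall_nrm.
have kE : k (asimple ip i') = k (asimple ip i) by rewrite -ai hk.
have [u' hu' [uu' u'u]] := Waff_inv hD hu.
have u2 : aact ip u (ascale 2 (asimple ip i)) = ascale 2 (asimple ip i').
  by rewrite (aact_scale _ _ (Waff_isometry hu)) ai.
have k2E : k2 ip D k (asimple ip i') = k2 ip D k (asimple ip i).
  rewrite /k2 -u2; case: asboolP => [S2|nS2]; case: asboolP => [S2'|nS2'] //.
  - by rewrite hk.
  - case: nS2'; have := Sall_aact hD hu' S2.
    by rewrite -(aact_Waff_comp _ hu' hu) u'u aact_id.
  - by case: nS2; exact: Sall_aact.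
by split=> //; rewrite /tau /ttau kE k2E.
Qed.

Lemma Ti_Omega u i i' f : Omega ip D u -> aact ip u (hsimple i) = hsimple i' -> supp f ->
  gact u (Ti i f) = Ti i' (gact u f).
Proof.
move=> Ou ui hf; have hu := Omega_Waff Ou; have au := Waff_isometry hu.
have [ai ti tti] := tau_Omega Ou ui.
apply: Ti_uniq; first exact: supported_gact.
have us : s_ ip i' \o u = u \o s_ ip i.
  by rewrite !s_E // srefl_aactJ ?ui.
have as_ j := Waff_isometry (Waff_s hD j).
rewrite -gact_comp // us gact_comp // ti.
have gM (x y : @galg R V K) : gact u (x * y) = (gact u x : galg) * gact u y by exact: gactM.
have e0 : aact ip u (0, 0) = (0, 0).
  by have := aact_scale 0 (0, 0) au; rewrite /ascale /= !scale0r !mul0r.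
have gB (x y : @galg R V K) : gact u (x - y) = (gact u x : galg) - gact u y by exact: linearB.
have gD (x y : @galg R V K) : gact u (x + y) = (gact u x : galg) + gact u y by exact: linearD.
have gZ c (x : @galg R V K) : gact u (c *: x) = c *: (gact u x : galg) by exact: linearZ.
have ge a : gact u (e_ q a) = e_ q (aact ip u a) by exact: gact_e.
have := congr1 (gact u) (Ti_eq i hf); rewrite !gM.
have -> : gact u (dl_den i) = dl_den i'.
  by rewrite /dl_den gB !ge e0 (aact_scale _ _ au) ai.
have -> : gact u (dl_num i) = dl_num i'.
  by rewrite /dl_num gD !gZ !ge e0 ai ti tti.
by rewrite !gB gZ.
Qed.

End DemazureLusztig.

(** * K[L] as a module in its own right *)

Section WeightModule.
Context {R : realType} {V : vectType R} (ip : {dot V for idfun}).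
Context {m : nat} (D : 'I_m -> component V) (K : fieldType).

Definition KL_pred : {pred KV V K} := fun f => `[< supported (Lall ip D) f >].

Lemma KL_predP f : reflect (supported (Lall ip D) f) (f \in KL_pred).
Proof. exact: asboolP. Qed.

Lemma KL_submod_closed : submod_closed KL_pred.
Proof.
split; first by apply/KL_predP; exact: supported0.
by move=> c f g /KL_predP hf /KL_predP hg; apply/KL_predP; exact: supported_linear.
Qed.

HB.instance Definition _ := GRing.isSubmodClosed.Build K (KV V K) KL_pred KL_submod_closed.

(** The given operators are controlled on K[L] only. Restricting them to this type gives genuine
    linear endomorphisms, to which an abstract module structure applies. *)
Record KL := MkKL { KLval : KV V K; _ : KLval \in KL_pred }.

HB.instance Definition _ := [isSub for KLval].
HB.instance Definition _ := [Choice of KL by <:].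
HB.instance Definition _ := [SubChoice_isSubLmodule of KL by <:].

Lemma KL_supported (f : KL) : supported (Lall ip D) (val f).
Proof. exact/KL_predP/(valP f). Qed.

(** Anything outside K[L] is sent to 0; for operators that preserve K[L] this default is never
    reached, by [lift_KLE]. *)
Definition to_KL (f : KV V K) : KL := insubd 0 f.

Lemma to_KLK f : supported (Lall ip D) f -> val (to_KL f) = f.
Proof. by move=> hf; rewrite val_insubd; move/KL_predP: hf => ->. Qed.

Definition lift_KL (F : KV V K -> KV V K) (f : KL) : KL := to_KL (F (val f)).

Definition preserves_KL (F : KV V K -> KV V K) : Prop :=
  forall f, supported (Lall ip D) f -> supported (Lall ip D) (F f).

Lemma lift_KLE F f : preserves_KL F -> val (lift_KL F f) = F (val f).
Proof. by move=> pF; rewrite to_KLK //; exact/pF/KL_supported. Qed.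

End WeightModule.

(** * Products and quadratic relations of the operators T(w) *)

Section HeckeOperators.
Context {R : realType} {V : vectType R} (ip : {dot V for idfun}).
Context {m : nat} (D : 'I_m -> component V) (hD : duality_data ip D).
Context (k : aff V -> R) (hk : labelling ip D k).
Context {K : fieldType} (q : R -> K).
Hypothesis q_neq0 : forall x, q x != 0.
Hypothesis qD : forall x y, q (x + y) = q x * q y.
Context (Ti : Iaff D -> KV V K -> KV V K) (hTi : is_Ti ip q k Ti).
Context (T : (V -> V) -> KV V K -> KV V K) (hT : is_T ip q Ti T).
Context (Y : V -> KV V K -> KV V K) (hY : is_Y ip D T Y).
Local Notation supp := (supported (Lall ip D)).
Local Notation H := (S_of (Rall D)).
Local Notation aneg h := (apos D (ascale (-1) h)).
Local Notation gact := (gact ip q).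
Local Notation tau_ i := (tau ip D q k (asimple ip i)).
Implicit Types (f : KV V K) (i : Iaff D) (u w x y : V -> V) (s : seq (Iaff D)).

Lemma foldr_Ti_supported s f : supp f -> supp (foldr Ti f s).
Proof. by move=> hf; elim: s => //= i s IH; exact: (Ti_supported hTi IH). Qed.

Lemma foldr_Ti_linear s c f g : supp f -> supp g ->
  foldr Ti (c *: f + g) s = c *: foldr Ti f s + foldr Ti g s.
Proof.
move=> hf hg; elim: s => //= i s ->.
by apply: (Ti_linear hD q_neq0 qD hTi); exact: foldr_Ti_supported.
Qed.

Lemma T_decomposition w : Waff ip D w -> exists u s,
  [/\ Omega ip D u, w = u \o prod_s ip s, len ip D w = size s &
      forall f, supp f -> T w f = gact u (foldr Ti f s)].
Proof.
move=> hw; have [u [s [Ou wE sw]]] := reduced_decomposition hD hw.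
by exists u, s; split=> // f hf; rewrite [in LHS]wE hT // -wE sw.
Qed.

Lemma T_preserves w : Waff ip D w -> preserves_KL ip D (T w).
Proof.
move=> hw f hf; have [u [s [Ou _ _ ->//]]] := T_decomposition hw.
by apply: (supported_gact hD); [exact: Omega_Waff | exact: foldr_Ti_supported].
Qed.

Lemma T_linear w c f g : Waff ip D w -> supp f -> supp g ->
  T w (c *: f + g) = c *: T w f + T w g.
Proof.
move=> hw hf hg; have [u [s [Ou _ _ Tw]]] := T_decomposition hw.
by rewrite !Tw ?foldr_Ti_linear ?(gact_is_linear ip q u) //; exact: supported_linear.
Qed.

(** Conjugation by u permutes the simple reflections, so u moves to the left of a word of unchanged
    size. This brings a product of two decompositions to the form on which [is_T] determines T. *)
Lemma Omega_prod_s_comm u s : Omega ip D u -> exists s',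
  [/\ prod_s ip s \o u = u \o prod_s ip s', size s' = size s &
      forall f, supp f -> foldr Ti (gact u f) s = gact u (foldr Ti f s')].
Proof.
move=> Ou; have hu := Omega_Waff Ou; have [v hv [uv vu]] := Waff_inv hD hu.
have Ov := Omega_inv hD Ou hv uv.
elim: s => [|i s [s' [ss' size_s' Ts']]]; first by exists [::].
have [j vi] := Omega_simple hD i Ov.
have uj : aact ip u (hsimple j) = hsimple i by rewrite -vi -(aact_Waff_comp _ hu hv) uv aact_id.
exists (j :: s'); split=> /=; last 2 first.
- by rewrite size_s'.
- move=> f hf; rewrite Ts' // (Ti_Omega hD hk q_neq0 qD hTi Ou uj) //.
  exact: foldr_Ti_supported.
have us : u \o s_ ip j = s_ ip i \o u.
  by rewrite !(s_E hD) srefl_aactJ ?uj //; exact: (Waff_isometry hu).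
apply/funext => z /=; have /= -> := congr1 (@^~ (prod_s ip s' z)) us.
by congr (s_ ip i _); exact: (congr1 (@^~ z) ss').
Qed.

Lemma T_mul x y f : Waff ip D x -> Waff ip D y -> supp f ->
  len ip D (x \o y) = (len ip D x + len ip D y)%N -> T (x \o y) f = T x (T y f).
Proof.
move=> hx hy hf lxy; have hTy := T_preserves hy hf.
have [u [s [Ou xE lx Tx]]] := T_decomposition hx.
have [v [s' [Ov yE ly Ty]]] := T_decomposition hy.
have [s1 [ss1 size_s1 Ts1]] := Omega_prod_s_comm s Ov.
have xyE : x \o y = (u \o v) \o prod_s ip (s1 ++ s').
  rewrite prod_s_cat xE yE; apply/funext => z /=; congr (u _).
  exact: (congr1 (@^~ (prod_s ip s' z)) ss1).
have hu := Omega_Waff Ou; have hv := Omega_Waff Ov.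
rewrite Tx // Ty // [in LHS]xyE hT //; first last.
- by rewrite -xyE lxy size_cat size_s1 lx ly.
- exact: Omega_comp.
rewrite (gact_comp _ _ (Waff_isometry hu) (Waff_isometry hv)) //.
by rewrite foldr_cat Ts1 //; exact: foldr_Ti_supported.
Qed.

Lemma T_s i f : supp f -> T (s_ ip i) f = Ti i f.
Proof.
move=> hf; have := hT (u := id) (s := [:: i]) (f := f) (Omega_id hD) _ hf => /= ->.
  exact: gact_id.
exact: len_s.
Qed.

Definition KL_T w : KL ip D K -> KL ip D K := lift_KL (T w).
Definition KL_Ti i := KL_T (s_ ip i).
Definition KL_Y t : KL ip D K -> KL ip D K := lift_KL (Y t).

Lemma val_KL_T w g : Waff ip D w -> val (KL_T w g) = T w (val g).
Proof. by move=> hw; apply: lift_KLE; exact: T_preserves. Qed.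

Lemma val_KL_Y t g : L'all ip D t -> val (KL_Y t g) = Y t (val g).
Proof. by move=> ht; apply: lift_KLE; have [_ h _ _] := hY; move=> f; exact: h. Qed.

Lemma KL_T_linear w : Waff ip D w -> linear (KL_T w).
Proof.
move=> hw c f g; apply: val_inj; rewrite linearP /= !(val_KL_T _ hw) linearP /=.
by apply: T_linear => //; exact: KL_supported.
Qed.

Lemma KL_T_comp x y g : Waff ip D x -> Waff ip D y ->
  (forall h, H h -> apos D h -> aneg (aact ip y h) -> aneg (aact ip x (aact ip y h))) ->
  KL_T (x \o y) g = KL_T x (KL_T y g).
Proof.
move=> hx hy xy; have hxy := Waff_comp hD hx hy; apply: val_inj.
rewrite (val_KL_T _ hxy) (val_KL_T _ hx) (val_KL_T _ hy).
by apply: T_mul => //; [exact: KL_supported | exact: len_comp].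
Qed.

Lemma KL_Ti_quadratic i g : KL_Ti i (KL_Ti i g) = (tau_ i - (tau_ i)^-1) *: KL_Ti i g + g.
Proof.
have hs := Waff_s hD i; have hg : supp (val g) by exact: KL_supported.
apply: val_inj; rewrite linearP /= !(val_KL_T _ hs) !(T_s _ hg) T_s.
  exact: (Ti_quadratic hD q_neq0 qD hTi).
exact: (Ti_supported hTi).
Qed.

Lemma KL_T_comp_s w i g : Waff ip D w -> apos D (aact ip w (hsimple i)) ->
  KL_T (w \o s_ ip i) g = KL_T w (KL_Ti i g).
Proof.
move=> hw pw; have hs := Waff_s hD i; apply: KL_T_comp => // h Hh ph.
move=> /(inversion_simple hD Hh ph) ->.
by rewrite aact_s_simple // (aactN _ hw) ascaleNN.
Qed.

Lemma KL_T_s_comp w i g : Waff ip D w ->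
  (forall h, H h -> apos D h -> aact ip w h <> ascale (-1) (hsimple i)) ->
  KL_T (s_ ip i \o w) g = KL_Ti i (KL_T w g).
Proof.
move=> hw nw; have hs := Waff_s hD i; apply: KL_T_comp => // h Hh ph nh.
rewrite -(aactN _ hs); apply: (apos_s hD) => //; first exact/(HN hD)/(Waff_H hD hw Hh).
by move=> e; apply: (nw h) => //; rewrite -e ascaleNN.
Qed.

Lemma KL_Y_dominant t g : L'all ip D t -> dominant ip D t -> KL_Y t g = KL_T (translation t) g.
Proof.
move=> ht dt; apply: val_inj; rewrite val_KL_Y // val_KL_T; last exact: Waff_translation.
by have [h _ _ _] := hY; apply: h => //; exact: KL_supported.
Qed.

Lemma KL_Y0 g : KL_Y 0 g = g.
Proof.
apply: val_inj; rewrite val_KL_Y; last exact: L'all0.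
by have [_ _ h _] := hY; apply: h; exact: KL_supported.
Qed.

Lemma KL_YD t t' g : L'all ip D t -> L'all ip D t' -> KL_Y (t + t') g = KL_Y t (KL_Y t' g).
Proof.
move=> ht ht'; apply: val_inj; rewrite !val_KL_Y //; last exact: L'allD.
by have [_ _ _ h] := hY; apply: h => //; exact: KL_supported.
Qed.

End HeckeOperators.

(** * The Bernstein relations *)

Section LinearMaps.
Context {K : nzRingType} {U W : lmodType K} (f : U -> W) (lf : linear f).

Lemma linear_fD x y : f (x + y) = f x + f y.
Proof. by have := lf 1 x y; rewrite !scale1r. Qed.

Lemma linear_f0 : f 0 = 0.
Proof. by have := linear_fD 0 0; rewrite addr0 => /(congr1 (+%R^~ (- f 0))); rewrite addrK subrr. Qed.

Lemma linear_fZ c x : f (c *: x) = c *: f x.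
Proof. by have := lf c x 0; rewrite !addr0 linear_f0 addr0. Qed.

Lemma linear_fB x y : f (x - y) = f x - f y.
Proof. by rewrite linear_fD -scaleN1r linear_fZ scaleN1r. Qed.

End LinearMaps.

Section Bernstein.
Context {R : realType} {V : vectType R} (ip : {dot V for idfun}).
Context {m : nat} (D : 'I_m -> component V) (hD : duality_data ip D).
Local Notation Rc j := (shape_R (shp (D j))).
Local Notation H := (S_of (Rall D)).
Local Notation aneg h := (apos D (ascale (-1) h)).
Context {K : fieldType} (M : lmodType K).
Implicit Types (t x y b : V) (u w : V -> V) (h : aff V) (i : Iaff D) (j : I0 D) (g : M).

(* A module over the affine Hecke algebra: tw w is the action of T(w), yl t that
   of Y^t, and a i = tau_i - tau_i^-1. *)
Record hecke_module (a : Iaff D -> K) (tw : (V -> V) -> M -> M) (yl : V -> M -> M) : Prop :=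
  HeckeModule {
  hm_linear : forall w, Waff ip D w -> linear (tw w);
  hm_quadratic : forall i g,
    tw (s_ ip i) (tw (s_ ip i) g) = a i *: tw (s_ ip i) g + g;
  hm_comp : forall u w g, Waff ip D u -> Waff ip D w ->
    (forall h, H h -> apos D h -> aneg (aact ip w h) -> aneg (aact ip u (aact ip w h))) ->
    tw (u \o w) g = tw u (tw w g);
  hm_comp_s : forall w i g, Waff ip D w -> apos D (aact ip w (hsimple i)) ->
    tw (w \o s_ ip i) g = tw w (tw (s_ ip i) g);
  hm_s_comp : forall w i g, Waff ip D w ->
    (forall h, H h -> apos D h -> aact ip w h <> ascale (-1) (hsimple i)) ->
    tw (s_ ip i \o w) g = tw (s_ ip i) (tw w g);
  hm_dominant : forall t g, L'all ip D t -> dominant ip D t -> yl t g = tw (translation t) g;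
  hm_0 : forall g, yl 0 g = g;
  hm_add : forall t t' g, L'all ip D t -> L'all ip D t' -> yl (t + t') g = yl t (yl t' g) }.

Context (a : Iaff D -> K) (tw : (V -> V) -> M -> M) (yl : V -> M -> M).
Hypothesis hM : hecke_module a tw yl.
Local Notation ti i := (tw (s_ ip i)).
Local Notation tj j := (tw (s_ ip (inl j))).
Local Notation sj j := (refl ip (sroot j)).

Lemma hm_Ti_linear i : linear (ti i).
Proof. by apply: (hm_linear hM); exact: Waff_s. Qed.

Lemma dominantP t : dominant ip D t <-> forall j, 0 <= ip t (sroot j).
Proof.
split=> [dt j|dt b pb]; first exact/dt/(Rpos_sroot hD).
by rewrite ipC; apply: Rpos_ge0 pb => j; rewrite ipC.
Qed.

(** b is 2N times the sum of the fundamental coweights selected by [c]: the factor 2 puts it in L',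
    and N exceeds every pairing of t in absolute value. Leaving out j makes b orthogonal to
    alpha_j. *)
Lemma dominant_shift (c : pred (I0 D)) t : L'all ip D t ->
  (forall j, ~~ c j -> 0 <= ip t (sroot j)) ->
  exists b, [/\ L'all ip D b, dominant ip D b, dominant ip D (t + b) &
                forall j, ~~ c j -> ip b (sroot j) = 0].
Proof.
move=> ht tc; have [x xP] := dual_point hD (fun j => (c j)%:R).
have x2 : L'all ip D (2 *: x).
  apply: (L'all_double hD); apply: (Rall_ip_int hD) => j.
  by rewrite xP; exact: natr_int.
pose N := Num.bound (\sum_(j : I0 D) `|ip t (sroot j)|).
have bE j : ip (N%:R *: (2 *: x)) (sroot j) = N%:R * (2 * (c j)%:R).
  by rewrite !ipZl ipC xP.
exists (N%:R *: (2 *: x)); split.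
- exact: L'all_nat.
- by apply/dominantP => j; rewrite bE !mulr_ge0.
- apply/dominantP => j; rewrite ipDl bE; case cj: (c j); last first.
    by rewrite !mulr0 addr0 tc // cj.
  have tN : `|ip t (sroot j)| <= N%:R.
    apply: le_trans (ltW (archi_boundP _)); last by apply: sumr_ge0.
    by rewrite (bigD1 j) //= lerDl sumr_ge0.
  have := ler_norm (- ip t (sroot j)); rewrite normrN => tn.
  have : 0 <= N%:R :> R by [].
  by rewrite mulr1; lra.
- by move=> j /negPf cj; rewrite bE cj !mulr0.
Qed.

Lemma ylNK t g : L'all ip D t -> yl (- t) (yl t g) = g.
Proof. by move=> ht; rewrite -(hm_add hM) ?addNr ?(hm_0 hM) //; exact: L'allN. Qed.

Lemma ylKN t g : L'all ip D t -> yl t (yl (- t) g) = g.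
Proof. by move=> ht; rewrite -(hm_add hM) ?subrr ?(hm_0 hM) //; exact: L'allN. Qed.

Lemma yl_inj t g g' : L'all ip D t -> yl t g = yl t g' -> g = g'.
Proof. by move=> ht e; rewrite -(ylNK g ht) e ylNK. Qed.

(** Y^b Y^t = Y^(t+b) with b and t + b dominant, and Y^b is injective. *)
Lemma yl_linear t : L'all ip D t -> linear (yl t).
Proof.
move=> ht.
have dom s : L'all ip D s -> dominant ip D s -> linear (yl s).
  move=> hs ds c g g'; rewrite !(hm_dominant hM) //.
  by rewrite (hm_linear hM) //; exact: Waff_translation.
have [b [hb db dtb _]] := dominant_shift (c := xpredT) ht (fun j => ltac:(by [])).
move=> c g g'; apply: (yl_inj hb); rewrite (dom b hb db) -!(hm_add hM) // [b + t]addrC.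
by rewrite (dom (t + b)) //; exact: L'allD.
Qed.

Lemma aact_translation t h : aact ip (translation t) h = (h.1, h.2 - ip h.1 t).
Proof. by have := aactE t h (isometry_id ip). Qed.

Lemma s_inl j : s_ ip (inl j) = sj j.
Proof. by rewrite (s_E hD). Qed.

Lemma isometry_sj j : isometry ip (sj j).
Proof. exact: isometry_refl. Qed.

Lemma L'_sj j t : L'all ip D t -> L'all ip D (sj j t).
Proof. by apply: (L'all_refl hD); exact: (Rall_sroot hD). Qed.

Lemma aact_sj j h : aact ip (s_ ip (inl j)) h = (sj j h.1, h.2).
Proof. by rewrite s_inl aact_linear //; exact: isometry_refl. Qed.

Lemma ip_sj j x y : ip (sj j x) y = ip x (sj j y).
Proof. by rewrite -[in LHS](reflK ip (sroot j) y) refl_isometric. Qed.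

Lemma sj_fix j t : ip t (sroot j) = 0 -> sj j t = t.
Proof. by move=> e; rewrite refl_orth // ipC. Qed.

Lemma Rpos_sj j b : Rpos D b -> b <> sroot j -> Rpos D (sj j b).
Proof.
move=> pb bj; have Hb : H (b, 0) by split; [exact: Rpos_Rall | exact: rpred0].
have := apos_s hD (i := inl j) Hb; rewrite aact_sj /=.
by case=> [|[]|/=|[]] //; [right | rewrite ltxx].
Qed.

Lemma ti_yl_comm_dominant j t g : L'all ip D t -> dominant ip D t -> ip t (sroot j) = 0 ->
  tj j (yl t g) = yl t (tj j g).
Proof.
move=> ht dt tj0; have wt := Waff_translation ht.
have comm : s_ ip (inl j) \o translation t = translation t \o s_ ip (inl j).
  apply/funext => x; rewrite s_inl /translation /=.
  by rewrite (isometryD _ _ (isometry_sj j)) sj_fix.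
rewrite !(hm_dominant hM) // -(hm_comp_s hM) //; last first.
  by rewrite aact_translation /= ipC tj0 subrr; exact: (apos_simple hD (inl j)).
rewrite -(hm_s_comp hM) ?comm // => h Hh ph; rewrite aact_translation /ascale /= => -[h1 h2].
apply: (apos_asym hD (apos_simple hD (inl j))).
rewrite (_ : ascale _ _ = h) //; move: h1 h2; case: (h) => h1 h2 /= ->.
rewrite scaleN1r ipNl ipC tj0 mulr0 oppr0 subr0 => ->.
by rewrite /ascale /= scaleN1r mulr0.
Qed.

(** Reduced to the dominant case by Y^b with b dominant and orthogonal to alpha_j, which itself
    commutes with T_j. *)
Lemma ti_yl_comm j t g : L'all ip D t -> ip t (sroot j) = 0 -> tj j (yl t g) = yl t (tj j g).
Proof.
move=> ht tj0.
have [|b [hb db dtb bj]] := dominant_shift (c := predC1 j) ht.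
  by move=> l; rewrite negbK => /eqP ->; rewrite tj0.
have {}bj : ip b (sroot j) = 0 by apply: bj; rewrite negbK.
apply: (yl_inj hb); rewrite -ti_yl_comm_dominant // -!(hm_add hM) // [b + t]addrC.
by rewrite ti_yl_comm_dominant ?ipDl ?tj0 ?bj ?addr0 //; exact: L'allD.
Qed.

Lemma ti_yl_ti_dominant j t g : L'all ip D t -> dominant ip D t -> ip t (sroot j) = 1 ->
  tj j (yl (sj j t) (tj j g)) = yl t g.
Proof.
move=> ht dt tj1; have wt := Waff_translation ht; have ws := Waff_s hD (inl j).
(* T(x) is the intermediary: t(t) = x s_j gives T(x) T_j = Y^t, and x t(t) = s_j t(mu) with mu = t +
   s_j t gives T(x) Y^t = T_j Y^mu. Cancelling Y^t in the latter yields T(x) = T_j Y^(s_j t). *)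
pose x := translation t \o s_ ip (inl j); have wx : Waff ip D x by exact: Waff_comp.
pose mu := t + sj j t; have hmu : L'all ip D mu by apply: L'allD => //; exact: L'_sj.
have muj : ip mu (sroot j) = 0.
  by rewrite ipDl ip_sj refl_self ipNr subrr.
have dmu : dominant ip D mu.
  move=> b pb; have [->|bj] := pselect (b = sroot j); first by rewrite muj.
  by rewrite ipDl ip_sj addr_ge0 ?dt //; exact: Rpos_sj.
have xt : x \o translation t = s_ ip (inl j) \o translation mu.
  apply/funext => z; rewrite /x s_inl /translation /=.
  rewrite (isometryD t z (isometry_sj j)) (isometryD mu z (isometry_sj j)).
  by rewrite (sj_fix muj) /mu addrA.
have xs : x \o s_ ip (inl j) = translation t by exact: comp_s_K.
have aactx h : aact ip x h = (sj j h.1, h.2 - ip (sj j h.1) t).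
  by rewrite /x s_inl aactE //; exact: isometry_sj.
have e1 g' : tw x (tj j g') = yl t g'.
  rewrite -(hm_comp_s hM) // ?xs ?(hm_dominant hM) // aactx /=; left => /=.
  by rewrite refl_self ipNl ipC tj1; lra.
have e2 g' : tw x (yl t g') = tj j (yl (sj j t) (yl t g')).
  rewrite -(hm_add hM) //; last exact: L'_sj.
  rewrite [sj j t + t]addrC -/mu !(hm_dominant hM) //.
  rewrite -(hm_comp hM) //; last first.
    move=> h Hh ph; rewrite aactx !aact_translation /=; case: h Hh ph => b r [/= Rb rZ] ph.
    move=> nh.
    have pb : Rpos D b.
      case: (Rall_pos hD Rb) => // nb; exfalso.
      have bt : 0 <= - ip b t by rewrite -ipNl ipC dt.
      case: ph => /= [r0|[_ pb]]; last exact: (Rpos_asym hD pb nb).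
      by case: nh => /= [|[]]; lra.
    have [bj|bj] := pselect (b = sroot j); last first.
      have sbt : 0 <= ip (sj j b) t by rewrite ipC dt //; exact: Rpos_sj.
      left => /=; case: nh => /= [|[e nb]]; first by lra.
      by exfalso; move: nb; rewrite scaleN1r => /(Rpos_asym hD pb).
    (* Only alpha_j itself is left: t(t) maps it to alpha_j - c, and x maps this to -alpha_j, which
       is still negative. *)
    subst b; have sjt : ip (sroot j) t = 1 by rewrite ipC.
    move: nh; rewrite refl_self ipNl sjt; case=> /= [r1|[_ nb]]; last first.
      by exfalso; move: nb; rewrite scaleN1r => /(Rpos_asym hD pb).
    have r0 : r = 0.
      have r0 : 0 <= r by case: ph => /= [/ltW|[->]].
      case/intrP: rZ r0 r1 => z -> z0 z1.
      have {}z0 : (0 <= z)%R by rewrite -(ler0z R).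
      have : z%:~R < 1 :> R by lra.
      rewrite ltrz1 => {}z1; have -> : z = 0 by lia.
      by [].
    right; rewrite r0 /=; split; first by lra.
    by rewrite scaleN1r opprK.
  rewrite xt (hm_s_comp hM) //; first exact: Waff_translation.
  move=> h Hh ph; rewrite aact_translation /ascale /= => -[h1 h2].
  apply: (apos_asym hD (apos_simple hD (inl j))).
  rewrite (_ : ascale _ _ = h) //; move: h1 h2; case: (h) => h1 h2 /= ->.
  rewrite scaleN1r ipNl ipC muj mulr0 oppr0 subr0 => ->.
  by rewrite /ascale /= scaleN1r mulr0.
by rewrite -[in LHS](ylKN (tj j g) ht) -e2 ylKN // e1.
Qed.

Lemma ti_yl_ti j t g : L'all ip D t -> ip t (sroot j) = 1 ->
  tj j (yl (sj j t) (tj j g)) = yl t g.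
Proof.
move=> ht tj1; have hst := L'_sj j ht.
have [|b [hb db dtb bj]] := dominant_shift (c := predC1 j) ht.
  by move=> l; rewrite negbK => /eqP ->; rewrite tj1.
have {}bj : ip b (sroot j) = 0 by apply: bj; rewrite negbK.
apply: (yl_inj hb); rewrite -ti_yl_comm // -!(hm_add hM) // [b + t]addrC.
rewrite -(@ti_yl_ti_dominant j (t + b)) //; last first.
- by rewrite ipDl tj1 bj addr0.
- exact: L'allD.
by rewrite (isometryD _ _ (isometry_sj j)) (sj_fix bj) [b + _]addrC.
Qed.

(** T_i^-1, read off the quadratic relation. *)
Definition ti_inv i g : M := ti i g - a i *: g.

Lemma ti_invK i g : ti i (ti_inv i g) = g.
Proof.
rewrite (linear_fB (hm_Ti_linear i)) (linear_fZ (hm_Ti_linear i)) (hm_quadratic hM).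
by rewrite addrAC subrr add0r.
Qed.

Lemma ti_Kinv i g : ti_inv i (ti i g) = g.
Proof. by rewrite /ti_inv (hm_quadratic hM) addrAC subrr add0r. Qed.

Definition commutes_sym j t : Prop := forall g,
  tj j (yl t g + yl (sj j t) g) = yl t (tj j g) + yl (sj j t) (tj j g).

(** The relation gives T_j Y^(s_j t) = Y^t T_j^-1 and Y^(s_j t) T_j = T_j^-1 Y^t. Since T_j^-1 is
    T_j minus a scalar, the same multiple of Y^t is subtracted on both sides. *)
Lemma commutes_sym_ti_yl_ti j t : L'all ip D t ->
  (forall g, tj j (yl (sj j t) (tj j g)) = yl t g) -> commutes_sym j t.
Proof.
move=> ht e g; have hst := L'_sj j ht; have lt := yl_linear ht.
have e1 : tj j (yl (sj j t) g) = yl t (tj j g) - a (inl j) *: yl t g.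
  by rewrite -[in LHS](ti_invK (inl j) g) e /ti_inv (linear_fB lt) (linear_fZ lt).
have e2 : yl (sj j t) (tj j g) = tj j (yl t g) - a (inl j) *: yl t g.
  by rewrite -[LHS](ti_Kinv (inl j)) e.
rewrite (linear_fD (hm_Ti_linear _)) e1 e2 addrCA.
by rewrite addrA.
Qed.

(* Y^t + Y^(s t) is a polynomial in Y^l + Y^(s l) with coefficients Y^n, s n = n:
   Y^t + Y^(s t) = (Y^l + Y^(s l)) (Y^(t-l) + Y^(s(t-l))) - (Y^r + Y^(s r)),
   r = t - l + s l. *)
Lemma commutes_sym_multiple j l c : L'all ip D l -> ip l (sroot j) = c ->
  commutes_sym j l -> forall (n : nat) t, L'all ip D t -> ip t (sroot j) = n%:R * c ->
  commutes_sym j t.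
Proof.
move=> hl lc Cl; have hsl := L'_sj j hl; have isj := isometry_sj j.
have lti := hm_Ti_linear (inl j).
(* Strong induction: for the pairing (n + 2)c, the weights t - l and t - l + s_j l have pairings (n
   + 1)c and nc. *)
move=> n; have [N] := ubnP n; elim: N n => // N IH [|[|n]] nN t ht tn g.
- have tj0 : ip t (sroot j) = 0 by rewrite tn mul0r.
  by rewrite (sj_fix tj0) (linear_fD lti) !ti_yl_comm.
- have hn : L'all ip D (t - l) by apply: L'allD => //; exact: L'allN.
  have nj : ip (t - l) (sroot j) = 0 by rewrite ipBl tn lc mul1r subrr.
  have stE : sj j t = (t - l) + sj j l.
    by rewrite -[in LHS](subrK l t) (isometryD _ _ isj) (sj_fix nj).
  have yt g' : yl t g' = yl (t - l) (yl l g') by rewrite -(hm_add hM) // subrK.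
  have yst g' : yl (sj j t) g' = yl (t - l) (yl (sj j l) g').
    by rewrite stE (hm_add hM).
  by rewrite !yt !yst -!(linear_fD (yl_linear hn)) ti_yl_comm // Cl.
have ht1 : L'all ip D (t - l) by apply: L'allD => //; exact: L'allN.
have hr : L'all ip D ((t - l) + sj j l) by exact: L'allD.
have hst1 := L'_sj j ht1.
have C1 : commutes_sym j (t - l).
  apply: (IH n.+1) => //.
  by rewrite ipBl tn lc -[in RHS]addn1 -[n.+2]addn1 -[n.+1]addn1 !natrD; ring.
have Cr : commutes_sym j ((t - l) + sj j l).
  apply: (IH n) => //; first exact: ltnW.
  by rewrite ipDl ipBl tn ip_sj refl_self ipNr lc -[n.+2]addn1 -[n.+1]addn1 !natrD; ring.
have srE : sj j ((t - l) + sj j l) = sj j (t - l) + l.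
  by rewrite (isometryD _ _ isj) reflK.
have stE : sj j t = sj j (t - l) + sj j l by rewrite -(isometryD _ _ isj) subrK.
have key g' : yl t g' + yl (sj j t) g' =
  (yl l (yl (t - l) g' + yl (sj j (t - l)) g') + yl (sj j l) (yl (t - l) g' + yl (sj j (t - l)) g'))
  - (yl ((t - l) + sj j l) g' + yl (sj j ((t - l) + sj j l)) g').
  rewrite !(linear_fD (yl_linear _)) // srE stE -!(hm_add hM) //.
  rewrite [l + (t - l)]addrC subrK [sj j l + sj j (t - l)]addrC [l + sj j _]addrC.
  rewrite [sj j l + (t - l)]addrC.
  set A := yl t g'; set B := yl (_ + l) g'; set C := yl (t - l + _) g'; set E := yl _ g'.
  by rewrite [C + E]addrC addrACA [C + B]addrC addrK.
rewrite key (linear_fB lti) Cl C1 Cr.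
by rewrite -key.
Qed.

End Bernstein.

(** * Long simple roots of type C_n and the commutation relation for every simple root *)

Section BernsteinRelation.
Context {R : realType} {V : vectType R} (ip : {dot V for idfun}).
Context {m : nat} (D : 'I_m -> component V) (hD : duality_data ip D).
Local Notation Rc j := (shape_R (shp (D j))).
Local Notation H := (S_of (Rall D)).
Context {K : fieldType} (M : lmodType K).
Context (a : Iaff D -> K) (tw : (V -> V) -> M -> M) (yl : V -> M -> M).
Hypothesis hM : hecke_module ip a tw yl.
Local Notation ti i := (tw (s_ ip i)).
Local Notation tj j := (tw (s_ ip (inl j))).
Local Notation tinv i := (ti_inv ip a tw i).
Local Notation sj j := (refl ip (sroot j)).
Local Notation Csym j t := (commutes_sym ip tw yl j t).
Implicit Types (t x y b : V) (u w : V -> V) (h : aff V) (i : Iaff D) (j : I0 D) (g : M).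

Lemma s_inr c : s_ ip (inr c : Iaff D) = translation (coroot ip (top (D c))) \o refl ip (top (D c)).
Proof.
rewrite (s_E hD) srefl_translation /= reflN corootN.
by rewrite scalerN scaleN1r opprK.
Qed.

Section LongRoots.
Context (c : 'I_m) (n : nat) (eps : 'I_n -> V) (cE : shp (D c) = CaseIII eps).

Lemma caseIII_orthonormal (i k : 'I_n) : ip (eps i) (eps k) = (i == k)%:R.
Proof. by have [wf _ _] := comp_wf hD c; move: wf; rewrite cE => -[_ ->]. Qed.
Local Notation epsP := caseIII_orthonormal.

Lemma caseIII_Cn b : Rc c b = Cn_roots eps b.
Proof. by rewrite cE. Qed.

Lemma long_coroot b : Rc c b -> ip b b = 4 ->
  [/\ signed_eps eps (coroot ip b) & b = 2 *: coroot ip b].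
Proof.
rewrite caseIII_Cn => Cb b4; have bE : b = 2 *: coroot ip b.
  by rewrite Cn_coroot_long // scalerA mulfV ?scale1r // pnatr_eq0.
split=> //; case: (Cn_cases epsP Cb) => [[u Eu bu]|[u [v [Eu Ev uv bu]]]].
  by rewrite Cn_coroot_long // bu scalerA mulVf ?scale1r // pnatr_eq0.
move: b4; rewrite bu !ipE (ipC _ v) uv !(signed_eps_ip epsP) //; lra.
Qed.

(** Let phi be the highest root. Dominance of b gives <b, phi - b> >= 0, so <b, phi> >= 4; as phi
    has squared length at most 4, the squared length of phi - b is at most 4 - 8 + 4 = 0. *)
Lemma long_dominant_top b : Rc c b -> ip b b = 4 -> (forall j, 0 <= ip b (sroot j)) ->
  b = top (D c).
Proof.
move=> cb b4 pb; have [d [dN _ dE]] := top_cone hD cb.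
have bt : 0 <= ip b (top (D c) - b).
  rewrite dE ip_sumr sumr_ge0 // => j _.
  by rewrite ipZr mulr_ge0 ?(natr_ge0 (dN j)).
have tt : ip (top (D c)) (top (D c)) <= 4.
  have := comp_top hD c; rewrite caseIII_Cn => /(Cn_ip epsP).
  by case=> ->; lra.
apply/esym/eqP; rewrite -subr_eq0 -(ip_eq0 ip) eq_le ip_ge0 andbT.
move: bt; rewrite !ipE (ipC ip (top _) b); lra.
Qed.

(** Write b = 2e with e a signed basis vector. A long simple root pairing negatively with e would be
    -b, which is not positive; hence the simple root is a short u + v with u or v equal to -e. *)
Lemma long_simple_pairing b j : Rc c b -> Rpos D b -> ip b b = 4 -> ip b (sroot j) < 0 ->
  ip (coroot ip b) (sroot j) = -1 /\ ip (sroot j) (sroot j) = 2.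
Proof.
move=> cb pb b4 neg; have [Eb bE] := long_coroot cb b4.
have jc : tag j = c.
  apply/eqP; apply: contraT => jc.
  by move: neg; rewrite ipC (comp_orth hD jc (comp_sroot hD j) cb) ltxx.
have := comp_sroot hD j; rewrite jc caseIII_Cn.
set e := coroot ip b in Eb bE *; rewrite bE ipZl in neg.
have {}neg : ip e (sroot j) < 0 by lra.
case/(Cn_cases epsP) => [[u Eu jE]|[u [v [Eu Ev uv jE]]]].
  exfalso; move: neg; rewrite jE ipZr.
  case: (signed_eps_cases epsP Eb Eu) => [->|eu|->]; last by rewrite mulr0 ltxx.
    by rewrite (signed_eps_ip epsP) //; lra.
  move=> _; have := Rpos_sroot hD j; rewrite jE.
  by rewrite (_ : 2 *: u = - b) => [/(Rpos_asym hD pb)|]; last rewrite bE eu scalerN opprK.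
have uu := signed_eps_ip epsP Eu; have vv := signed_eps_ip epsP Ev.
have vu : ip v u = 0 by rewrite ipC.
split; last by rewrite jE !ipE uu vv uv vu; lra.
move: neg; rewrite jE ipDr.
case: (signed_eps_cases epsP Eb Eu) => [->|->|->].
- by rewrite uu uv; lra.
- by rewrite !ipNl uu uv; lra.
case: (signed_eps_cases epsP Eb Ev) => [->|->|->].
- by rewrite vv; lra.
- by rewrite !ipNl vv; lra.
- by lra.
Qed.

Lemma ti_inv_linear i : linear (tinv i).
Proof.
move=> d g g'; rewrite /ti_inv (hm_linear hM) ?Waff_s //; last exact: Waff_s.
by rewrite scalerDr scalerBr !scalerA mulrC opprD addrACA.
Qed.

(* Y^(b^vee) = X T(s_b), where X is conjugate to T_0: start from the highest
   root and descend along simple reflections. *)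
Lemma long_root_operator b : Rc c b -> Rpos D b -> ip b b = 4 ->
  exists X : M -> M, [/\ linear X, forall g, X (X g) = a (inr c) *: X g + g &
    forall g, yl (coroot ip b) g = X (tw (refl ip b) g)].
Proof.
have [x xP] := dual_point hD (fun=> 1).
have x0 j : 0 < ip (sroot j) x by rewrite xP.
have pos b' : Rall D b' -> 0 < ip b' x -> Rpos D b'.
  move=> Rb' bx; case: (Rall_pos hD Rb') => // /(Rpos_gt0 hD x0).
  by rewrite ipNl; lra.
(* Induction on the height of phi - b, phi the highest root: every simple root takes the value 1 at
   [x]. *)
suff ht N : forall b, Rc c b -> Rpos D b -> ip b b = 4 -> ip (top (D c) - b) x < N%:R ->
    exists X : M -> M, [/\ linear X, forall g, X (X g) = a (inr c) *: X g + g &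
    forall g, yl (coroot ip b) g = X (tw (refl ip b) g)].
  move=> cb pb b4; apply: (ht (Num.bound (ip (top (D c) - b) x))) => //.
  apply: archi_boundP; have [d [dN _ ->]] := top_cone hD cb.
  by rewrite ip_suml sumr_ge0 // => j _; rewrite ipZl xP mulr1 (natr_ge0 (dN j)).
elim: N => {b} [|N IH] b cb pb b4 bN.
  have [d [dN _ dE]] := top_cone hD cb; move: bN; rewrite dE ip_suml ltNge sumr_ge0 //.
  by move=> j _; rewrite ipZl xP mulr1 (natr_ge0 (dN j)).
have Rb : Rall D b by exists c.
have wb := Waff_W0 (W0_refl ip Rb).
have [[j neg]|dom] := pselect (exists j, ip b (sroot j) < 0); last first.
  have {}dom j : 0 <= ip b (sroot j).
    by rewrite leNgt; apply/negP => bj; apply: dom; exists j.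
  have bE := long_dominant_top cb b4 dom; have hL := L'all_coroot hD Rb.
  (* At the highest root X is T_0 itself: t(phi^vee) = s_0 s_phi, and the lengths add up. *)
  exists (ti (inr c : Iaff D)); split; first exact: (hm_Ti_linear hD hM).
    exact: (hm_quadratic hM).
  move=> g; rewrite (hm_dominant hM) //; last first.
    apply/(dominantP hD) => j; rewrite ipZl mulr_ge0 //.
    by rewrite divr_ge0 ?ip_ge0.
  rewrite -(hm_s_comp hM) //.
    congr (tw _ g); rewrite s_inr -bE; apply/funext => z /=.
    by rewrite reflK.
  move=> h Hh ph; rewrite aact_linear /ascale /=; last exact: isometry_refl.
  move=> -[_ h2]; case: ph; rewrite h2 mulr1; first by lra.
  by case; lra.
have [bj jj] := long_simple_pairing cb pb b4 neg.
have bneq : b <> sroot j by move=> e; move: neg; rewrite -e b4; lra.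
(* The root s_j b = b + 2 alpha_j is closer to the highest root. *)
pose g0 := sj j b; have Rj := Rall_sroot hD j.
have cg0 : Rc c g0 by apply: (comp_refl hD).
have pg0 : Rpos D g0 by exact: (Rpos_sj hD pb bneq).
have g4 : ip g0 g0 = 4 by rewrite refl_isometric.
have jb : ip (sroot j) (coroot ip b) = -1 by rewrite ipC.
have rbj : refl ip b (sroot j) = sroot j + b.
  by rewrite reflE' jb scaleN1r opprK.
have crj : coroot ip (sroot j) = sroot j by exact: Cn_coroot_short.
have [_ bE] := long_coroot cb b4.
have bj2 : ip b (sroot j) = -2 by rewrite bE ipZl bj; lra.
have g0E : g0 = b + 2 *: sroot j by rewrite /g0 reflE' crj bj2 scaleNr opprK.
have bx : 0 < ip b x by apply: (Rpos_gt0 hD x0).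
have [X [lX X2 XP]] : exists X : M -> M,
    [/\ linear X, forall g, X (X g) = a (inr c) *: X g + g &
        forall g, yl (coroot ip g0) g = X (tw (refl ip g0) g)].
  apply: IH => //; rewrite g0E opprD addrA ipBl ipZl xP.
  by move: bN; rewrite -addn1 natrD; lra.
have tK := ti_invK hD hM (inl j); have Kt := ti_Kinv hM (inl j).
have lti := hm_Ti_linear hD hM (inl j); have lt' := ti_inv_linear (inl j).
have isj := isometry_sj ip j.
have cg : coroot ip g0 = sj j (coroot ip b) by rewrite isometry_coroot.
have hg0 : L'all ip D (coroot ip g0) by apply: (L'all_coroot hD); exists c.
have refl_g0 : refl ip g0 = s_ ip (inl j) \o (refl ip b \o s_ ip (inl j)).
  apply/funext => z; rewrite (s_inl hD) /=.
  by have := congr1 (@^~ (sj j z)) (isometry_reflJ b isj); rewrite /= reflK.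
have ws := Waff_s hD (inl j); have wbs := Waff_comp hD wb ws.
(* The word s_j s_b s_j for the reflection in [g0] has additive lengths because s_b alpha_j =
   alpha_j + b is positive. *)
have twg g : tw (refl ip g0) g = tj j (tw (refl ip b) (tj j g)).
  rewrite refl_g0 (hm_s_comp hM) //.
    rewrite (hm_comp_s hM) // aact_linear /=; last exact: isometry_refl.
    right; split=> //=; apply: pos; first exact: (Rall_refl hD Rb Rj).
    by rewrite rbj ipDl xP; lra.
  move=> h Hh ph; rewrite (aact_Waff_comp _ wb ws) (aact_sj hD).
  rewrite aact_linear /ascale /=; last exact: isometry_refl.
  move=> [h1 h2]; have h1E : h.1 = - (b + sroot j).
    rewrite -[h.1](reflK ip (sroot j)) -[sj j h.1](reflK ip b) h1 scaleN1r.
    rewrite (isometryN _ (isometry_refl ip b)) (isometryN _ isj) rbj.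
    rewrite (isometryD _ _ isj) refl_self -/g0 g0E scaler_nat mulr2n.
    by rewrite addrCA addKr.
  case: ph; rewrite h2 mulr0 ?ltxx // => -[_].
  by rewrite h1E => /(Rpos_gt0 hD x0); rewrite ipNl ipDl xP; lra.
(* X is conjugated by T_j: with g0^vee = s_j b^vee, T_j Y^(b^vee) T_j = Y^(g0^vee) = X T_j T(s_b)
   T_j, whence Y^(b^vee) = (T_j^-1 X T_j) T(s_b). *)
exists (fun g => tinv (inl j) (X (tj j g))); split.
- by move=> d g g'; rewrite lti lX lt'.
- by move=> g; rewrite tK X2 lt' Kt.
move=> g; rewrite -[in RHS](tK g) -twg -XP.
have gj : ip (coroot ip g0) (sroot j) = 1.
  by rewrite cg ip_sj refl_self ipNr bj opprK.
by rewrite -[in RHS](ti_yl_ti hD hM _ hg0 gj) Kt tK cg reflK.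
Qed.

(** Here s_j l = -l, Y^l = X T_j and Y^(-l) = T_j^-1 (X - a_0), with a_0 = [a (inr c)]. Multiplied
    by T_j on either side, Y^l + Y^(-l) becomes T_j X T_j + X - a_0. *)
Lemma commutes_sym_long j : tag j = c -> ip (sroot j) (sroot j) = 4 ->
  Csym j (coroot ip (sroot j)).
Proof.
move=> jc j4; have cj := comp_sroot hD j; rewrite jc in cj.
have [X [lX X2 XP]] := long_root_operator cj (Rpos_sroot hD j) j4.
set l := coroot ip (sroot j) in XP *.
have hl : L'all ip D l by apply: (L'all_coroot hD); exact: (Rall_sroot hD).
have sl : sj j l = - l.
  rewrite /l (isometry_coroot _ (isometry_sj ip j)) refl_self corootN //.
have {}XP g : yl l g = X (tj j g) by rewrite XP (s_inl hD).
have tK := ti_invK hD hM (inl j); have Kt := ti_Kinv hM (inl j).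
have lti := hm_Ti_linear hD hM (inl j); have lt' := ti_inv_linear (inl j).
pose X' g := X g - a (inr c) *: g.
have XX' g : X (X' g) = g by rewrite (linear_fB lX) (linear_fZ lX) X2 addrAC subrr add0r.
have ylN g : yl (- l) g = tinv (inl j) (X' g).
  by apply: (yl_inj hM hl); rewrite (ylKN hM) // XP tK XX'.
move=> g; rewrite sl !ylN !XP (linear_fD lti) tK.
rewrite /X' (linear_fB lt') (linear_fZ lt') Kt /ti_inv.
rewrite (hm_quadratic hM) (linear_fD lX) (linear_fZ lX).
set A := X (tj j g); set B := a (inl j) *: A; set P := tj j A.
by rewrite [RHS]addrA [P - B]addrC addrACA subrr add0r addrA [X g + P]addrC.
Qed.

End LongRoots.

Lemma commutes_sym_refl j t : Csym j (sj j t) -> Csym j t.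
Proof. by move=> C g; have := C g; rewrite reflK addrC => ->; rewrite addrC. Qed.

(** A negative pairing becomes positive on exchanging t with s_j t, under which the sum Y^t + Y^(s_j
    t) is symmetric. *)
Lemma pairing_multiple_commutes j l d : L'all ip D l -> ip l (sroot j) = d -> Csym j l ->
  (forall t, L'all ip D t -> exists2 z, z \is a Num.int & ip t (sroot j) = z * d) ->
  forall t, L'all ip D t -> Csym j t.
Proof.
move=> hl ld Cl mult t ht; have [_ /intrP[[z|z] ->] tz] := mult t ht.
  exact: (commutes_sym_multiple hD hM hl ld Cl (n := z)).
apply: commutes_sym_refl; apply: (commutes_sym_multiple hD hM hl ld Cl (n := z.+1)).
  exact: (L'_sj hD).
by rewrite ip_sj refl_self ipNr tz NegzE mulrNz mulNr opprK.
Qed.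

Lemma bernstein_relation j t : L'all ip D t -> Csym j t.
Proof.
have one l : L'all ip D l -> ip l (sroot j) = 1 -> forall t, L'all ip D t -> Csym j t.
  move=> hl l1; apply: (pairing_multiple_commutes hl l1).
    apply: (commutes_sym_ti_yl_ti hD hM hl) => g; exact: (ti_yl_ti hD hM).
  move=> s hs; exists (ip s (sroot j)); rewrite ?mulr1 //.
  exact: (L'all_ip_int hD hs (Rall_sroot hD j)).
have cj := comp_sroot hD j; have Rj := Rall_sroot hD j; move: t.
have weight : (if shp (D (tag j)) is CaseIII _ _ then False else True) ->
    forall t, L'all ip D t -> Csym j t.
  (* The component of the fundamental coweight of j lies in L' and pairs to 1 with alpha_j. *)
  move=> nIII; have [x xP] := dual_point hD (fun l => (l == j)%:R).
  have xZ : forall b, Rall D b -> ip x b \is a Num.int.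
    by apply: (Rall_ip_int hD) => i; rewrite xP; exact: natr_int.
  have [f [_ fx _ fL]] := coweight_decomposition hD xZ.
  apply: (one (f (tag j))); first exact/L'all_comp/fL.
  by rewrite fx // ipC xP eqxx.
case E: (shp (D (tag j))) => [P|P|n eps]; try by apply: weight; rewrite E.
have epsP := caseIII_orthonormal E; have := cj; rewrite (caseIII_Cn E).
case/(Cn_cases epsP) => [[u Eu jE]|[u [v [Eu Ev uv jE]]]]; last first.
  (* For a short root u + v, the vector u is the coroot of 2u, hence in L', and pairs to 1. *)
  apply: (one u); last by rewrite jE ipDr (signed_eps_ip epsP) // uv addr0.
  rewrite -(corootK ip u) (_ : coroot ip u = 2 *: u); last first.
    by rewrite /coroot (signed_eps_ip epsP) // divr1.
  by apply: (L'all_coroot hD); exists (tag j); rewrite (caseIII_Cn E); exact: Cn_long.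
have j4 : ip (sroot j) (sroot j) = 4 by rewrite jE !ipE (signed_eps_ip epsP) //; lra.
apply: (pairing_multiple_commutes (l := coroot ip (sroot j)) (d := 2)).
- exact: (L'all_coroot hD).
- by rewrite ipC ip_coroot // (comp_neq0 hD cj).
- exact: (commutes_sym_long E).
(* All pairings with alpha_j = 2u are even, because coroots, which span L' in this component, pair
   integrally with u. *)
move=> _ [f fL ->]; exists (ip (\sum_k f k) u); last by rewrite jE ipZr mulrC.
rewrite ip_suml rpred_sum // => k _.
have [->|kj] := eqVneq k (tag j); last first.
  have := span_orth hD _ cj (L'c_span (fL k)); rewrite eq_sym => /(_ kj).
  rewrite jE ipZl => /eqP; rewrite mulf_eq0 pnatr_eq0 /= ipC => /eqP ->.
  exact: rpred0.
have := fL (tag j); rewrite E /=; move: (f (tag j)); apply: comb_ind.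
  by rewrite ip0l rpred0.
move=> d _ z dZ [b Cb <-] zZ; rewrite ipDl ipZl rpredD ?rpredM // ipC.
exact: (signed_eps_coroot_int epsP).
Qed.

End BernsteinRelation.

(** * Invariant polynomials in Y commute with T(w) for w in W_J *)

Section InvariantPolynomials.
Context {R : realType} {V : vectType R} (ip : {dot V for idfun}).
Context {m : nat} (D : 'I_m -> component V) (hD : duality_data ip D).
Local Notation H := (S_of (Rall D)).
Local Notation aneg h := (apos D (ascale (-1) h)).
Context {K : fieldType} (M : lmodType K) (hK : [pchar K] =i pred0).
Context (q : R -> K).
Hypothesis q_neq0 : forall x, q x != 0.
Hypothesis qD : forall x y, q (x + y) = q x * q y.
Context (a : Iaff D -> K) (tw : (V -> V) -> M -> M) (yl : V -> M -> M).
Hypothesis hM : hecke_module ip a tw yl.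
Local Notation tj j := (tw (s_ ip (inl j))).
Local Notation sj j := (refl ip (sroot j)).
Implicit Types (f : KV V K) (j : I0 D) (w : V -> V) (g : M).

Definition poly_act f g : M := \sum_(t <- msupp f) f@_t *: yl t g.

Lemma poly_act_linear f : supported (L'all ip D) f -> linear (poly_act f).
Proof.
move=> hf c g g'; rewrite /poly_act scaler_sumr -big_split /= big_seq [RHS]big_seq.
apply: eq_bigr => t tf; rewrite (yl_linear hD hM (hf t tf)) scalerDr !scalerA.
by rewrite mulrC.
Qed.

Lemma mcoeff_gact_sj j f t : (gact ip q (s_ ip (inl j)) f)@_(sj j t) = f@_t.
Proof.
have isj := isometry_refl ip (sroot j).
rewrite gactE /mextend raddf_sum /= [in RHS](monalgE f) raddf_sum /=.
apply: eq_bigr => x _; rewrite (s_inl hD) aact_linear // mcoeffZ /e_ /= !mcoeffU.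
rewrite (inj_eq (inv_inj (reflK ip _))) (q0 q_neq0 qD).
by case: eqP; rewrite ?mulr1 ?mulr0.
Qed.

Lemma poly_act_sym j f g : gact ip q (s_ ip (inl j)) f = f ->
  poly_act f g = \sum_(t <- msupp f) f@_t *: yl (sj j t) g.
Proof.
move=> fj; have fE t : f@_(sj j t) = f@_t by rewrite -[in LHS]fj mcoeff_gact_sj.
have injs : injective (sj j) := inv_inj (reflK ip (sroot j)).
rewrite /poly_act; have perm : perm_eq (msupp f) (map (sj j) (msupp f)).
  apply: uniq_perm; rewrite ?map_inj_uniq ?fset_uniq // => t.
  rewrite -mcoeff_neq0 -[t in RHS](reflK ip (sroot j)) mem_map // -[in LHS]fE.
  by rewrite mcoeff_neq0.
by rewrite (perm_big _ perm) big_map; apply: eq_bigr => t _; rewrite fE.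
Qed.

Lemma poly_act_ti j f g : supported (L'all ip D) f -> gact ip q (s_ ip (inl j)) f = f ->
  tj j (poly_act f g) = poly_act f (tj j g).
Proof.
move=> hf fj; have lt := hm_Ti_linear hD hM (inl j).
(* Invariance allows f(Y) to be averaged over s_j; the factor 2 is cancelled in characteristic 0. *)
have sumE g' : poly_act f g' *+ 2 = \sum_(t <- msupp f) f@_t *: (yl t g' + yl (sj j t) g').
  rewrite mulr2n [X in _ + X](poly_act_sym _ fj) /poly_act -big_split /=.
  by apply: eq_bigr => t _; rewrite scalerDr.
have n2 : (2%:R : K) != 0 by have := hK 2; rewrite inE /= => /negbT.
apply: (scalerI n2); rewrite -(linear_fZ lt) !scaler_nat !sumE.
rewrite (big_morph _ (linear_fD lt) (linear_f0 lt)) big_seq [RHS]big_seq.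
apply: eq_bigr => t tf; rewrite (linear_fZ lt).
by rewrite (bernstein_relation hD hM j (hf t tf)).
Qed.

Lemma poly_act_ti_inv j f g : supported (L'all ip D) f -> gact ip q (s_ ip (inl j)) f = f ->
  ti_inv ip a tw (inl j) (poly_act f g) = poly_act f (ti_inv ip a tw (inl j) g).
Proof.
move=> hf fj; have lf := poly_act_linear hf.
by rewrite /ti_inv (linear_fB lf) (linear_fZ lf) poly_act_ti.
Qed.

(* A word need not be reduced here: T(w s_j) is T(w) T_j or T(w) T_j^-1. *)
Lemma poly_act_tw (J : {set I0 D}) f w g : A'J ip q J f -> WJ ip J w ->
  tw w (poly_act f g) = poly_act f (tw w g).
Proof.
move=> [hf invf] [s [sJ wE]]; move: s sJ w wE g.
have fj j : j \in J -> gact ip q (s_ ip (inl j)) f = f.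
  move=> jJ; apply: invf; exists [:: j]; split=> // l; rewrite inE => /eqP -> //.
apply: last_ind => [_ _ -> g|s j IH sJ _ -> g] /=.
  have h1 : Waff ip D id := Waff_id ip D.
  (* T(id) is the identity because it is Y^0. *)
  have t1 g' : tw id g' = g'.
    rewrite (_ : id = translation (0 : V)); last first.
      by apply/funext => x; rewrite /translation add0r.
    rewrite -(hm_dominant hM) ?(hm_0 hM) //; first exact: L'all0.
    by move=> b _; rewrite ip0l.
  by rewrite !t1.
have jJ : j \in J by apply: sJ; rewrite mem_rcons mem_head.
have {}IH := IH (fun l ls => sJ l (mem_subseq (subseq_rcons _ _) ls)) _ erefl.
set w := prod_s ip (map inl s) in IH.
have hw : Waff ip D w by exact: Waff_prod_s.
have -> : prod_s ip (map inl (rcons s j)) = w \o s_ ip (inl j).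
  by rewrite map_rcons -cats1 prod_s_cat.
have hws := Waff_comp hD hw (Waff_s hD (inl j)).
have [pw|nw] := apos_total hD (Waff_H hD hw (H_simple hD (inl j))).
  by rewrite !(hm_comp_s hM) // (poly_act_ti _ hf (fj j jJ)) IH.
have pws : apos D (aact ip (w \o s_ ip (inl j)) (hsimple (inl j))).
  by rewrite (aact_Waff_comp _ hw (Waff_s hD (inl j))) aact_s_simple // (aactN _ hw).
have twE g' : tw (w \o s_ ip (inl j)) g' = tw w (ti_inv ip a tw (inl j) g').
  rewrite -[in LHS](ti_invK hD hM (inl j) g') -(hm_comp_s hM) //.
  by rewrite comp_s_K.
by rewrite !twE poly_act_ti_inv // ?IH //; exact: fj.
Qed.

End InvariantPolynomials.

(** * K[L] as a Hecke module, and the eigenvalue equation *)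

Section HeckeModuleKL.
Context {R : realType} {V : vectType R} (ip : {dot V for idfun}).
Context {m : nat} (D : 'I_m -> component V) (hD : duality_data ip D).
Context (k : aff V -> R) (hk : labelling ip D k).
Context {K : fieldType} (q : R -> K).
Hypothesis q_neq0 : forall x, q x != 0.
Hypothesis qD : forall x y, q (x + y) = q x * q y.
Context (Ti : Iaff D -> KV V K -> KV V K) (hTi : is_Ti ip q k Ti).
Context (T : (V -> V) -> KV V K -> KV V K) (hT : is_T ip q Ti T).
Context (Y : V -> KV V K -> KV V K) (hY : is_Y ip D T Y).

Lemma hecke_module_KL : @hecke_module R V ip m D K (KL ip D K)
  (fun i => tau ip D q k (asimple ip i) - (tau ip D q k (asimple ip i))^-1)
  (@KL_T R V ip m D K T) (@KL_Y R V ip m D K Y).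
Proof.
split.
- by move=> w; exact: (KL_T_linear hD q_neq0 qD hTi hT).
- by move=> i g; exact: (KL_Ti_quadratic hD q_neq0 qD hTi hT).
- by move=> u w g; exact: (KL_T_comp hD hk q_neq0 qD hTi hT).
- by move=> w i g; exact: (KL_T_comp_s hD hk q_neq0 qD hTi hT).
- by move=> w i g; exact: (KL_T_s_comp hD hk q_neq0 qD hTi hT).
- by move=> t g; exact: (KL_Y_dominant hD hTi hT hY).
- by move=> g; exact: (KL_Y0 hY).
- by move=> t t' g; exact: (KL_YD hY).
Qed.

Lemma val_KLZ c (g : KL ip D K) : val (c *: g) = c *: val g.
Proof. exact: linearZ. Qed.

Lemma val_KL_sum I (r : seq I) (F : I -> KL ip D K) :
  val (\sum_(i <- r) F i) = \sum_(i <- r) val (F i).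
Proof. exact: linear_sum. Qed.

Lemma val_poly_act f g : supported (L'all ip D) f ->
  val (poly_act (@KL_Y R V ip m D K Y) f g) = polyY Y f (val g).
Proof.
move=> hf; rewrite /poly_act val_KL_sum /polyY big_seq [RHS]big_seq.
by apply: eq_bigr => t tf; rewrite val_KLZ (val_KL_Y hY) //; exact: hf.
Qed.

End HeckeModuleKL.

(** A sum over W_J becomes a sum over a list of elements of W_J; an infinite support gives the empty
    list by convention. *)
Lemma fsbig_seq (T : choiceType) (M : nmodType) (A : set T) (F : T -> M) :
  exists2 r : seq T, (forall x, x \in r -> A x) &
    \sum_(x \in A) F x = \sum_(x <- r) F x.
Proof.
exists (finite_support 0 A F); last by [].
move=> x; have [fin|inf] := pselect (finite_set (A `&` F @^-1` [set~ 0])).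
  by rewrite in_finite_support // inE => -[].
by rewrite no_finite_support // => /inf.
Qed.

Theorem corollary4p3
  (R : realType) (V : vectType R) (ip : {dot V for idfun})
  (m : nat) (D : 'I_m -> component V) (hD : duality_data ip D)
  (k k' : aff V -> R)
  (hk : labelling ip D k) (hk' : dual_labelling ip D k k')
  (hr : forall l mu, Lall ip D l -> Lall ip D mu ->
          r_ ip D k' l = r_ ip D k' mu -> l = mu)
  (K : fieldType) (hK : [pchar K] =i pred0)
  (q : R -> K) (q_neq0 : forall x, q x != 0)
  (qD : forall x y, q (x + y) = q x * q y)
  (q_transc : forall x, x != 0 -> ~ algebraicOver (ratr : rat -> K) (q x))
  (Ti : Iaff D -> KV V K -> KV V K) (hTi : is_Ti ip q k Ti)
  (T : (V -> V) -> KV V K -> KV V K) (hT : is_T ip q Ti T)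
  (Y : V -> KV V K -> KV V K) (hY : is_Y ip D T Y)
  (E : V -> KV V K) (hE : is_E ip D q k' Y E)
  (J : {set I0 D}) (eps : (V -> V) -> int) (heps : mult_character ip J eps)
  (l : V) (hl : Lall ip D l) (f : KV V K) (hf : A'J ip q J f) :
  polyY Y f (UJ ip q k J eps T (E l)) =
    evalq ip q f (- r_ ip D k' l) *: UJ ip q k J eps T (E l).
Proof.
have hM := hecke_module_KL hD hk q_neq0 qD hTi hT hY.
have [El1 Elow Eeig] := hE l hl.
have sE : supported (Lall ip D) (E l).
  by move=> x xE; have [->//|xl] := pselect (x = l); have [] := Elow x xE xl.
have [hfL _] := hf.
pose g0 := to_KL ip D (E l); have g0E : val g0 = E l by exact: to_KLK.
have wJ w : WJ ip J w -> Waff ip D w by move=> [s [_ ->]]; exact: Waff_prod_s.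
have [r rJ rE] := fsbig_seq (WJ ip J)
  (fun w => tauw ip q k J eps w *: T w (E l)).
pose G : KL ip D K := (tauw ip q k J eps (longest ip D (WJ ip J)))^-1 *:
  \sum_(w <- r) tauw ip q k J eps w *: @KL_T R V ip m D K T w g0.
have -> : UJ ip q k J eps T (E l) = val G.
  rewrite /UJ rE val_KLZ val_KL_sum big_seq [in RHS]big_seq.
  congr (_ *: _); apply: eq_bigr => w wr; rewrite val_KLZ.
  by rewrite (val_KL_T hD hTi hT) ?g0E //; exact/wJ/rJ.
rewrite -(val_poly_act hY) //; set c := evalq _ _ _ _.
rewrite -val_KLZ; congr val.
have g0eig : poly_act (@KL_Y R V ip m D K Y) f g0 = c *: g0.
  by apply: val_inj; rewrite (val_poly_act hY) // val_KLZ g0E; exact: Eeig.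
have lf := poly_act_linear hD hM hfL.
rewrite /G (linear_fZ lf) scalerA mulrC -scalerA; congr (_ *: _).
rewrite (big_morph _ (linear_fD lf) (linear_f0 lf)) scaler_sumr.
rewrite big_seq [RHS]big_seq; apply: eq_bigr => w wr.
rewrite (linear_fZ lf) -(poly_act_tw hD hK q_neq0 qD hM _ hf (rJ w wr)) g0eig.
by rewrite (linear_fZ (hm_linear hM (wJ w (rJ w wr)))) !scalerA mulrC.
Qed.
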